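(* Let $\Bbbk$ be a field. Then the contravariant functors of $\Bbbk$-characters groupoid $\mathscr{X}_{\Bbbk}:\mathsf{GTCHAlgd}_{\Bbbk}\to\mathsf{Grpd}$ and of $\Bbbk$-valued representative functions $\mathscr{R}_{\Bbbk}:\mathsf{Grpd}\to\mathsf{GTCHAlgd}_{\Bbbk}$, $\mathscr{G}\mapsto(\mathrm{M}_{\Bbbk}(\mathscr{G}_0),\mathscr{R}_{\Bbbk}(\mathscr{G}))$, establish a duality between the category $\mathsf{GTCHAlgd}_{\Bbbk}$ of geometrically transitive commutative Hopf algebroids over $\Bbbk$ and the category $\mathsf{Grpd}$ of discrete groupoids. That is, there is a natural isomorphism $$\mathrm{Hom}_{\mathsf{GTCHAlgd}_{\Bbbk}}\big((R,\mathcal{H}),\,(\mathrm{M}_{\Bbbk}(\mathscr{G}_0),\mathscr{R}_{\Bbbk}(\mathscr{G}))\big)\;\cong\;\mathrm{Hom}_{\mathsf{Grpd}}\big(\mathscr{G},\,\mathscr{X}_{\Bbbk}(R,\mathcal{H})\big)$$ for every $(R,\mathcal{H})\in\mathsf{GTCHAlgd}_{\Bbbk}$ and every $\mathscr{G}\in\mathsf{Grpd}$.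
   Context: $\Bbbk$ is a fixed ground field. For commutative $\Bbbk$-algebras $R,S$, $R(S)$ is the set of $\Bbbk$-algebra maps $R\to S$; all commutative algebras $R$ occurring as base algebras are assumed to satisfy $R(\Bbbk)\neq\emptyset$. For a set $X$, $\mathrm{M}_{\Bbbk}(X)$ is the $\Bbbk$-algebra of all maps $X\to\Bbbk$. **Groupoids.** A (discrete) groupoid $\mathscr{G}$ is a small category with all arrows invertible and nonempty object set $\mathscr{G}_0$; $\mathscr{G}_1$ is the set of arrows, $\mathsf{s},\mathsf{t}:\mathscr{G}_1\to\mathscr{G}_0$ source and target, $\iota:\mathscr{G}_0\to\mathscr{G}_1$ identities; $gh$ is defined when $\mathsf{s}(g)=\mathsf{t}(h)$. Morphisms are functors; $\mathsf{Grpd}$ is the resulting category. **Representations.** A $\mathscr{G}$-representation $(\mathcal{E},\varrho^{\mathcal{E}})$ is a disjoint union $\mathcal{E}=\bigcup_{x\in\mathscr{G}_0}E_x$ of finite dimensional $\Bbbk$-vector spaces, all isomorphic to one finite dimensional space $V$, with linear isomorphisms $\varrho^{\mathcal{E}}_g:E_{\mathsf{s}(g)}\to E_{\mathsf{t}(g)}$ ($g\in\mathscr{G}_1$) such that $\varrho^{\mathcal{E}}_{\iota(x)}=\mathrm{id}$ and $\varrho^{\mathcal{E}}_{gh}=\varrho^{\mathcal{E}}_g\varrho^{\mathcal{E}}_h$. A morphism $\alpha$ is a family of linear maps $\alpha_x:E_x\to F_x$ with $\alpha_{\mathsf{t}(g)}\varrho^{\mathcal{E}}_g=\varrho^{\mathcal{F}}_g\alpha_{\mathsf{s}(g)}$.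 The category is $\mathrm{Rep}_{\Bbbk}(\mathscr{G})$ (essentially small); $\mathrm{T}_{\mathcal{E}}=\mathrm{End}(\varrho^{\mathcal{E}})$. Tensor products are fiberwise, duals have fibers $E_x^*$ with action $[(\varrho_g^{\mathcal{E}})^*]^{-1}$, and the unit $\mathcal{I}$ has fibers $\Bbbk$ and identity action. With $B=\mathrm{M}_{\Bbbk}(\mathscr{G}_0)$, $\Gamma(\mathcal{E})$ is the $B$-module of sections $p$, $p(x)\in E_x$ (finitely generated projective). Put $\Gamma(\mathcal{E})^*=\mathrm{Hom}_B(\Gamma(\mathcal{E}),B)\cong\Gamma(\mathcal{E}^* )$, so $\varphi\in\Gamma(\mathcal{E})^*$ has values $\varphi(x)\in E_x^*$. **Commutative Hopf algebroids.** A commutative Hopf algebroid is a pair $(R,\mathcal{H})$ of commutative $\Bbbk$-algebras, $R\neq0$, with algebra maps $\mathsf{s},\mathsf{t}:R\to\mathcal{H}$, $\varepsilon:\mathcal{H}\to R$, $\Delta:\mathcal{H}\to\mathcal{H}\otimes_R\mathcal{H}$ ($R$ acts on $\mathcal{H}$ on the left via $\mathsf{t}$, on the right via $\mathsf{s}$), and antipode $\mathscr{S}:\mathcal{H}\to\mathcal{H}$, satisfying the usual (cogroupoid) axioms. Morphisms are pairs $(\alpha_0,\alpha_1)$ of algebra maps compatible with all structure maps. $\mathsf{comod}_{\mathcal{H}}$ is the category of right $\mathcal{H}$-comodules finitely generated as $R$-modules. $(R,\mathcal{H})$ is geometrically transitive if $\mathcal{H}$ is projective as an $(R\otimes_{\Bbbk}R)$-module,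 the $\Bbbk$-linear category $\mathsf{comod}_{\mathcal{H}}$ is locally of finite type (objects of finite length, finite dimensional Hom spaces), and $\mathrm{End}_{\mathsf{comod}_{\mathcal{H}}}(R)\cong\Bbbk$, where $R$ is a comodule via the grouplike $1_{\mathcal{H}}$. $\mathsf{GTCHAlgd}_{\Bbbk}$ is the full subcategory of geometrically transitive ones. **Functor $\mathscr{R}_{\Bbbk}$.** $\mathscr{R}_{\Bbbk}(\mathscr{G})$ is the coend of $\Gamma(-)^*\otimes_{\Bbbk}\Gamma(-)$ over $\mathrm{Rep}_{\Bbbk}(\mathscr{G})$, i.e. the quotient of $\bigoplus_{\mathcal{E}}\Gamma(\mathcal{E})^*\otimes_{\mathrm{T}_{\mathcal{E}}}\Gamma(\mathcal{E})$ by the $(B\otimes_{\Bbbk}B)$-submodule generated by all $\varphi\otimes\alpha s-\varphi\alpha\otimes s$ with $\alpha:\mathcal{E}\to\mathcal{F}$, $\varphi\in\Gamma(\mathcal{F})^*$, $s\in\Gamma(\mathcal{E})$. Write $\overline{\varphi\otimes p}$ for classes. Hopf algebroid structure on $(B,\mathscr{R}_{\Bbbk}(\mathscr{G}))$: $\overline{\varphi\otimes p}\cdot\overline{\psi\otimes q}=\overline{(\varphi\otimes_B\psi)\otimes(p\otimes_Bq)}$ (for $\mathcal{E}\otimes\mathcal{F}$); $\mathsf{s}(a)=\overline{1_B\otimes a}$, $\mathsf{t}(a)=\overline{a\otimes1_B}$ (for $\mathcal{I}$); $\varepsilon(\overline{\varphi\otimes p})(x)=\varphi(x)(p(x))$;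 $\Delta(\overline{\varphi\otimes p})=\sum_i\overline{\varphi\otimes s_i}\otimes_B\overline{s_i^*\otimes p}$ for a dual basis $\{s_i,s_i^*\}$ of $\Gamma(\mathcal{E})$; $\mathscr{S}(\overline{\varphi\otimes p})=\overline{\tilde p\otimes\varphi}$ (for $\mathcal{E}^*$, with $\tilde{(-)}:\mathcal{E}\cong\mathcal{E}^{**}$). A morphism $\phi:\mathscr{G}\to\mathscr{H}$ goes to the pair consisting of $a\mapsto a\circ\phi_0$ and $\overline{\varphi\otimes p}\mapsto\overline{(\varphi\circ\phi_0)\otimes(p\circ\phi_0)}$, the latter class taken for the restricted representation with fibers $F_{\phi_0(x)}$ and action $\varrho^{\mathcal{F}}_{\phi_1(g)}$. **Functor $\mathscr{X}_{\Bbbk}$.** $\mathscr{X}_{\Bbbk}(R,\mathcal{H})$ is the groupoid with objects $R(\Bbbk)$, arrows $\mathcal{H}(\Bbbk)$, source $g\mapsto g\circ\mathsf{s}$, target $g\mapsto g\circ\mathsf{t}$, identities $x\mapsto x\circ\varepsilon$, composition $(gf)(h)=g(h_1)f(h_2)$ where $\Delta(h)=h_1\otimes_Rh_2$, inverse $g\mapsto g\circ\mathscr{S}$. On morphisms it is precomposition with $(\alpha_0,\alpha_1)$.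
   Formalization: R_k(G) is not geometrically transitive for non-transitive G (e.g. two objects, only identities: End(R) = k×k), so R_k is shown to land in commutative Hopf algebroids, geometrically transitive iff G is transitive; the natural isomorphism, with Hom taken there, holds for every groupoid. *)

(* Defs.v *)
From HB Require Import structures.
From mathcomp Require Import all_boot all_algebra.
From mathcomp Require Import boolp functions.
Set Implicit Arguments.
Unset Strict Implicit.
Unset Printing Implicit Defensive.
Import GRing.Theory.
Local Open Scope ring_scope.
Local Open Scope quotient_scope.

(* M (x)_R N for abelian groups M, N on which R acts by aM and aN (for a right
   module M and a left module N): the group of formal sums, i.e. sequences of
   pairs, where two sums are identified when every R-balanced biadditive map
   takes the same value on both.  This is the kernel of the universal balanced
   map, so it is the congruence generated by the usual relations; - (m, n) is
   represented by (- m, n).  The universal property is tens_balanced, tliftE,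
   tliftD and tensor_sumE. *)
Section Tensor.
Variables (R : Type) (M N : zmodType) (aM : R -> M -> M) (aN : R -> N -> N).

Definition balanced (W : zmodType) (f : M -> N -> W) : Prop :=
  [/\ forall m m' n, f (m + m') n = f m n + f m' n,
      forall m n n', f m (n + n') = f m n + f m n'
    & forall r m n, f (aM r m) n = f m (aN r n)].

Definition tens_sum (W : zmodType) (f : M -> N -> W) (s : seq (M * N)) : W :=
  \sum_(p <- s) f p.1 p.2.

Definition tens_eqv : rel (seq (M * N)) := fun s s' =>
  `[< forall (W : zmodType) (f : M -> N -> W),
        balanced f -> tens_sum f s = tens_sum f s' >].

Fact tens_eqv_refl : reflexive tens_eqv.
Proof. by move=> s; apply/asboolP. Qed.
Fact tens_eqv_sym : symmetric tens_eqv.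
Proof.
by move=> s s'; apply/asboolP/asboolP => e W f bf; rewrite (e W f bf).
Qed.
Fact tens_eqv_trans : transitive tens_eqv.
Proof.
move=> s s' s'' /asboolP e /asboolP e'; apply/asboolP => W f bf.
by rewrite (e W f bf) e'.
Qed.
Canonical tens_equiv :=
  EquivRel tens_eqv tens_eqv_refl tens_eqv_sym tens_eqv_trans.

Definition tensor := {eq_quot tens_equiv}.
HB.instance Definition _ := Choice.on tensor.
HB.instance Definition _ := EqQuotient.on tensor.

Definition tens (m : M) (n : N) : tensor := \pi_tensor [:: (m, n)].
(* tlift f z is the sum of the f m n over a chosen representative of z: it is
   the map induced by f when f is balanced (tliftE, tliftD), and depends on the
   chosen representative otherwise.  It is only used below on maps that are
   balanced by virtue of the axioms of the structure at hand, and doubles as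
   Sweedler notation: \sum F h_1 h_2 is tlift F (Delta h). *)
Definition tlift (W : zmodType) (f : M -> N -> W) (z : tensor) : W :=
  tens_sum f (repr z).

Fact tens_piP (s s' : seq (M * N)) :
  (forall (W : zmodType) (f : M -> N -> W),
     balanced f -> tens_sum f s = tens_sum f s') ->
  \pi_tensor s = \pi_tensor s'.
Proof. by move=> e; apply/eqmodP/asboolP. Qed.

Lemma tlift_pi (W : zmodType) (f : M -> N -> W) s :
  balanced f -> tlift f (\pi_tensor s) = tens_sum f s.
Proof.
move=> bf; rewrite /tlift.
have /eqmodP/asboolP/(_ W f bf) -> // : repr (\pi_tensor s) = s %[mod tensor].
by rewrite reprK.
Qed.

Let tzero : tensor := \pi_tensor [::].
Let tadd (z w : tensor) : tensor := \pi_tensor (repr z ++ repr w).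
Let topp (z : tensor) : tensor := \pi_tensor [seq (- p.1, p.2) | p <- repr z].

Let sum_repr (W : zmodType) (f : M -> N -> W) s : balanced f ->
  tens_sum f (repr (\pi_tensor s)) = tens_sum f s.
Proof. exact: tlift_pi. Qed.

Let sum_cat (W : zmodType) (f : M -> N -> W) s s' :
  tens_sum f (s ++ s') = tens_sum f s + tens_sum f s'.
Proof. by rewrite /tens_sum big_cat. Qed.

Fact taddA : associative tadd.
Proof.
move=> x y z; apply: tens_piP => W f bf.
by rewrite !sum_cat !sum_repr // !sum_cat addrA.
Qed.
Fact taddC : commutative tadd.
Proof. by move=> x y; apply: tens_piP => W f bf; rewrite !sum_cat addrC. Qed.
Fact tadd0 : left_id tzero tadd.
Proof.
move=> x; rewrite -[RHS]reprK; apply: tens_piP => W f bf.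
by rewrite sum_cat sum_repr // /tens_sum big_nil add0r.
Qed.
Fact taddN : left_inverse tzero topp tadd.
Proof.
move=> x; apply: tens_piP => W f bf.
rewrite sum_cat sum_repr // /tens_sum big_map big_nil -big_split big1 //= => p _.
case: bf => bl _ _; rewrite -bl addNr.
by apply: (addrI (f 0 p.2)); rewrite -bl !addr0.
Qed.
HB.instance Definition _ := GRing.isZmodule.Build tensor taddA taddC tadd0 taddN.

Lemma tpiD s s' : \pi_tensor (s ++ s') = \pi_tensor s + \pi_tensor s'.
Proof. by apply: tens_piP => W f bf; rewrite !sum_cat !sum_repr. Qed.

Lemma tens_balanced : balanced tens.
Proof.
split=> *; last first.
- by apply: tens_piP => W f [_ _ b]; rewrite /tens_sum !big_seq1 /=.
- rewrite /tens -tpiD; apply: tens_piP => W f [_ b _].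
  by rewrite /tens_sum big_cat !big_seq1 /=.
- rewrite /tens -tpiD; apply: tens_piP => W f [b _ _].
  by rewrite /tens_sum big_cat !big_seq1 /=.
Qed.

Lemma tliftE (W : zmodType) (f : M -> N -> W) m n :
  balanced f -> tlift f (tens m n) = f m n.
Proof. by move=> bf; rewrite tlift_pi // /tens_sum big_seq1. Qed.

Lemma tliftD (W : zmodType) (f : M -> N -> W) z w :
  balanced f -> tlift f (z + w) = tlift f z + tlift f w.
Proof. by move=> bf; rewrite tlift_pi // sum_cat. Qed.

Lemma tensor_sumE z : z = \sum_(p <- repr z) tens p.1 p.2.
Proof.
rewrite -[LHS]reprK; elim: (repr z) => [|[m n] s IH]; first by rewrite big_nil.
by rewrite -cat1s tpiD IH big_cons.
Qed.

End Tensor.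

Arguments tens {R M N aM aN} m n.
Arguments tlift {R M N aM aN W} f z.

Section TensorMore.
Variables (R : Type) (M N : zmodType) (aM : R -> M -> M) (aN : R -> N -> N).
Local Notation T := (tensor aM aN).

Lemma tensDl m m' n : tens (m + m') n = tens m n + tens m' n :> T.
Proof. by have [H _ _] := tens_balanced aM aN. Qed.
Lemma tensDr m n n' : tens m (n + n') = tens m n + tens m n' :> T.
Proof. by have [_ H _] := tens_balanced aM aN. Qed.
Lemma tensA r m n : tens (aM r m) n = tens m (aN r n) :> T.
Proof. by have [_ _ H] := tens_balanced aM aN. Qed.
Lemma tlift_sum (W : zmodType) (f : M -> N -> W) I (s : seq I) (F : I -> T) :
  balanced aM aN f -> tlift f (\sum_(i <- s) F i) = \sum_(i <- s) tlift f (F i).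
Proof.
move=> bf; have D := @tliftD _ _ _ aM aN _ f _ _ bf.
apply: (big_morph _ D).
by apply: (addrI (tlift f (0 : T))); rewrite -D !addr0.
Qed.
Lemma tensor_ind (P : T -> Prop) :
  P 0 -> (forall m n, P (tens m n)) -> (forall z w, P z -> P w -> P (z + w)) ->
  forall z, P z.
Proof. by move=> P0 Pt PD z; rewrite (tensor_sumE z); apply: big_ind. Qed.
Lemma balancedP (W : zmodType) (f : M -> N -> W) :
  (forall m m' n, f (m + m') n = f m n + f m' n) ->
  (forall m n n', f m (n + n') = f m n + f m n') ->
  (forall r m n, f (aM r m) n = f m (aN r n)) -> balanced aM aN f.
Proof. by []. Qed.
Lemma eq_tlift (W : zmodType) (f g : M -> N -> W) (z : T) :
  f =2 g -> tlift f z = tlift g z.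
Proof. by move=> e; apply: eq_bigr => p _. Qed.
End TensorMore.

(* The tensor product of two commutative rings over the ring maps f and g, R
   acting on A through f and on B through g. *)
Section AlgTensor.
Variables (R : Type) (A B : comPzRingType) (f : R -> A) (g : R -> B).

Definition ctens :=
  tensor (fun (r : R) (a : A) => a * f r) (fun (r : R) (b : B) => g r * b).
HB.instance Definition _ := GRing.Zmodule.on ctens.
Local Notation "a ⊗ b" := (tens a b : ctens) (at level 35).
Local Notation bal := 
  (balanced (fun r (a : A) => a * f r) (fun r (b : B) => g r * b)).

Lemma ctensA r a b : (a * f r) ⊗ b = a ⊗ (g r * b).
Proof. exact: (tensA (fun r a => a * f r) (fun r b => g r * b)). Qed.

Let bal_mull c d : bal (fun a b => (a * c) ⊗ (b * d)).
Proof.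
split=> *; rewrite ?mulrDl ?tensDl ?tensDr //.
by rewrite mulrAC ctensA mulrA.
Qed.

Definition ctens_mul (z w : ctens) : ctens :=
  tlift (fun c d => tlift (fun a b => (a * c) ⊗ (b * d)) z) w.

Let bal_mulr (z : ctens) : bal (fun c d => tlift (fun a b => (a * c) ⊗ (b * d)) z).
Proof.
have tl c d := tliftE _ _ (bal_mull c d).
rewrite (tensor_sumE z).
split=> [c c' d|c d d'|r c d]; rewrite !tlift_sum // -?big_split /=;
  apply: eq_bigr => -[a b] _; rewrite !tl /= ?mulrDr ?tensDl ?tensDr //.
by rewrite mulrA ctensA mulrCA.
Qed.

Lemma ctens_mulE a b c d : ctens_mul (a ⊗ b) (c ⊗ d) = (a * c) ⊗ (b * d).
Proof. by rewrite /ctens_mul !tliftE. Qed.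

Let mulDl : left_distributive ctens_mul +%R.
Proof.
move=> x y z; rewrite /ctens_mul -[RHS]/(_ + _ : ctens) -big_split.
by apply: eq_bigr => p _; rewrite tliftD.
Qed.
Let mulDr : right_distributive ctens_mul +%R.
Proof. by move=> x y z; rewrite /ctens_mul tliftD. Qed.

Let mulC : commutative ctens_mul.
Proof.
have m0l z : ctens_mul 0 z = 0.
  by apply: (addrI (ctens_mul 0 z)); rewrite -mulDl !addr0.
have m0r z : ctens_mul z 0 = 0.
  by apply: (addrI (ctens_mul z 0)); rewrite -mulDr !addr0.
move=> x y; elim/tensor_ind: x => [|a b|x x' ex ex']; last 1 first.
- by rewrite mulDl mulDr ex ex'.
- by rewrite m0l m0r.
elim/tensor_ind: y => [|c d|y y' ey ey']; last 1 first.
- by rewrite mulDl mulDr ey ey'.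
- by rewrite m0l m0r.
by rewrite !ctens_mulE [a * c]mulrC [b * d]mulrC.
Qed.

Let mul1 : left_id (1 ⊗ 1) ctens_mul.
Proof.
move=> x; elim/tensor_ind: x => [|a b|x y ex ey].
- by apply: (addrI (ctens_mul (1 ⊗ 1) 0)); rewrite -mulDr !addr0.
- by rewrite ctens_mulE !mul1r.
- by rewrite mulDr ex ey.
Qed.

Let mulA : associative ctens_mul.
Proof.
have m0l z : ctens_mul 0 z = 0.
  by apply: (addrI (ctens_mul 0 z)); rewrite -mulDl !addr0.
have m0r z : ctens_mul z 0 = 0 by rewrite mulC.
move=> x y z; elim/tensor_ind: x => [|a b|x x' ex ex']; last 1 first.
- by rewrite !mulDl ex ex'.
- by rewrite !m0l.
elim/tensor_ind: y => [|c d|y y' ey ey']; last 1 first.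
- by rewrite mulDl !mulDr mulDl ey ey'.
- by rewrite ?(m0l, m0r).
elim/tensor_ind: z => [|c' d'|z z' ez ez']; last 1 first.
- by rewrite !mulDr ez ez'.
- by rewrite !m0r.
by rewrite !ctens_mulE !mulrA.
Qed.

HB.instance Definition _ :=
  GRing.Zmodule_isComPzRing.Build ctens mulA mulC mul1 mulDl.

Lemma ctensM a b c d : (a ⊗ b) * (c ⊗ d) = (a * c) ⊗ (b * d) :> ctens.
Proof. exact: ctens_mulE. Qed.
Lemma ctens1 : 1 = 1 ⊗ 1 :> ctens.
Proof. by []. Qed.
End AlgTensor.

(* The k-points R(k). *)
Definition chars (k : fieldType) (A : comAlgType k) := {lrmorphism A -> k^o}.

(* H (x)_R H is ctens hsrc htgt: R acts on the left-hand factor via the source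
   and on the right-hand one via the target.  Coassociativity is stated in
   (H (x)_R H) (x)_R H, with the associator H (x) (H (x) H) -> (H (x) H) (x) H
   written out on pure tensors.  The k-linearity of hdelta follows from
   hdelta_tgt. *)
Record hopf_algebroid (k : fieldType) (R : comAlgType k) := HopfAlgebroid {
  htot :> comAlgType k;
  hsrc : {lrmorphism R -> htot};
  htgt : {lrmorphism R -> htot};
  heps : {lrmorphism htot -> R};
  hdelta : {rmorphism htot -> ctens hsrc htgt};
  hanti : {lrmorphism htot -> htot};
  heps_src : forall r, heps (hsrc r) = r;
  heps_tgt : forall r, heps (htgt r) = r;
  hdelta_src : forall r, hdelta (hsrc r) = tens 1 (hsrc r);
  hdelta_tgt : forall r, hdelta (htgt r) = tens (htgt r) 1;
  hcounitl : forall h, tlift (fun a b => htgt (heps a) * b) (hdelta h) = h;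
  hcounitr : forall h, tlift (fun a b => a * hsrc (heps b)) (hdelta h) = h;
  hcoassoc : forall h,
    tlift (fun a b => tens (hdelta a) b) (hdelta h) =
    tlift (fun a b => tlift (fun b1 b2 => tens (tens a b1 : ctens hsrc htgt) b2) (hdelta b))
      (hdelta h) :> ctens (fun r => tens 1 (hsrc r) : ctens hsrc htgt) htgt;
  hanti_src : forall r, hanti (hsrc r) = htgt r;
  hanti_tgt : forall r, hanti (htgt r) = hsrc r;
  hantil : forall h, tlift (fun a b => hanti a * b) (hdelta h) = hsrc (heps h);
  hantir : forall h, tlift (fun a b => a * hanti b) (hdelta h) = htgt (heps h)
}.
Arguments hsrc {k R} _.
Arguments htgt {k R} _.
Arguments heps {k R} _.
Arguments hdelta {k R} _.
Arguments hanti {k R} _.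

Lemma lrmorphismP (k : fieldType) (A B : comAlgType k)
  (f g : {lrmorphism A -> B}) : f =1 g -> f = g.
Proof.
case: f g => f [[f1] [f2] [f3]] [g [[g1] [g2] [g3]]] /= /funext e.
subst g; congr (GRing.LRMorphism.Pack (GRing.LRMorphism.Class _ _ _));
  congr (_ _); exact: Prop_irrelevance.
Qed.

(* gcomp g h is gh, defined when the source of g is the target of h. *)
Record groupoid := Groupoid {
  gob : Type;
  garr : Type;
  gsrc : garr -> gob;
  gtgt : garr -> gob;
  gid : gob -> garr;
  gcomp : forall g h : garr, gsrc g = gtgt h -> garr;
  ginv : garr -> garr;
  gob_inh : inhabited gob;
  gsrc_id : forall x, gsrc (gid x) = x;
  gtgt_id : forall x, gtgt (gid x) = x;
  gsrc_comp : forall g h e, gsrc (@gcomp g h e) = gsrc h;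
  gtgt_comp : forall g h e, gtgt (@gcomp g h e) = gtgt g;
  gcomp1 : forall g e, @gcomp g (gid (gsrc g)) e = g;
  gcomp1l : forall g e, @gcomp (gid (gtgt g)) g e = g;
  gcompA : forall f g h e1 e2 e3 e4,
    @gcomp (@gcomp f g e1) h e2 = @gcomp f (@gcomp g h e3) e4;
  gsrc_inv : forall g, gsrc (ginv g) = gtgt g;
  gtgt_inv : forall g, gtgt (ginv g) = gsrc g;
  gcompV : forall g e, @gcomp g (ginv g) e = gid (gtgt g);
  gcompVl : forall g e, @gcomp (ginv g) g e = gid (gsrc g)
}.

Record chalgd (k : fieldType) := CHAlgd {
  cbase : comAlgType k;
  ctot :> hopf_algebroid cbase;
  cpt : inhabited (chars cbase)
}.

Section Characters.
Variables (k : fieldType) (A : chalgd k).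
Implicit Types (x : chars (cbase A)) (g h : chars (htot A)).

Definition char_src g : chars (cbase A) := g \o hsrc A.
Definition char_tgt g : chars (cbase A) := g \o htgt A.
Definition char_id x : chars (htot A) := x \o heps A.
Definition char_inv g : chars (htot A) := g \o hanti A.

Section Comp.
Variables (g f : chars (htot A)) (gf : char_src g = char_tgt f).

Definition char_conv of char_src g = char_tgt f := fun h : A =>
  tlift (fun a b => g a * f b : k^o) (hdelta A h).
Local Notation conv := (char_conv gf).

Let gfE r : g (hsrc A r) = f (htgt A r).
Proof. exact: (congr1 (fun u : chars _ => u r) gf). Qed.

Lemma char_bal : balanced (fun r (a : A) => a * hsrc A r)
  (fun r (b : A) => htgt A r * b) (fun a b => g a * f b).
Proof.
split=> *; rewrite !(rmorphD, rmorphM) ?(mulrDl, mulrDr) //= gfE mulrA //.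
Qed.

Fact char_conv_zmod : zmod_morphism conv.
Proof.
move=> a b; apply/eqP; rewrite -subr_eq opprK /char_conv -tliftD ?raddfB ?subrK //.
exact: char_bal.
Qed.
Fact char_conv_monoid : monoid_morphism conv.
Proof.
have B := char_bal; split=> [|a b].
  by rewrite /char_conv rmorph1 ctens1 tliftE // !rmorph1 mulr1.
rewrite /char_conv rmorphM (tensor_sumE (hdelta A a)) (tensor_sumE (hdelta A b)).
rewrite big_distrlr /= !tlift_sum // big_distrlr; apply: eq_bigr => p _.
rewrite tlift_sum //; apply: eq_bigr => q _.
by rewrite ctensM !tliftE // !rmorphM mulrACA.
Qed.
HB.instance Definition _ :=
  GRing.isZmodMorphism.Build A k^o conv char_conv_zmod.
HB.instance Definition _ :=
  GRing.isMonoidMorphism.Build A k^o conv char_conv_monoid.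
Fact char_conv_scalable : scalable conv.
Proof.
move=> c a; have e (B : comAlgType k) (u : {lrmorphism B -> k^o}) : u c%:A = c.
  by rewrite linearZ rmorph1 [LHS]mulr1.
rewrite -mulr_algl rmorphM; congr (_ * _).
have -> : c%:A = htgt A c%:A by rewrite linearZ rmorph1.
rewrite /= /char_conv hdelta_tgt tliftE; last exact: char_bal.
by rewrite linearZ !rmorph1 mulr1 e.
Qed.
HB.instance Definition _ :=
  GRing.isScalable.Build k A k^o *:%R conv char_conv_scalable.
Definition char_comp : chars (htot A) := conv.
End Comp.

Lemma raddf_tlift (S : Type) (M N W W' : zmodType) (aM : S -> M -> M)
    (aN : S -> N -> N) (u : {additive W -> W'}) (f : M -> N -> W)
    (z : tensor aM aN) : u (tlift f z) = tlift (fun m n => u (f m n)) z.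
Proof. exact: raddf_sum. Qed.

Lemma tlift_tlift (S S' : Type) (M N M' N' W : zmodType)
    (aM : S -> M -> M) (aN : S -> N -> N)
    (aM' : S' -> M' -> M') (aN' : S' -> N' -> N') (f : M -> N -> W)
    (F : M' -> N' -> tensor aM aN) (z : tensor aM' aN') :
  balanced aM aN f ->
  tlift f (tlift F z) = tlift (fun m n => tlift f (F m n)) z.
Proof. by move=> B; apply: tlift_sum. Qed.

Fact char_src_id x : char_src (char_id x) = x.
Proof. by apply: lrmorphismP => r /=; rewrite heps_src. Qed.
Fact char_tgt_id x : char_tgt (char_id x) = x.
Proof. by apply: lrmorphismP => r /=; rewrite heps_tgt. Qed.
Fact char_src_comp g h e : char_src (@char_comp g h e) = char_src h.
Proof.
apply: lrmorphismP => r; rewrite /= /char_conv hdelta_src tliftE.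
  by rewrite rmorph1 mul1r.
exact: char_bal.
Qed.
Fact char_tgt_comp g h e : char_tgt (@char_comp g h e) = char_tgt g.
Proof.
apply: lrmorphismP => r; rewrite /= /char_conv hdelta_tgt tliftE.
  by rewrite rmorph1 mulr1.
exact: char_bal.
Qed.
Fact char_comp1 g e : @char_comp g (char_id (char_src g)) e = g.
Proof.
apply: lrmorphismP => h; rewrite -[in RHS](hcounitr h) raddf_tlift.
by apply: eq_tlift => a b /=; rewrite rmorphM.
Qed.
Fact char_comp1l g e : @char_comp (char_id (char_tgt g)) g e = g.
Proof.
apply: lrmorphismP => h; rewrite -[in RHS](hcounitl h) raddf_tlift.
by apply: eq_tlift => a b /=; rewrite rmorphM.
Qed.
Fact char_src_inv g : char_src (char_inv g) = char_tgt g.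
Proof. by apply: lrmorphismP => r /=; rewrite hanti_src. Qed.
Fact char_tgt_inv g : char_tgt (char_inv g) = char_src g.
Proof. by apply: lrmorphismP => r /=; rewrite hanti_tgt. Qed.
Fact char_compV g e : @char_comp g (char_inv g) e = char_id (char_tgt g).
Proof.
apply: lrmorphismP => h; rewrite /= -hantir raddf_tlift.
by apply: eq_tlift => a b /=; rewrite rmorphM.
Qed.
Fact char_compVl g e : @char_comp (char_inv g) g e = char_id (char_src g).
Proof.
apply: lrmorphismP => h; rewrite /= -hantil raddf_tlift.
by apply: eq_tlift => a b /=; rewrite rmorphM.
Qed.
Fact char_compA f g h e1 e2 e3 e4 :
  @char_comp (@char_comp f g e1) h e2 = @char_comp f (@char_comp g h e3) e4.
Proof.
have Bfg := char_bal e1.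
pose v : ctens (hsrc A) (htgt A) -> k^o := tlift (fun a b => f a * g b).
have vM (w : ctens (hsrc A) (htgt A)) r :
    v (w * (tens 1 (hsrc A r) : ctens (hsrc A) (htgt A))) = v w * g (hsrc A r).
  rewrite (tensor_sumE w) mulr_suml /v !tlift_sum // mulr_suml.
  apply: eq_bigr => p _; rewrite ctensM !tliftE // mulr1 rmorphM.
  exact: mulrA.
have B : balanced
    (fun r w => w * (tens 1 (hsrc A r) : ctens (hsrc A) (htgt A)))
    (fun r (b : A) => htgt A r * b) (fun w b => v w * h b).
  split=> [w w' b|w b b'|r w b].
  - by rewrite /v tliftD // mulrDl.
  - by rewrite rmorphD mulrDr.
  - have gh : g (hsrc A r) = h (htgt A r).
      exact: (congr1 (fun u : chars _ => u r) e3).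
    by rewrite vM -mulrA; congr (_ * _); rewrite [RHS]rmorphM gh.
apply: lrmorphismP => a.
have := congr1 (tlift (fun w b => v w * h b)) (hcoassoc a).
rewrite !tlift_tlift // => E; rewrite /= /char_conv.
transitivity (tlift (fun a b => tlift (fun w b => v w * h b)
  (tens (hdelta A a) b : ctens (fun r => tens 1 (hsrc A r) : ctens _ _) (htgt A)))
  (hdelta A a)); first by apply: eq_tlift => x y; rewrite tliftE.
rewrite E; apply: eq_tlift => x y; rewrite tlift_tlift //.
rewrite /= /char_conv [in RHS]/tlift /tens_sum mulr_sumr.
by apply: eq_bigr => q _; rewrite tliftE // /v tliftE // mulrA.
Qed.

Definition char_groupoid : groupoid := Groupoid (cpt A) char_src_id char_tgt_id
  char_src_comp char_tgt_comp char_comp1 char_comp1l char_compA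
  char_src_inv char_tgt_inv char_compV char_compVl.
End Characters.

Record grpd_hom (G H : groupoid) := GrpdHom {
  gmap0 : gob G -> gob H;
  gmap1 : garr G -> garr H;
  gmap_src : forall g, gsrc (gmap1 g) = gmap0 (gsrc g);
  gmap_tgt : forall g, gtgt (gmap1 g) = gmap0 (gtgt g);
  gmap_id : forall x, gmap1 (gid x) = gid (gmap0 x);
  gmap_comp : forall g h (e : gsrc g = gtgt h) e',
    gmap1 (gcomp e) = @gcomp H (gmap1 g) (gmap1 h) e'
}.

Lemma grpd_homP (G H : groupoid) (p q : grpd_hom G H) :
  gmap0 p =1 gmap0 q -> gmap1 p =1 gmap1 q -> p = q.
Proof.
case: p q => p0 p1 ps pt pi pc [q0 q1 qs qt qi qc] /= /funext e0 /funext e1.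
subst q0 q1; congr GrpdHom; exact: Prop_irrelevance.
Qed.

Definition grpd_idm (G : groupoid) : grpd_hom G G.
Proof.
refine (@GrpdHom G G id id _ _ _ _) => // g h e e'.
by rewrite (Prop_irrelevance e e').
Defined.

Section GrpdComp.
Variables (G H K : groupoid) (q : grpd_hom H K) (p : grpd_hom G H).
Fact gcompm_src g : gsrc (gmap1 q (gmap1 p g)) = gmap0 q (gmap0 p (gsrc g)).
Proof. by rewrite !gmap_src. Qed.
Fact gcompm_tgt g : gtgt (gmap1 q (gmap1 p g)) = gmap0 q (gmap0 p (gtgt g)).
Proof. by rewrite !gmap_tgt. Qed.
Fact gcompm_id x : gmap1 q (gmap1 p (gid x)) = gid (gmap0 q (gmap0 p x)).
Proof. by rewrite !gmap_id. Qed.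
Fact gcompm_comp g h (e : gsrc g = gtgt h) e' :
  gmap1 q (gmap1 p (gcomp e)) =
  @gcomp K (gmap1 q (gmap1 p g)) (gmap1 q (gmap1 p h)) e'.
Proof.
have e1 : gsrc (gmap1 p g) = gtgt (gmap1 p h) by rewrite gmap_src gmap_tgt e.
by rewrite (@gmap_comp _ _ p _ _ e e1) (@gmap_comp _ _ q _ _ e1 e').
Qed.
Definition grpd_comp : grpd_hom G K :=
  @GrpdHom G K (fun x => gmap0 q (gmap0 p x)) (fun g => gmap1 q (gmap1 p g))
    gcompm_src gcompm_tgt gcompm_id gcompm_comp.
End GrpdComp.

Record chalgd_hom (k : fieldType) (A B : chalgd k) := CHAlgdHom {
  hmap0 : {lrmorphism cbase A -> cbase B};
  hmap1 : {lrmorphism htot A -> htot B};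
  hmap_src : forall r, hmap1 (hsrc A r) = hsrc B (hmap0 r);
  hmap_tgt : forall r, hmap1 (htgt A r) = htgt B (hmap0 r);
  hmap_eps : forall h, hmap0 (heps A h) = heps B (hmap1 h);
  hmap_delta : forall h,
    hdelta B (hmap1 h) = tlift (fun a b => tens (hmap1 a) (hmap1 b)) (hdelta A h);
  hmap_anti : forall h, hmap1 (hanti A h) = hanti B (hmap1 h)
}.

Lemma chalgd_homP (k : fieldType) (A B : chalgd k) (p q : chalgd_hom A B) :
  hmap0 p =1 hmap0 q -> hmap1 p =1 hmap1 q -> p = q.
Proof.
case: p q => p0 p1 ? ? ? ? ? [q0 q1 ? ? ? ? ?] /=.
move=> /lrmorphismP e0 /lrmorphismP e1; subst q0 q1.
congr CHAlgdHom; exact: Prop_irrelevance.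
Qed.

Section CHAlgdComp.
Variable k : fieldType.

Lemma hmap_balanced (A B : chalgd k) (u : chalgd_hom A B) :
  balanced (fun r (a : A) => a * hsrc A r) (fun r (b : A) => htgt A r * b)
    (fun a b => tens (hmap1 u a) (hmap1 u b) : ctens (hsrc B) (htgt B)).
Proof.
split=> [a a' b|a b b'|r a b]; rewrite ?rmorphD ?tensDl ?tensDr //.
by rewrite !rmorphM /= hmap_src hmap_tgt; exact: ctensA.
Qed.

Fact chalgd_idm_delta (A : chalgd k) h :
  hdelta A h = tlift (fun a b => tens a b) (hdelta A h).
Proof. exact: tensor_sumE. Qed.

Definition chalgd_idm (A : chalgd k) : chalgd_hom A A :=
  @CHAlgdHom k A A (idfun : {lrmorphism _ -> _}) (idfun : {lrmorphism _ -> _})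
    (fun=> erefl) (fun=> erefl) (fun=> erefl) (@chalgd_idm_delta A) (fun=> erefl).

Variables (A B C : chalgd k) (v : chalgd_hom B C) (u : chalgd_hom A B).

Fact hcomp_src r : hmap1 v (hmap1 u (hsrc A r)) = hsrc C (hmap0 v (hmap0 u r)).
Proof. by rewrite !hmap_src. Qed.
Fact hcomp_tgt r : hmap1 v (hmap1 u (htgt A r)) = htgt C (hmap0 v (hmap0 u r)).
Proof. by rewrite !hmap_tgt. Qed.
Fact hcomp_eps h : hmap0 v (hmap0 u (heps A h)) = heps C (hmap1 v (hmap1 u h)).
Proof. by rewrite !hmap_eps. Qed.
Fact hcomp_delta h : hdelta C (hmap1 v (hmap1 u h)) =
  tlift (fun a b => tens (hmap1 v (hmap1 u a)) (hmap1 v (hmap1 u b))) (hdelta A h).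
Proof.
rewrite !hmap_delta tlift_tlift; last exact: hmap_balanced.
by apply: eq_tlift => a b; rewrite tliftE //; exact: hmap_balanced.
Qed.
Fact hcomp_anti h : hmap1 v (hmap1 u (hanti A h)) = hanti C (hmap1 v (hmap1 u h)).
Proof. by rewrite !hmap_anti. Qed.
Definition chalgd_comp : chalgd_hom A C :=
  @CHAlgdHom k A C (hmap0 v \o hmap0 u : {lrmorphism _ -> _})
    (hmap1 v \o hmap1 u : {lrmorphism _ -> _})
    hcomp_src hcomp_tgt hcomp_eps hcomp_delta hcomp_anti.
End CHAlgdComp.

Section CharMap.
Variables (k : fieldType) (A B : chalgd k) (u : chalgd_hom A B).

Definition char_map0 (x : chars (cbase B)) : chars (cbase A) := x \o hmap0 u.
Definition char_map1 (g : chars (htot B)) : chars (htot A) := g \o hmap1 u.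

Fact char_map_src g : char_src (char_map1 g) = char_map0 (char_src g).
Proof. by apply: lrmorphismP => r /=; rewrite hmap_src. Qed.
Fact char_map_tgt g : char_tgt (char_map1 g) = char_map0 (char_tgt g).
Proof. by apply: lrmorphismP => r /=; rewrite hmap_tgt. Qed.
Fact char_map_id x : char_map1 (char_id x) = char_id (char_map0 x).
Proof. by apply: lrmorphismP => r /=; rewrite hmap_eps. Qed.
Fact char_map_comp g h (e : char_src g = char_tgt h)
    (e' : char_src (char_map1 g) = char_tgt (char_map1 h)) :
  char_map1 (char_comp e) = char_comp e'.
Proof.
apply: lrmorphismP => a; rewrite /= /char_conv hmap_delta tlift_tlift.
  by apply: eq_tlift => b c; rewrite tliftE //; exact: char_bal.
exact: char_bal.
Qed.
Definition char_map : grpd_hom (char_groupoid B) (char_groupoid A) :=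
  @GrpdHom (char_groupoid B) (char_groupoid A) char_map0 char_map1
    char_map_src char_map_tgt char_map_id char_map_comp.
End CharMap.

Lemma char_map_idm (k : fieldType) (A : chalgd k) :
  char_map (chalgd_idm A) = grpd_idm (char_groupoid A).
Proof. by apply: grpd_homP => x; apply: lrmorphismP. Qed.
Lemma char_map_compm (k : fieldType) (A B C : chalgd k) (v : chalgd_hom B C)
    (u : chalgd_hom A B) :
  char_map (chalgd_comp v u) = grpd_comp (char_map u) (char_map v).
Proof. by apply: grpd_homP => x; apply: lrmorphismP. Qed.

(* The algebra of all maps X -> k; the witness of nonemptiness makes it a nonzero
   ring. *)
Section MapAlgebra.
Variables (k : fieldType) (X : Type) (X0 : inhabited X).

Definition mapalg of inhabited X : Type := X -> k.
Local Notation B := (mapalg X0).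
HB.instance Definition _ := GRing.ComPzRing.on B.
HB.instance Definition _ := GRing.Zmodule.on B.
Fact mapalg1_neq0 : 1 != 0 :> B.
Proof.
by case: X0 => x; apply/eqP => /(congr1 (fun f : B => f x))/eqP; rewrite oner_eq0.
Qed.
HB.instance Definition _ := GRing.PzSemiRing_isNonZero.Build B mapalg1_neq0.
Definition mapalg_scale (c : k) (f : B) : B := fun x => c * f x.
Fact mapalg_scaleA a b f : mapalg_scale a (mapalg_scale b f) = mapalg_scale (a * b) f.
Proof. by apply/funext => x; apply: mulrA. Qed.
Fact mapalg_scale1 : left_id 1 mapalg_scale.
Proof. by move=> f; apply/funext => x; apply: mul1r. Qed.
Fact mapalg_scaleDr : right_distributive mapalg_scale +%R.
Proof. by move=> a f g; apply/funext => x; apply: mulrDr. Qed.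
Fact mapalg_scaleDl f : {morph mapalg_scale^~ f : a b / a + b}.
Proof. by move=> a b; apply/funext => x; apply: mulrDl. Qed.
HB.instance Definition _ := GRing.Zmodule_isLmodule.Build k B
  mapalg_scaleA mapalg_scale1 mapalg_scaleDr mapalg_scaleDl.
Fact mapalg_scaleAl (c : k) (f g : B) : c *: (f * g) = (c *: f) * g.
Proof. by apply/funext => x; apply: mulrA. Qed.
HB.instance Definition _ := GRing.Lmodule_isLalgebra.Build k B mapalg_scaleAl.
HB.instance Definition _ := GRing.Lalgebra_isComAlgebra.Build k B.
End MapAlgebra.

(* The action of an arrow g is given as a map E_x -> E_y for every x, y with
   proofs that x and y are the source and target of g: this is the map
   E_(s g) -> E_(t g), transported so that ract_id and ract_comp need no cast. *)
Record rep (k : fieldType) (G : groupoid) := Rep {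
  rfib : gob G -> vectType k;
  ract : forall g x y, gsrc g = x -> gtgt g = y -> 'Hom(rfib x, rfib y);
  rfib_iso : exists V : vectType k,
    forall x, exists f : 'Hom(rfib x, V), bijective f;
  ract_id : forall x e e', @ract (gid x) x x e e' = \1%VF;
  ract_comp : forall g h (gh : gsrc g = gtgt h) x y z es et eh eg e e',
    @ract (gcomp gh) x z e e' = (@ract g y z eg et \o @ract h x y es eh)%VF
}.
Arguments ract {k G} E g {x y} _ _ : rename.

Section Transpose.
Variables (k : fieldType) (U V : vectType k) (u : 'Hom(U, V)).
Definition ltr_fun (f : 'Hom(V, k^o)) : 'Hom(U, k^o) := (f \o u)%VF.
Fact ltr_linear : linear ltr_fun.
Proof. by move=> c f g; rewrite /ltr_fun comp_lfunDl -comp_lfunZl. Qed.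
HB.instance Definition _ := GRing.isLinear.Build k _ _ _ ltr_fun ltr_linear.
Definition ltr : 'Hom('Hom(V, k^o), 'Hom(U, k^o)) := linfun ltr_fun.
Lemma ltrE f : ltr f = (f \o u)%VF.
Proof. by rewrite lfunE. Qed.
End Transpose.

Section Bidual.
Variables (k : fieldType) (U : vectType k) (v : U).
Definition bidual_fun (f : 'Hom(U, k^o)) : k^o := f v.
Fact bidual_linear : linear bidual_fun.
Proof. by move=> c f g; rewrite /bidual_fun !lfunE /= !lfunE. Qed.
HB.instance Definition _ := GRing.isLinear.Build k _ _ _ bidual_fun bidual_linear.
Definition bidual : 'Hom('Hom(U, k^o), k^o) := linfun bidual_fun.
Lemma bidualE f : bidual f = f v.
Proof. by rewrite lfunE. Qed.
End Bidual.

(* The tensor product of two finite-dimensional spaces, U (x) V = Hom(U^*, V),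
   with u (x) v : f |-> f(u) v.  The action of maps a (x) b and of forms f (x) g
   on it is the expected one on pure tensors: ltens_vtens, ftens_vtens. *)
Section TensorSpace.
Variable k : fieldType.
Definition ltensor (U V : vectType k) : vectType k := 'Hom('Hom(U, k^o), V).

Section Vectors.
Variables (U V : vectType k) (u : U) (v : V).
Definition vtens_fun (f : 'Hom(U, k^o)) : V := (f u : k) *: v.
Fact vtens_linear : linear vtens_fun.
Proof. by move=> c f g; rewrite /vtens_fun !lfunE /= !lfunE scalerDl scalerA. Qed.
HB.instance Definition _ := GRing.isLinear.Build k _ _ _ vtens_fun vtens_linear.
Definition vtens : ltensor U V := linfun vtens_fun.
End Vectors.

Section Maps.
Variables (U V U' V' : vectType k) (a : 'Hom(U, U')) (b : 'Hom(V, V')).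
Definition ltens_fun (h : ltensor U V) : ltensor U' V' := (b \o h \o ltr a)%VF.
Fact ltens_linear : linear ltens_fun.
Proof.
by move=> c h h'; rewrite /ltens_fun comp_lfunDr -comp_lfunZr comp_lfunDl -comp_lfunZl.
Qed.
HB.instance Definition _ := GRing.isLinear.Build k _ _ _ ltens_fun ltens_linear.
Definition ltens : 'Hom(ltensor U V, ltensor U' V') := linfun ltens_fun.
Lemma ltensE h : ltens h = (b \o h \o ltr a)%VF.
Proof. by rewrite lfunE. Qed.
Lemma ltens_vtens u v : ltens (vtens u v) = vtens (a u) (b v).
Proof.
rewrite ltensE; apply/lfunP => f.
rewrite !comp_lfunE ltrE [vtens u v _]lfunE [RHS]lfunE /= /vtens_fun.
by rewrite comp_lfunE linearZ.
Qed.
End Maps.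

Section Forms.
Variables (U V : vectType k) (f : 'Hom(U, k^o)) (g : 'Hom(V, k^o)).
Definition ftens_fun (h : ltensor U V) : k^o := g (h f).
Fact ftens_linear : linear ftens_fun.
Proof. by move=> c h h'; rewrite /ftens_fun !lfunE /= !lfunE linearP. Qed.
HB.instance Definition _ := GRing.isLinear.Build k _ _ _ ftens_fun ftens_linear.
Definition ftens : 'Hom(ltensor U V, k^o) := linfun ftens_fun.
Lemma ftens_vtens u v : ftens (vtens u v) = f u * g v.
Proof. by rewrite !lfunE /= /ftens_fun lfunE /= /vtens_fun linearZ. Qed.
End Forms.
End TensorSpace.

Section RepLemmas.
Variable k : fieldType.

Lemma lfun_bij (U V : vectType k) (f : 'Hom(U, V)) :
  bijective f <-> exists2 g : 'Hom(V, U), (g \o f = \1)%VF & (f \o g = \1)%VF.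
Proof.
split=> [bf|[g gf fg]]; last first.
  exists g => x; first by rewrite -comp_lfunE gf lfunE.
  by rewrite -comp_lfunE fg lfunE.
have f0 : lker f == 0%VS by apply/lker0P; exact: bij_inj.
exists (f^-1)%VF; first exact: lker0_compVf.
case: bf => g _ gK; apply/lfunP => x; rewrite !lfunE /= -{1}(gK x).
by rewrite lker0_lfunK // gK.
Qed.

Lemma inv_lfun_uniq (U V : vectType k) (f : 'Hom(U, V)) (g : 'Hom(V, U)) :
  (g \o f = \1)%VF -> (f \o g = \1)%VF -> (f^-1)%VF = g.
Proof.
move=> gf fg; have f0 : lker f == 0%VS.
  apply/lker0P => x y e; rewrite -[x](id_lfunE) -[y]id_lfunE -gf.
  by rewrite !comp_lfunE e.
by rewrite -[LHS]comp_lfun1r -fg comp_lfunA lker0_compVf // comp_lfun1l.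
Qed.

Variables (G : groupoid) (E : rep k G).

Lemma ract_inv g x y (e : gsrc g = x) (e' : gtgt g = y)
    (f : gsrc (ginv g) = y) (f' : gtgt (ginv g) = x) :
  (ract E g e e' \o ract E (ginv g) f f' = \1)%VF /\
  (ract E (ginv g) f f' \o ract E g e e' = \1)%VF.
Proof.
have c : gsrc g = gtgt (ginv g) by rewrite gtgt_inv.
have c' : gsrc (ginv g) = gtgt g by rewrite gsrc_inv.
have ce : gsrc (gcomp c) = y by rewrite gsrc_comp gsrc_inv.
have ce' : gtgt (gcomp c) = y by rewrite gtgt_comp.
have de : gsrc (gcomp c') = x by rewrite gsrc_comp.
have de' : gtgt (gcomp c') = x by rewrite gtgt_comp gtgt_inv.
split; rewrite -(ract_comp _ _ _ _ _ ce ce') || rewrite -(ract_comp _ _ _ _ _ de de').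
  move: ce ce'; rewrite gcompV -e' => ce ce'; move: f; rewrite -{1}e'.
  by subst y => f; apply: ract_id.
move: de de'; rewrite gcompVl.
by subst x => de de'; apply: ract_id.
Qed.

Lemma ract_invE g x y (e : gsrc g = x) (e' : gtgt g = y)
    (f : gsrc (ginv g) = y) (f' : gtgt (ginv g) = x) :
  (ract E g e e')^-1%VF = ract E (ginv g) f f'.
Proof. by have [h h'] := ract_inv e e' f f'; apply: inv_lfun_uniq. Qed.

Lemma ract_invK g x y (e : gsrc g = x) (e' : gtgt g = y) :
  ((ract E g e e')^-1 \o ract E g e e' = \1 /\
  ract E g e e' \o (ract E g e e')^-1 = \1)%VF.
Proof.
have f : gsrc (ginv g) = y by rewrite gsrc_inv.
have f' : gtgt (ginv g) = x by rewrite gtgt_inv.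
by rewrite (ract_invE e e' f f'); have [] := ract_inv e e' f f'.
Qed.
End RepLemmas.

Section RepConstructions.
Variables (k : fieldType) (G : groupoid).

Definition rep_unit : rep k G.
Proof.
refine (@Rep k G (fun=> k^o) (fun _ _ _ _ _ => \1%VF) _ _ _) => [|//|*].
  by exists k^o => x; exists \1%VF; exists id => v; rewrite lfunE.
by rewrite comp_lfun1l.
Defined.

Variables (E F : rep k G).

Lemma ltr_comp (U V W : vectType k) (b : 'Hom(V, W)) (a : 'Hom(U, V)) :
  ltr (b \o a)%VF = (ltr a \o ltr b)%VF.
Proof. by apply/lfunP => f; rewrite comp_lfunE !ltrE comp_lfunA. Qed.
Lemma ltr_id (U : vectType k) : ltr (\1 : 'Hom(U, U))%VF = \1%VF.
Proof. by apply/lfunP => f; rewrite ltrE id_lfunE comp_lfun1r. Qed.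
Lemma ltens_comp (U V U' V' U'' V'' : vectType k) (a : 'Hom(U, U'))
    (b : 'Hom(V, V')) (a' : 'Hom(U', U'')) (b' : 'Hom(V', V'')) :
  ltens (a' \o a)%VF (b' \o b)%VF = (ltens a' b' \o ltens a b)%VF.
Proof. by apply/lfunP => h; rewrite comp_lfunE !ltensE ltr_comp !comp_lfunA. Qed.
Lemma ltens_id (U V : vectType k) :
  ltens (\1 : 'Hom(U, U))%VF (\1 : 'Hom(V, V))%VF = \1%VF.
Proof.
by apply/lfunP => h; rewrite ltensE ltr_id comp_lfun1l comp_lfun1r id_lfunE.
Qed.

Fact rep_dual_iso : exists V : vectType k, forall x,
  exists f : 'Hom('Hom(rfib E x, k^o), V), bijective f.
Proof.
have [V VP] := rfib_iso E; exists 'Hom(V, k^o) => x.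
have [f /lfun_bij[f' ff' f'f]] := VP x.
by exists (ltr f'); apply/lfun_bij; exists (ltr f); rewrite -ltr_comp ?ff' ?f'f ltr_id.
Qed.
(* [(rho_g)^* ]^-1, with ltr the transposition *)
Definition rep_dual_act g x y (e : gsrc g = x) (e' : gtgt g = y) :
    'Hom('Hom(rfib E x, k^o), 'Hom(rfib E y, k^o)) :=
  ((ltr (ract E g e e'))^-1)%VF.
Lemma rep_dual_actE g x y (e : gsrc g = x) (e' : gtgt g = y) :
  rep_dual_act e e' = ltr ((ract E g e e')^-1)%VF.
Proof.
have [g1 g2] := ract_invK E e e'.
by apply: inv_lfun_uniq; rewrite -ltr_comp ?g1 ?g2 ltr_id.
Qed.
Fact rep_dual_id x (e : gsrc (gid x) = x) (e' : gtgt (gid x) = x) :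
  rep_dual_act e e' = \1%VF.
Proof.
rewrite rep_dual_actE ract_id.
by rewrite (@inv_lfun_uniq _ _ _ \1%VF \1%VF) ?comp_lfun1r ?ltr_id.
Qed.
Fact rep_dual_comp g h (gh : gsrc g = gtgt h) x y z
    (es : gsrc h = x) (et : gtgt g = z) (eh : gtgt h = y) (eg : gsrc g = y)
    (e : gsrc (gcomp gh) = x) (e' : gtgt (gcomp gh) = z) :
  rep_dual_act e e' = (rep_dual_act eg et \o rep_dual_act es eh)%VF.
Proof.
rewrite !rep_dual_actE -ltr_comp; congr ltr.
rewrite (ract_comp E es et eh eg e e').
have [g1 g2] := ract_invK E eg et; have [h1 h2] := ract_invK E es eh.
apply: inv_lfun_uniq.
  by rewrite comp_lfunA -(comp_lfunA _ _ (ract E g eg et)) g1 comp_lfun1r h1.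
by rewrite comp_lfunA -(comp_lfunA _ (ract E h es eh)) h2 comp_lfun1r g2.
Qed.
Definition rep_dual : rep k G := Rep rep_dual_iso rep_dual_id rep_dual_comp.

Fact rep_tens_iso : exists V : vectType k, forall x,
  exists f : 'Hom(ltensor (rfib E x) (rfib F x), V), bijective f.
Proof.
have [V VP] := rfib_iso E; have [W WP] := rfib_iso F; exists (ltensor V W) => x.
have [f /lfun_bij[f' ff' f'f]] := VP x; have [g /lfun_bij[g' gg' g'g]] := WP x.
exists (ltens f g); apply/lfun_bij; exists (ltens f' g');
  by rewrite -ltens_comp ?ff' ?gg' ?f'f ?g'g ltens_id.
Qed.
Definition rep_tens_act g x y (e : gsrc g = x) (e' : gtgt g = y) :=
  ltens (ract E g e e') (ract F g e e').
Fact rep_tens_id x (e : gsrc (gid x) = x) (e' : gtgt (gid x) = x) :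
  rep_tens_act e e' = \1%VF.
Proof. by rewrite /rep_tens_act !ract_id ltens_id. Qed.
Fact rep_tens_comp g h (gh : gsrc g = gtgt h) x y z
    (es : gsrc h = x) (et : gtgt g = z) (eh : gtgt h = y) (eg : gsrc g = y)
    (e : gsrc (gcomp gh) = x) (e' : gtgt (gcomp gh) = z) :
  rep_tens_act e e' = (rep_tens_act eg et \o rep_tens_act es eh)%VF.
Proof.
by rewrite /rep_tens_act (ract_comp E es et eh eg e e')
  (ract_comp F es et eh eg e e') ltens_comp.
Qed.
Definition rep_tens : rep k G := Rep rep_tens_iso rep_tens_id rep_tens_comp.
End RepConstructions.

Section Restriction.
Variables (k : fieldType) (G H : groupoid) (p : grpd_hom G H) (F : rep k H).

Fact res_src g x : gsrc g = x -> gsrc (gmap1 p g) = gmap0 p x.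
Proof. by rewrite gmap_src => ->. Qed.
Fact res_tgt g x : gtgt g = x -> gtgt (gmap1 p g) = gmap0 p x.
Proof. by rewrite gmap_tgt => ->. Qed.
Fact rep_res_iso : exists V : vectType k, forall x,
  exists f : 'Hom(rfib F (gmap0 p x), V), bijective f.
Proof. by have [V VP] := rfib_iso F; exists V => x. Qed.
Definition rep_res_act g x y (e : gsrc g = x) (e' : gtgt g = y) :=
  ract F (gmap1 p g) (res_src e) (res_tgt e').
Fact rep_res_id x (e : gsrc (gid x) = x) (e' : gtgt (gid x) = x) :
  rep_res_act e e' = \1%VF.
Proof.
rewrite /rep_res_act; move: (res_src e) (res_tgt e').
by rewrite gmap_id => f f'; rewrite ract_id.
Qed.
Fact rep_res_comp g h (gh : gsrc g = gtgt h) x y z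
    (es : gsrc h = x) (et : gtgt g = z) (eh : gtgt h = y) (eg : gsrc g = y)
    (e : gsrc (gcomp gh) = x) (e' : gtgt (gcomp gh) = z) :
  rep_res_act e e' = (rep_res_act eg et \o rep_res_act es eh)%VF.
Proof.
have gh' : gsrc (gmap1 p g) = gtgt (gmap1 p h) by rewrite gmap_src gmap_tgt gh.
rewrite /rep_res_act; move: (res_src e) (res_tgt e').
by rewrite (gmap_comp gh gh') => f f'; apply: ract_comp.
Qed.
Definition rep_res : rep k G := Rep rep_res_iso rep_res_id rep_res_comp.
End Restriction.

Section RestrictScalars.
Variables (S A : pzRingType) (f : {rmorphism S -> A}).
Definition lrestr of {rmorphism S -> A} : Type := A.
Local Notation M := (lrestr f).
HB.instance Definition _ := GRing.Zmodule.on M.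
Let scale (c : S) (a : M) : M := (f c * a : A).
Fact lrestrA a b v : scale a (scale b v) = scale (a * b) v.
Proof. by rewrite /scale rmorphM mulrA. Qed.
Fact lrestr1 : left_id 1 scale.
Proof. by move=> v; rewrite /scale rmorph1 mul1r. Qed.
Fact lrestrDr : right_distributive scale +%R.
Proof. by move=> a u v; apply: mulrDr. Qed.
Fact lrestrDl v : {morph scale^~ v : a b / a + b}.
Proof. by move=> a b; rewrite /scale rmorphD mulrDl. Qed.
HB.instance Definition _ :=
  GRing.Zmodule_isLmodule.Build S M lrestrA lrestr1 lrestrDr lrestrDl.
End RestrictScalars.

(* Lifting along epimorphisms of S-modules. *)
Definition projective (S : pzRingType) (P : lmodType S) : Prop :=
  forall (N M : lmodType S) (q : {linear N -> M}) (f : {linear P -> M}),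
    (forall m, exists n, q n = m) ->
    exists g : {linear P -> N}, forall x, q (g x) = f x.

(* H as a module over R (x)_k R, a (x) b acting as multiplication by t(a) s(b). *)
Section Enveloping.
Variables (k : fieldType) (R : comAlgType k) (H : hopf_algebroid R).

Definition envel (A : comAlgType k) := ctens (in_alg A) (in_alg A).
Definition envel_map (z : envel R) : H := tlift (fun a b => htgt H a * hsrc H b) z.

Fact envel_balanced : balanced (fun (c : k) (a : R) => a * in_alg R c)
  (fun (c : k) (b : R) => in_alg R c * b) (fun a b => htgt H a * hsrc H b).
Proof.
split=> [a a' b|a b b'|c a b].
- by rewrite rmorphD mulrDl.
- by rewrite rmorphD mulrDr.
- rewrite !rmorphM -mulrA; congr (_ * (_ * _)).
  by rewrite /= !linearZ /= !rmorph1.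
Qed.
Fact envel_map_zmod : zmod_morphism envel_map.
Proof.
move=> x y; apply/eqP; rewrite eq_sym subr_eq; apply/eqP.
by rewrite /envel_map -tliftD ?subrK //; exact: envel_balanced.
Qed.
Fact envel_map_monoid : monoid_morphism envel_map.
Proof.
have B := envel_balanced; split=> [|x y].
  by rewrite /envel_map ctens1 tliftE // !rmorph1 mulr1.
rewrite (tensor_sumE x) (tensor_sumE y) big_distrlr /envel_map /= !tlift_sum //.
rewrite big_distrlr; apply: eq_bigr => p _; rewrite tlift_sum //.
by apply: eq_bigr => q _; rewrite ctensM !tliftE // !rmorphM mulrACA.
Qed.
HB.instance Definition _ :=
  GRing.isZmodMorphism.Build (envel R) H envel_map envel_map_zmod.
HB.instance Definition _ :=
  GRing.isMonoidMorphism.Build (envel R) H envel_map envel_map_monoid.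
End Enveloping.

(* Right H-comodules that are finitely generated over R.  In M (x)_R H the ring R
   acts on H via the target; the R-module structure of M (x)_R H comes from the
   source (cotens_act). *)
Section Comodules.
Variables (k : fieldType) (R : comAlgType k) (H : hopf_algebroid R).

Definition cotens (M : lmodType R) :=
  tensor (fun (r : R) (m : M) => r *: m) (fun (r : R) (h : H) => htgt H r * h).
HB.instance Definition _ M := GRing.Zmodule.on (cotens M).
Definition cotens_act M (r : R) (z : cotens M) : cotens M :=
  tlift (fun m h => tens m (h * hsrc H r)) z.

Record comodule := Comodule {
  cocar :> lmodType R;
  coact : {additive cocar -> cotens cocar};
  coact_lin : forall r m, coact (r *: m) = cotens_act r (coact m);
  coact_eps : forall m, tlift (fun m' h => heps H h *: m') (coact m) = m;
  coact_delta : forall m,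
    tlift (fun m' h => tens (coact m') h) (coact m) =
    tlift (fun m' h =>
             tlift (fun h1 h2 => tens (tens m' h1 : cotens cocar) h2) (hdelta H h))
      (coact m)
    :> tensor (@cotens_act cocar) (fun (r : R) (h : H) => htgt H r * h);
  cofg : exists n (v : 'I_n -> cocar),
    forall m, exists c : 'I_n -> R, m = \sum_i c i *: v i
}.

Record comod_hom (M N : comodule) := ComodHom {
  cohom :> {linear M -> N};
  cohom_coact : forall m,
    coact N (cohom m) = tlift (fun m' h => tens (cohom m') h) (coact M m)
}.

Definition comod_mono M N (f : comod_hom M N) : Prop :=
  forall (L : comodule) (u v : comod_hom L M),
    (forall x, f (u x) = f (v x)) -> forall x, u x = v x.
Definition comod_iso M N (f : comod_hom M N) : Prop :=
  exists g : comod_hom N M, cancel f g /\ cancel g f.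

(* subobject_chain n M: there is a chain of n strict inclusions of subobjects
   ending at M, in the category of finitely generated comodules.  An object has
   finite length when the length of such chains is bounded. *)
Fixpoint subobject_chain (n : nat) (M : comodule) : Prop :=
  if n is n'.+1 then
    exists (L : comodule) (f : comod_hom L M),
      [/\ comod_mono f, ~ comod_iso f & subobject_chain n' L]
  else True.
Definition finite_length (M : comodule) : Prop :=
  exists n, ~ subobject_chain n M.

Definition fin_dim_hom (M N : comodule) : Prop :=
  exists n (b : 'I_n -> comod_hom M N), forall f : comod_hom M N,
    exists c : 'I_n -> k, forall m, f m = \sum_i (c i)%:A *: b i m.

Lemma cotens_act_balanced (M : lmodType R) (r : R) :
  balanced (fun (r : R) (m : M) => r *: m) (fun (r : R) (h : H) => htgt H r * h)
    (fun m h => tens m (h * hsrc H r) : cotens M).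
Proof.
split=> [a a' b|a b b'|c a b]; first exact: tensDl.
  by rewrite mulrDl; exact: tensDr.
by rewrite (tensA (fun (r : R) (m : M) => r *: m)) mulrA.
Qed.

Lemma cotens_actE (M : lmodType R) (r : R) (m : M) (h : H) :
  cotens_act r (tens m h) = tens m (h * hsrc H r).
Proof. by rewrite /cotens_act tliftE //; exact: cotens_act_balanced. Qed.

Definition ucoact (r : R^o) : cotens R^o := tens (1 : R^o) (hsrc H r).
Fact ucoact_zmod : zmod_morphism ucoact.
Proof.
move=> a b; apply/eqP; rewrite eq_sym subr_eq -tensDr -rmorphD subrK //.
Qed.
HB.instance Definition _ :=
  GRing.isZmodMorphism.Build R^o (cotens R^o) ucoact ucoact_zmod.
Fact ucoact_lin (r : R) (m : R^o) : ucoact (r *: m) = cotens_act r (ucoact m).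
Proof. by rewrite cotens_actE /ucoact /= rmorphM mulrC. Qed.
Fact ucoact_eps (m : R^o) : tlift (fun (m' : R^o) h => heps H h *: m') (ucoact m) = m.
Proof.
rewrite tliftE; first by rewrite heps_src [LHS]mulr1.
split=> [a a' b|a b b'|c a b]; first exact: scalerDr.
  by rewrite rmorphD scalerDl.
by rewrite rmorphM /= heps_tgt scalerA mulrC.
Qed.
Fact ucoact_delta (m : R^o) :
  tlift (fun m' h => tens (ucoact m') h) (ucoact m) =
    tlift (fun m' h =>
             tlift (fun h1 h2 => tens (tens m' h1 : cotens R^o) h2) (hdelta H h))
      (ucoact m)
    :> tensor (@cotens_act R^o) (fun (r : R) (h : H) => htgt H r * h).
Proof.
pose T3 := tensor (@cotens_act R^o) (fun (r : R) (h : H) => htgt H r * h).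
have B1 : balanced (fun (r : R) (m : R^o) => r *: m)
    (fun (r : R) (h : H) => htgt H r * h) (fun m h => tens (ucoact m) h : T3).
  split=> [a a' b|a b b'|c a b]; last 1 first.
  - by rewrite ucoact_lin; exact: tensA.
  - by rewrite raddfD; exact: tensDl.
  - exact: tensDr.
have B2 (m' : R^o) : balanced (fun r (a : H) => a * hsrc H r)
    (fun r (b : H) => htgt H r * b)
    (fun h1 h2 => tens (tens m' h1 : cotens R^o) h2 : T3).
  split=> [a a' b|a b b'|c a b]; last 1 first.
  - by rewrite -cotens_actE; exact: tensA.
  - by rewrite (_ : tens m' (a + a') = tens m' a + tens m' a');
      [exact: tensDl | exact: tensDr].
  - exact: tensDr.
have B3 : balanced (fun (r : R) (m : R^o) => r *: m)
    (fun (r : R) (h : H) => htgt H r * h) (fun m h => tlift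
      (fun h1 h2 => tens (tens m h1 : cotens R^o) h2 : T3) (hdelta H h)).
  split=> [a a' b|a b b'|c a b].
  - rewrite /tlift /tens_sum -big_split; apply: eq_bigr => p _ /=.
    by rewrite (_ : tens (a + a') _ = tens a p.1 + tens a' p.1);
      [exact: tensDl | exact: tensDl].
  - by rewrite rmorphD tliftD.
  - rewrite rmorphM /= hdelta_tgt (tensor_sumE (hdelta H b)) mulr_sumr.
    rewrite !tlift_sum //; apply: eq_bigr => p _.
    rewrite ctensM mul1r !tliftE //; congr (tens _ _).
    exact: (tensA (fun (r : R) (m : R^o) => r *: m)).
rewrite (tliftE _ _ B1) (tliftE _ _ B3) hdelta_src (tliftE _ _ (B2 _)).
by rewrite /ucoact rmorph1.
Qed.
Fact ucofg : exists n (v : 'I_n -> R^o),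
  forall m, exists c : 'I_n -> R, m = \sum_i c i *: v i.
Proof.
by exists 1%N, (fun=> 1) => m; exists (fun=> m); rewrite big_ord1 [RHS]mulr1.
Qed.
Definition comod_unit : comodule :=
  Comodule (coact := ucoact) ucoact_lin ucoact_eps ucoact_delta ucofg.

(* The endomorphism algebra of the comodule R is isomorphic to k exactly when the
   canonical map k -> End(R) is bijective, which is the last clause. *)
Definition geom_transitive : Prop :=
  [/\ projective (lrestr (@envel_map _ _ H)),
      forall M : comodule, finite_length M,
      forall M N : comodule, fin_dim_hom M N
    & forall f : comod_hom comod_unit comod_unit,
        exists! c : k, forall r, f r = c%:A *: r].
End Comodules.

Record gtchalgd (k : fieldType) := GTCHAlgd {
  gtalgd :> chalgd k;
  gtP : geom_transitive gtalgd
}.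

Section Evaluation.
Variables (k : fieldType) (X : Type) (X0 : inhabited X).
Definition mapalg_eval (x : X) (f : mapalg k X0) : k^o := f x.
Fact eval_zmod x : zmod_morphism (mapalg_eval x). Proof. by []. Qed.
Fact eval_monoid x : monoid_morphism (mapalg_eval x). Proof. by []. Qed.
Fact eval_scal x : scalable (mapalg_eval x). Proof. by []. Qed.
HB.instance Definition _ x :=
  GRing.isZmodMorphism.Build (mapalg k X0) k^o (mapalg_eval x) (eval_zmod x).
HB.instance Definition _ x :=
  GRing.isMonoidMorphism.Build (mapalg k X0) k^o (mapalg_eval x) (eval_monoid x).
HB.instance Definition _ x :=
  GRing.isScalable.Build k (mapalg k X0) k^o *:%R (mapalg_eval x) (eval_scal x).
Fact mapalg_pt : inhabited (chars (mapalg k X0)).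
Proof.
have [x] : inhabited X by [].
by exists; exact: (mapalg_eval x : {lrmorphism mapalg k X0 -> k^o}).
Qed.
End Evaluation.

Section RepFunctions.
Variables (k : fieldType) (G : groupoid).
Implicit Types E F : rep k G.
Local Notation B := (mapalg k (gob_inh G)).

(* The sections of E, and the sections of its dual, which are identified with the
   M_k(G_0)-linear forms on the sections of E. *)
Definition sect E := forall x, rfib E x.
Definition cosect E := forall x, 'Hom(rfib E x, k^o).

Record rep_hom E F := RepHom {
  rmap :> forall x, 'Hom(rfib E x, rfib F x);
  rmap_act : forall g x y (e : gsrc g = x) (e' : gtgt g = y),
    (rmap y \o ract E g e e' = ract F g e e' \o rmap x)%VF
}.

(* Families of k-linear maps Gamma(E)^* (x)_k Gamma(E) -> W (given as bilinear
   maps) compatible with the morphisms of representations; the universal one is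
   the coend of Gamma(-)^* (x)_k Gamma(-). *)
Definition cowedge (W : lmodType k) (w : forall E, cosect E -> sect E -> W) :=
  [/\ forall E c (f f' : cosect E) (p : sect E),
        w E (fun x => c *: f x + f' x) p = c *: w E f p + w E f' p,
      forall E c (f : cosect E) (p p' : sect E),
        w E f (fun x => c *: p x + p' x) = c *: w E f p + w E f p'
    & forall E F (u : rep_hom E F) (f : cosect F) (p : sect E),
        w F f (fun x => u x (p x)) = w E (fun x => f x \o u x)%VF p].

Definition dual_basis E n (s : 'I_n -> sect E) (t : 'I_n -> cosect E) :=
  forall (p : sect E) x, p x = \sum_i (t i x (p x) : k) *: s i x.

(* The Hopf algebroid of representative functions on G.  The representations form
   a large category, so that the coend is given by its universal property
   (rcl_univ), which determines it up to a unique isomorphism, together with the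
   class maps rcl E f p of f (x) p; all the structure maps are then determined by
   their values on classes. *)
Record rep_functions := RepFunctions {
  rf :> hopf_algebroid B;
  rcl : forall E, cosect E -> sect E -> rf;
  rcl_wedge : cowedge rcl;
  rcl_univ : forall (W : lmodType k) (w : forall E, cosect E -> sect E -> W),
    cowedge w ->
    exists! u : {linear rf -> W}, forall E f p, u (@rcl E f p) = w E f p;
  rcl_mul : forall E F (f : cosect E) (p : sect E) (g : cosect F) (q : sect F),
    @rcl E f p * @rcl F g q =
    @rcl (rep_tens E F) (fun x => ftens (f x) (g x)) (fun x => vtens (p x) (q x));
  rcl_src : forall a : B, hsrc rf a = @rcl (rep_unit k G) (fun=> \1%VF) a;
  rcl_tgt : forall a : B,
    htgt rf a = @rcl (rep_unit k G) (fun x => a x *: \1%VF) (fun=> 1);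
  rcl_eps : forall E (f : cosect E) (p : sect E) x,
    (heps rf (@rcl E f p) : B) x = f x (p x);
  rcl_delta : forall E n (s : 'I_n -> sect E) (t : 'I_n -> cosect E),
    dual_basis s t -> forall (f : cosect E) (p : sect E),
    hdelta rf (@rcl E f p) = \sum_i tens (@rcl E f (s i)) (@rcl E (t i) p);
  rcl_anti : forall E (f : cosect E) (p : sect E),
    hanti rf (@rcl E f p) = @rcl (rep_dual E) (fun x => bidual (p x)) f
}.

Definition rep_chalgd (A : rep_functions) : chalgd k :=
  CHAlgd A (mapalg_pt k (gob_inh G)).
End RepFunctions.

(* u is the morphism induced by the functor p. *)
Definition is_rep_map (k : fieldType) (G H : groupoid) (A : rep_functions k G)
    (B : rep_functions k H) (p : grpd_hom G H)
    (u : chalgd_hom (rep_chalgd B) (rep_chalgd A)) : Prop :=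
  (forall (a : mapalg k (gob_inh H)) x,
     (hmap0 u a : mapalg k (gob_inh G)) x = a (gmap0 p x)) /\
  (forall (F : rep k H) (f : cosect F) (q : sect F),
     hmap1 u (rcl B f q) =
     rcl A (E := rep_res p F) (fun x => f (gmap0 p x)) (fun x => q (gmap0 p x))).

Definition transitive_groupoid (G : groupoid) : Prop :=
  forall x y : gob G, exists g, gsrc g = x /\ gtgt g = y.

(* Main.v *)
(* The coend R_k(G) is the algebra of the functions F on the arrows of G such that
   F(gh) is a finite sum of products a_i(g) b_i(h).  Matrix coefficients have this
   form; conversely the translates of such an F span finite-dimensional fibres of
   bounded dimension, on which G acts.  Their dimension may vary from one component
   of G to another, but adding trivial summands makes it constant.  The same
   padding, applied to the subrepresentation generated by a section, shows that a
   class of the coend vanishes as soon as its matrix coefficient does.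
   Since M_k(G_0) consists of all functions, R (x)_B R embeds into the functions on
   composable pairs, so that identities between structure maps are checked on
   arrows.  A functor F : G -> X(A) then gives the morphism sending h to
   g |-> F(g)(h), a representative function because Delta(h) is a finite sum, and
   this is inverse to evaluation at the points of G.

   If G is transitive, fix arrows from a base point to all objects.  A comodule is
   free over B = M_k(G_0) on a k-basis of the vectors that are invariant under the
   connecting arrows, a finite-dimensional representation of G from which finite
   length and finiteness of Hom spaces follow; and H is B (x) L (x) B, with L the
   functions that only depend on the loop at the base point obtained from an arrow,
   so that a k-linear lift extends to a lift over B (x) B.  Conversely, the
   indicator function of a component is an endomorphism of the unit comodule. *)
From HB Require Import structures.
Require Import Defs.
From mathcomp Require Import all_boot all_algebra.
From mathcomp Require Import boolp functions classical_sets.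
Set Implicit Arguments.
Unset Strict Implicit.
Unset Printing Implicit Defensive.
Import GRing.Theory.
Local Open Scope ring_scope.

(** * Linear algebra *)

Section Independence.
Variables (k : fieldType) (V : lmodType k).

Definition lspan n (w : 'I_n -> V) (v : V) :=
  exists c : 'I_n -> k, v = \sum_i c i *: w i.
Definition indep n (w : 'I_n -> V) :=
  forall c : 'I_n -> k, \sum_i c i *: w i = 0 -> forall i, c i = 0.

Lemma lspan_mem n (w : 'I_n -> V) i : lspan w (w i).
Proof.
exists (fun j => (j == i)%:R); rewrite (bigD1 i) //= eqxx scale1r big1 ?addr0 //.
by move=> j /negPf ->; rewrite scale0r.
Qed.

Lemma lspan_ind n (w : 'I_n -> V) (P : V -> Prop) :
  P 0 -> (forall c u v, P u -> P v -> P (c *: u + v)) -> (forall i, P (w i)) ->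
  forall v, lspan w v -> P v.
Proof.
move=> P0 PD Pw v [c ->]; apply: big_ind => // [x y Px Py|i _].
  by rewrite -[x]scale1r; exact: PD.
by rewrite -[_ *: _]addr0; exact: PD.
Qed.

(** If [d > n], the coefficient matrix of the [u i] has more rows than columns, and a nonzero vector
    of its left kernel is a relation between them. *)
Lemma indep_leq n d (w : 'I_n -> V) (u : 'I_d -> V) :
  indep u -> (forall i, lspan w (u i)) -> (d <= n)%N.
Proof.
move=> iu /choice[C CE]; rewrite leqNgt; apply/negP => lt.
pose M := \matrix_(i, j) C i j : 'M_(d, n).
have : (0 < \rank (kermx M))%N.
  by rewrite mxrank_ker subn_gt0 (leq_ltn_trans (rank_leq_col M)).
rewrite lt0n mxrank_eq0 => /rowV0Pn[v /sub_kermxP vM /eqP v0]; apply: v0.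
apply/rowP => i; rewrite mxE; apply: (iu (v 0)).
transitivity (\sum_j (v *m M) 0 j *: w j).
  under eq_bigr do rewrite CE scaler_sumr.
  rewrite exchange_big; apply: eq_bigr => j _; rewrite mxE scaler_suml.
  by apply: eq_bigr => l _; rewrite mxE scalerA.
by rewrite vM big1 // => j _; rewrite mxE scale0r.
Qed.

Lemma indep_inj n (w : 'I_n -> V) (a b : 'I_n -> k) : indep w ->
  \sum_i a i *: w i = \sum_i b i *: w i -> a =1 b.
Proof.
move=> iw e i; apply/eqP; rewrite -subr_eq0; apply/eqP.
apply: (iw (fun i => a i - b i)); under eq_bigr do rewrite scalerBl.
by rewrite sumrB e subrr.
Qed.

Definition fcons d (v : V) (u : 'I_d -> V) (i : 'I_d.+1) :=
  if unlift ord0 i is Some j then u j else v.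

Lemma indep_fcons d (v : V) (u : 'I_d -> V) :
  indep u -> ~ lspan u v -> indep (fcons v u).
Proof.
move=> iu nv c; rewrite big_ord_recl /fcons unlift_none.
under eq_bigr do rewrite liftK.
move=> e; have c0 : c ord0 = 0.
  apply: contrapT => /eqP c0; apply: nv.
  exists (fun i => - (c ord0)^-1 * c (lift ord0 i)).
  under eq_bigr do rewrite -scalerA.
  rewrite -scaler_sumr; move/eqP: e; rewrite addrC addr_eq0 => /eqP ->.
  by rewrite scaleNr scalerN opprK scalerA mulVf // scale1r.
move: e; rewrite c0 scale0r add0r => /iu ci i.
by case: (unliftP ord0 i) => [j ->|->].
Qed.

(** Independent families in [D] have at most [n] members, and a largest one spans [D], since a
    vector outside its span could be prepended. [D] is an arbitrary predicate, so the basis is made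
    of vectors of [D] itself. *)
Lemma max_indep (D : V -> Prop) n (w : 'I_n -> V) :
  (forall v, D v -> lspan w v) ->
  exists d (u : 'I_d -> V),
    [/\ (d <= n)%N, forall i, D (u i), indep u & forall v, D v -> lspan u v].
Proof.
move=> Dw; pose P d := `[< exists u : 'I_d -> V, (forall i, D (u i)) /\ indep u >].
have P0 : exists d, P d.
  (* The empty family; [w] and [widen_ord] only serve to name a function on ['I_0]. *)
  exists 0%N; apply/asboolP; exists (fun i => w (widen_ord (leq0n n) i)).
  by split=> [[]|c _ []].
have Pn d : P d -> (d <= n)%N.
  by move=> /asboolP[u [Du iu]]; apply: (indep_leq iu) => i; apply: Dw.
have [d /asboolP[u [Du iu]] dmax] := ex_maxnP P0 Pn.
exists d, u; split=> // [|v Dv].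
  by apply: Pn; apply/asboolP; exists u.
apply: contrapT => nv; suff /dmax : P d.+1 by rewrite ltnn.
apply/asboolP; exists (fcons v u); split=> [i|]; last exact: indep_fcons.
by rewrite /fcons; case: unliftP.
Qed.

(** Otherwise [fcons v u] would be [d.+1] independent vectors in a span of [d]. *)
Lemma indep_full d (w u : 'I_d -> V) : indep u -> (forall i, lspan w (u i)) ->
  forall v, lspan w v -> lspan u v.
Proof.
move=> iu uw v wv; apply: contrapT => nv.
suff : (d.+1 <= d)%N by rewrite ltnn.
apply: (@indep_leq _ _ w (fcons v u)); first exact: indep_fcons.
by move=> i; rewrite /fcons; case: unliftP.
Qed.
End Independence.

(* The rows [alpha] and columns [beta] annihilate each other, so some projection
   splits [k^n] between them. *)
Lemma annihilating_projection (k : fieldType) n (D : 'rV[k]_n -> Prop)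
    (D' : 'cV[k]_n -> Prop) :
  (forall a b, D a -> D' b -> a *m b = 0) ->
  exists P : 'M[k]_n, (forall a, D a -> a *m P = 0) /\ (forall b, D' b -> P *m b = b).
Proof.
move=> ann.
have [v _|d [u [_ Du _ uD]]] := @max_indep k 'rV[k]_n D n (delta_mx 0).
  by exists (v 0); apply: row_sum_delta.
(* [pinvmx A *m A] fixes the row space of [A], which contains [D], and kills the columns killed by
   [A]; its complement is the projection sought. *)
pose A := \matrix_i u i; exists (1%:M - pinvmx A *m A).
have uE i : u i = delta_mx 0 i *m A by rewrite -rowE rowK.
split=> [a /uD[c ->]|b D'b].
  rewrite mulmx_suml big1 // => i _; rewrite -scalemxAl uE -mulmxA mulmxBr mulmx1.
  by rewrite mulmxA mulmxKpV // subrr mulmx0 scaler0.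
rewrite mulmxBl mul1mx -mulmxA (_ : A *m b = 0) ?mulmx0 ?subr0 //.
by apply/row_matrixP => i; rewrite row_mul rowK row0 ann.
Qed.

(** * Representations with fibres of constant dimension *)

Section PaddedRep.
Variables (k : fieldType) (G : groupoid) (V : gob G -> lmodType k).
Variable rho : forall g x y, gsrc g = x -> gtgt g = y -> {linear V x -> V y}.
Hypothesis rho_id : forall x e e' v, @rho (gid x) x x e e' v = v.
Hypothesis rho_comp : forall g h (gh : gsrc g = gtgt h) x y z es et eh eg e e' v,
  @rho (gcomp gh) x z e e' v = @rho g y z eg et (@rho h x y es eh v).
Variable p : forall x, V x.

(** Orbits stand in for the subspaces they span: [rho] maps orbits into orbits, and bases of the
    spans can be chosen inside the orbits. *)
Definition orbit_at y (v : V y) :=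
  exists g x (e : gsrc g = x) (e' : gtgt g = y), v = rho e e' (p x).

Lemma rho_inj g x y (e : gsrc g = x) (e' : gtgt g = y) : injective (rho e e').
Proof.
have f : gsrc (ginv g) = y by rewrite gsrc_inv.
have f' : gtgt (ginv g) = x by rewrite gtgt_inv.
apply: (can_inj (g := rho f f')) => v.
have c : gsrc (ginv g) = gtgt g by rewrite f.
have ce : gsrc (gcomp c) = x by rewrite gsrc_comp.
have ce' : gtgt (gcomp c) = x by rewrite gtgt_comp.
rewrite -(rho_comp (gh := c) e f' e' f ce ce').
by move: ce ce'; rewrite gcompVl; subst x => ce ce'; exact: rho_id.
Qed.

Lemma rho_orbit g x y (e : gsrc g = x) (e' : gtgt g = y) v :
  orbit_at v -> orbit_at (rho e e' v).
Proof.
move=> [h [z [eh [eh' ->]]]].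
have c : gsrc g = gtgt h by rewrite e.
have ce : gsrc (gcomp c) = z by rewrite gsrc_comp.
have ce' : gtgt (gcomp c) = y by rewrite gtgt_comp.
exists (gcomp c), z, ce, ce'.
by rewrite -(rho_comp (gh := c) eh e' eh' e ce ce').
Qed.

Lemma p_orbit x : orbit_at (p x).
Proof. by exists (gid x), x, (gsrc_id x), (gtgt_id x); rewrite rho_id. Qed.

Variable n : nat.
Hypothesis orbit_bounded :
  forall y, exists w : 'I_n -> V y, forall v, orbit_at v -> lspan w v.

Let basis_ex y : exists s : {d : nat & 'I_d -> V y},
  [/\ (tag s <= n)%N, forall i, orbit_at (tagged s i), indep (tagged s)
    & forall v, orbit_at v -> lspan (tagged s) v].
Proof.
have [w /max_indep[d [u uP]]] := orbit_bounded y.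
by exists (Tagged (fun d => 'I_d -> V y) u).
Qed.

Let bas y := projT1 (cid (basis_ex y)).
Let rk y := tag (bas y).
Let bP y := projT2 (cid (basis_ex y)).

(** [rho] is injective and preserves orbits, so it carries the orbit basis at [x] to independent
    vectors in the span of the orbit at [y]. *)
Let rk_le g x y (e : gsrc g = x) (e' : gtgt g = y) : (rk x <= rk y)%N.
Proof.
have [_ ox ix _] := bP x; have [_ _ _ sy] := bP y.
apply: (@indep_leq _ _ _ _ (tagged (bas y)) (fun i => rho e e' (tagged (bas x) i))).
  move=> c; under eq_bigr do rewrite -linearZ; rewrite -linear_sum => e0; apply: ix.
  by apply: (@rho_inj _ _ _ e e'); rewrite e0 linear0.
by move=> i; apply/sy/rho_orbit/ox.
Qed.

Let rk_eq g x y (e : gsrc g = x) (e' : gtgt g = y) : rk x = rk y.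
Proof.
apply/eqP; rewrite eqn_leq (rk_le e e').
by apply: (@rk_le (ginv g)); rewrite ?gsrc_inv ?gtgt_inv.
Qed.

(** The orbit basis, extended by zeros to [n] vectors. The resulting map [em] from [k^n] is
    injective on the image of the coordinate projection [pi] and zero on the complementary
    coordinates. *)
Let pb y (i : 'I_n) : V y := if insub (i : nat) is Some j then tagged (bas y) j else 0.
Let em y (v : 'rV[k]_n) : V y := \sum_i v 0 i *: pb y i.
Let em_linear y : linear (em y).
Proof.
move=> c u v; rewrite /em scaler_sumr -big_split; apply: eq_bigr => i _.
by rewrite !mxE scalerDl scalerA.
Qed.
HB.instance Definition _ y := GRing.isLinear.Build k _ _ _ (em y) (em_linear y).

Let pi y : 'M[k]_n := pid_mx (rk y).

Let rk_n y : (rk y <= n)%N. Proof. by have [] := bP y. Qed.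

Let em_big y (v : 'rV[k]_n) :
  em y v = \sum_(j < rk y) v 0 (widen_ord (rk_n y) j) *: tagged (bas y) j.
Proof.
rewrite /em (bigID (fun i : 'I_n => (i < rk y)%N)) /= [X in _ + X]big1 ?addr0.
  rewrite (big_ord_narrow (rk_n y)); apply: eq_bigr => j _; congr (_ *: _).
  rewrite /pb /=; case: insubP => [i _ ij|]; last by rewrite ltn_ord.
  by congr (tagged (bas y) _); apply: val_inj.
by move=> i lt; rewrite /pb insubF ?scaler0 //; apply: negbTE.
Qed.

Let pi_mul y (v : 'rV[k]_n) i : (v *m pi y) 0 i = if (i < rk y)%N then v 0 i else 0.
Proof.
rewrite mxE (bigD1 i) //= mxE eqxx big1 => [|j /negPf ji].
  by case: ltnP; rewrite /= ?mulr1 ?mulr0 addr0.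
by rewrite mxE -val_eqE /= in ji *; rewrite ji mulr0.
Qed.

Let em_pi y v : em y (v *m pi y) = em y v.
Proof. by rewrite !em_big; apply: eq_bigr => j _; rewrite pi_mul /= ltn_ord. Qed.

Let em_eq0 y v : em y v = 0 -> v *m pi y = 0.
Proof.
rewrite em_big => e; have [_ _ iy _] := bP y.
apply/rowP => i; rewrite pi_mul mxE; case: ifP => // lt.
have := iy (fun j => v 0 (widen_ord (rk_n y) j)) e (Ordinal lt).
by move <-; congr (v 0 _); apply: val_inj.
Qed.

Let em_inj y u v : em y u = em y v -> u *m pi y = v *m pi y.
Proof.
by move=> /eqP; rewrite -subr_eq0 -linearB => /eqP/em_eq0/eqP;
  rewrite mulmxBl subr_eq0 => /eqP.
Qed.

Let em_onto y v : lspan (tagged (bas y)) v -> exists u, em y u = v.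
Proof.
move=> [c ->]; exists (\row_i if insub (i : nat) is Some j then c j else 0).
rewrite em_big; apply: eq_bigr => j _; rewrite mxE; congr (_ *: _).
case: insubP => [i _ ij|/=]; last by rewrite ltn_ord.
by congr (c _); apply: val_inj.
Qed.

Let em_span y v : exists m (z : 'I_m -> V y), (forall i, orbit_at (z i)) /\ lspan z (em y v).
Proof.
by exists (rk y), (tagged (bas y)); have [] := bP y; split=> //; eexists; exact: em_big.
Qed.

(** [T] is the matrix of [rho] in the orbit bases. Its normalisation by [pi] makes it unique
    ([T_uniq]), so that functoriality of [rho] passes to [T]. *)
Let T_ex g x y (e : gsrc g = x) (e' : gtgt g = y) :
  exists T : 'M[k]_n, [/\ pi x *m T = T, T *m pi y = T
    & forall v, em y (v *m T) = rho e e' (em x v)].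
Proof.
have [_ ox _ _] := bP x; have [_ _ _ sy] := bP y.
have /choice[t tE] i : exists u, em y u = rho e e' (em x (delta_mx 0 i)).
  apply: em_onto; have [m [z [oz zs]]] := @em_span x (delta_mx 0 i).
  apply: (@lspan_ind _ _ _ z (fun v => lspan _ (rho e e' v))) zs => [|c u v|j];
    last exact/sy/rho_orbit/oz.
    by rewrite linear0; exists (fun=> 0); rewrite big1 // => j _; rewrite scale0r.
  move=> [c1 E1] [c2 E2]; exists (fun j => c * c1 j + c2 j).
  rewrite linearP E1 E2 scaler_sumr -big_split; apply: eq_bigr => j _.
  by rewrite scalerDl scalerA.
pose T := \matrix_i t i.
have TE v : em y (v *m T) = rho e e' (em x v).
  rewrite mulmx_sum_row linear_sum [in RHS](row_sum_delta v).
  rewrite (linear_sum (em x)) (linear_sum (rho e e')).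
  by apply: eq_bigr => i _; rewrite !linearZ /= rowK tE.
exists (pi x *m T *m pi y); split.
- by rewrite !mulmxA pid_mx_id.
- by rewrite -!mulmxA pid_mx_id.
- by move=> v; rewrite !mulmxA em_pi TE em_pi.
Qed.

Let T g x y (e : gsrc g = x) (e' : gtgt g = y) := projT1 (cid (T_ex e e')).
Let piT g x y (e : gsrc g = x) (e' : gtgt g = y) : pi x *m T e e' = T e e'.
Proof. by rewrite /T; case: cid => /= ? []. Qed.
Let Tpi g x y (e : gsrc g = x) (e' : gtgt g = y) : T e e' *m pi y = T e e'.
Proof. by rewrite /T; case: cid => /= ? []. Qed.
Let TE g x y (e : gsrc g = x) (e' : gtgt g = y) v :
  em y (v *m T e e') = rho e e' (em x v).
Proof. by rewrite /T; case: cid => /= ? []. Qed.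

Let T_uniq y (A B : 'M[k]_n) : A *m pi y = A -> B *m pi y = B ->
  (forall v : 'rV[k]_n, em y (v *m A) = em y (v *m B)) -> A = B.
Proof.
move=> Ay By e; apply/row_matrixP => i; rewrite !rowE -Ay -By !mulmxA.
exact/em_inj/e.
Qed.

(** [T] acts on the first [rk x] coordinates and [copid_mx] is the identity on the others. The
    padding makes all fibres isomorphic, as [rep] demands, although the rank may vary from one
    component to another. *)
Definition pad_act g x y (e : gsrc g = x) (e' : gtgt g = y) :
    'Hom('rV[k]_n, 'rV[k]_n) := linfun (mulmxr (T e e' + copid_mx (rk x))).

Let pad_actE g x y (e : gsrc g = x) (e' : gtgt g = y) v :
  pad_act e e' v = v *m (T e e' + copid_mx (rk x)).
Proof. by rewrite lfunE. Qed.

Fact pad_iso : exists W : vectType k,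
  forall x : gob G, exists f : 'Hom('rV[k]_n, W), bijective f.
Proof. by exists 'rV[k]_n => _; exists \1%VF; exists id => v; rewrite lfunE. Qed.

Fact pad_id x (e : gsrc (gid x) = x) (e' : gtgt (gid x) = x) : pad_act e e' = \1%VF.
Proof.
suff -> : pad_act e e' = linfun (mulmxr (pi x + copid_mx (rk x))).
  by apply/lfunP => v; rewrite !lfunE /= addrC subrK mulmx1.
rewrite /pad_act; congr (linfun (mulmxr (_ + _))); apply: (@T_uniq x) => [||v].
- exact: Tpi.
- exact: pid_mx_id.
- by rewrite TE rho_id em_pi.
Qed.

Fact pad_comp g h (gh : gsrc g = gtgt h) x y z
    (es : gsrc h = x) (et : gtgt g = z) (eh : gtgt h = y) (eg : gsrc g = y)
    (e : gsrc (gcomp gh) = x) (e' : gtgt (gcomp gh) = z) :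
  pad_act e e' = (pad_act eg et \o pad_act es eh)%VF.
Proof.
apply/lfunP => v; rewrite comp_lfunE !pad_actE -mulmxA; congr (_ *m _).
(* Ranks agree along arrows, so both cross terms between [T] and the padding vanish. *)
have Rxy := rk_eq es eh; rewrite mulmxDl [T es eh *m _]mulmxDr [copid_mx (rk x) *m _]mulmxDr.
have -> : T es eh *m copid_mx (rk y) = 0.
  by rewrite mulmxBr Tpi mulmx1 subrr.
have -> : copid_mx (rk x) *m T eg et = 0.
  by rewrite Rxy mulmxBl piT mul1mx subrr.
have -> : copid_mx (rk x) *m copid_mx (rk y) = copid_mx (rk x) :> 'M[k]_n.
  by rewrite Rxy copid_mx_id.
rewrite addr0 add0r; congr (_ + _); apply: (@T_uniq z) => [||w].
- exact: Tpi.
- by rewrite -mulmxA Tpi.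
- by rewrite mulmxA !TE (rho_comp es et eh eg e e').
Qed.

Definition pad_rep : rep k G := Rep pad_iso pad_id pad_comp.

(** The map [u] is [em]: it kills the padding, hence is equivariant, and its image lies in the span
    of the orbits. It need not be injective; it serves to pull forms and sections back to a
    representation with constant fibre dimension. *)
Lemma orbit_span_rep :
  exists (F : rep k G) (u : forall x, {linear rfib F x -> V x}) (q : sect F),
    [/\ forall g x y (e : gsrc g = x) (e' : gtgt g = y) v,
          u y (ract F g e e' v) = rho e e' (u x v),
        forall x, u x (q x) = p x
      & forall x v, exists m (z : 'I_m -> V x),
          (forall i, orbit_at (z i)) /\ lspan z (u x v)].
Proof.
have q x : exists v, em x v = p x.
  by apply: em_onto; have [_ _ _ H] := bP x; exact/H/p_orbit.
exists pad_rep, em, (fun x => sval (cid (q x))).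
split=> [g x y e e' v|x|]; [|by case: cid|exact: em_span].
rewrite pad_actE mulmxDr linearD /= TE.
have -> : em y (v *m copid_mx (rk x)) = 0.
  by rewrite (rk_eq e e') mulmxBr linearB /= em_pi mulmx1 subrr.
by rewrite addr0.
Qed.
End PaddedRep.

(** * Matrix coefficients, direct sums and cowedges *)

Section MatrixCoefficients.
Variables (k : fieldType) (G : groupoid).
Implicit Types E F : rep k G.

Definition coef E (f : cosect E) (p : sect E) (g : garr G) : k :=
  f (gtgt g) (ract E g erefl erefl (p (gsrc g))).

Lemma coef_at E (f : cosect E) (p : sect E) g x y (e : gsrc g = x) (e' : gtgt g = y) :
  coef f p g = f y (ract E g e e' (p x)).
Proof. by subst x y. Qed.

Lemma coef_id E (f : cosect E) (p : sect E) x : coef f p (gid x) = f x (p x).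
Proof. by rewrite (coef_at _ _ (gsrc_id x) (gtgt_id x)) ract_id lfunE. Qed.

Lemma coef_comp E (f : cosect E) (p : sect E) g h (e : gsrc g = gtgt h) :
  coef f p (gcomp e) =
  f (gtgt g) (ract E g erefl erefl (ract E h erefl (esym e) (p (gsrc h)))).
Proof.
rewrite (coef_at _ _ (gsrc_comp e) (gtgt_comp e)).
by rewrite (ract_comp _ erefl erefl (esym e) erefl) comp_lfunE.
Qed.

(** A basis of the common model [V] of the fibres, transported to each of them, gives dual families
    of the same size over all objects. *)
Lemma dual_basis_ex E :
  exists n (s : 'I_n -> sect E) (t : 'I_n -> cosect E), dual_basis s t.
Proof.
have [V VP] := rfib_iso E.
pose f x := sval (cid (VP x)).
have /(_ _)/lfun_bij fb x : bijective (f x) by rewrite /f; case: cid.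
exists (\dim {:V}), (fun i x => (f x)^-1%VF (vbasis {:V})`_i).
exists (fun i x => (linfun (coord (vbasis {:V}) i : V -> k^o) \o f x)%VF) => p x.
have [g gf fg] := fb x; rewrite (inv_lfun_uniq gf fg).
have {1}-> : p x = g (f x (p x)) by rewrite -comp_lfunE gf lfunE.
rewrite {1}(coord_vbasis (memvf (f x (p x)))) linear_sum.
by apply: eq_bigr => i _; rewrite linearZ comp_lfunE lfunE.
Qed.

(** [dual_basis] speaks of sections only, but any vector at [x] is the value of the section [r] that
    vanishes at all other objects. *)
Lemma dual_basis_at E n (s : 'I_n -> sect E) (t : 'I_n -> cosect E) :
  dual_basis s t -> forall x (v : rfib E x), v = \sum_i (t i x v : k) *: s i x.
Proof.
move=> st x v.
pose r : sect E := fun y => if pselect (x = y) is left e then ecast y (rfib E y) e v else 0.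
suff -> : v = r x by apply: st.
by rewrite /r; case: pselect => // e; rewrite (Prop_irrelevance e erefl).
Qed.

Lemma coef_dual_basis E n (s : 'I_n -> sect E) (t : 'I_n -> cosect E) :
  dual_basis s t -> forall (f : cosect E) (p : sect E) g h (e : gsrc g = gtgt h),
  coef f p (gcomp e) = \sum_i coef f (s i) g * coef (t i) p h.
Proof.
move=> st f p g h e; rewrite coef_comp.
rewrite {1}(dual_basis_at st (ract E h _ _ _)) !linear_sum.
apply: eq_bigr => i _; rewrite !linearZ mulrC.
by rewrite (coef_at (t i) p erefl (esym e)).
Qed.

Section DirectSum.
Variables E F : rep k G.

Section Maps.
Variables (U V U' V' : vectType k) (a : 'Hom(U, U')) (b : 'Hom(V, V')).
Definition pair_fun (v : U * V) : U' * V' := (a v.1, b v.2).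
Fact pair_fun_linear : linear pair_fun.
Proof. by move=> c u v; rewrite /pair_fun !linearP. Qed.
HB.instance Definition _ := GRing.isLinear.Build k _ _ _ pair_fun pair_fun_linear.
Definition lpair : 'Hom((U * V)%type, (U' * V')%type) := linfun pair_fun.
Lemma lpairE v : lpair v = (a v.1, b v.2). Proof. by rewrite lfunE. Qed.
End Maps.

Lemma lpair_comp (U V U' V' U'' V'' : vectType k) (a : 'Hom(U, U'))
    (b : 'Hom(V, V')) (a' : 'Hom(U', U'')) (b' : 'Hom(V', V'')) :
  lpair (a' \o a)%VF (b' \o b)%VF = (lpair a' b' \o lpair a b)%VF.
Proof. by apply/lfunP => v; rewrite comp_lfunE !lpairE !comp_lfunE. Qed.
Lemma lpair_id (U V : vectType k) :
  lpair (\1 : 'Hom(U, U))%VF (\1 : 'Hom(V, V))%VF = \1%VF.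
Proof. by apply/lfunP => -[u v]; rewrite lpairE !id_lfunE. Qed.

Fact rep_sum_iso : exists W : vectType k,
  forall x, exists f : 'Hom((rfib E x * rfib F x)%type, W), bijective f.
Proof.
have [V VP] := rfib_iso E; have [W WP] := rfib_iso F; exists (V * W)%type => x.
have [f /lfun_bij[f' ff' f'f]] := VP x; have [g /lfun_bij[g' gg' g'g]] := WP x.
exists (lpair f g); apply/lfun_bij; exists (lpair f' g');
  by rewrite -lpair_comp ?ff' ?gg' ?f'f ?g'g lpair_id.
Qed.
Fact rep_sum_id x (e : gsrc (gid x) = x) (e' : gtgt (gid x) = x) :
  lpair (ract E (gid x) e e') (ract F (gid x) e e') = \1%VF.
Proof. by rewrite !ract_id lpair_id. Qed.
Fact rep_sum_comp g h (gh : gsrc g = gtgt h) x y z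
    (es : gsrc h = x) (et : gtgt g = z) (eh : gtgt h = y) (eg : gsrc g = y)
    (e : gsrc (gcomp gh) = x) (e' : gtgt (gcomp gh) = z) :
  lpair (ract E _ e e') (ract F _ e e') =
  (lpair (ract E g eg et) (ract F g eg et) \o lpair (ract E h es eh) (ract F h es eh))%VF.
Proof. by rewrite !(ract_comp _ es et eh eg e e') lpair_comp. Qed.
(** Direct sums merge a linear combination of values of a cowedge into a single value. *)
Definition rep_sum : rep k G := @Rep k G (fun x => (rfib E x * rfib F x)%type)
  (fun g x y e e' => lpair (ract E g e e') (ract F g e e'))
  rep_sum_iso rep_sum_id rep_sum_comp.

Section Injections.
Variables U V : vectType k.
Definition inl_fun (u : U) : U * V := (u, 0).
Definition inr_fun (v : V) : U * V := (0, v).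
Fact inl_fun_linear : linear inl_fun.
Proof. by move=> c u v; rewrite /inl_fun; congr (_, _); rewrite /= scaler0 addr0. Qed.
Fact inr_fun_linear : linear inr_fun.
Proof. by move=> c u v; rewrite /inr_fun; congr (_, _); rewrite /= scaler0 addr0. Qed.
HB.instance Definition _ := GRing.isLinear.Build k _ _ _ inl_fun inl_fun_linear.
HB.instance Definition _ := GRing.isLinear.Build k _ _ _ inr_fun inr_fun_linear.
Definition linl : 'Hom(U, (U * V)%type) := linfun inl_fun.
Definition linr : 'Hom(V, (U * V)%type) := linfun inr_fun.
Lemma linlE u : linl u = (u, 0). Proof. by rewrite lfunE. Qed.
Lemma linrE u : linr u = (0, u). Proof. by rewrite lfunE. Qed.
Variables (f : 'Hom(U, k^o)) (g : 'Hom(V, k^o)).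
Definition copair_fun (v : U * V) : k^o := f v.1 + g v.2.
Fact copair_fun_linear : linear copair_fun.
Proof. by move=> c u v; rewrite /copair_fun !linearP scalerDr addrACA. Qed.
HB.instance Definition _ := GRing.isLinear.Build k _ _ _ copair_fun copair_fun_linear.
Definition copair : 'Hom((U * V)%type, k^o) := linfun copair_fun.
Lemma copairE v : copair v = f v.1 + g v.2. Proof. by rewrite lfunE. Qed.
End Injections.

Fact rep_inl_act g x y (e : gsrc g = x) (e' : gtgt g = y) :
  (linl _ _ \o ract E g e e' = ract rep_sum g e e' \o linl _ _)%VF.
Proof. by apply/lfunP => v; rewrite !comp_lfunE lpairE !linlE /= linear0. Qed.
Fact rep_inr_act g x y (e : gsrc g = x) (e' : gtgt g = y) :
  (linr _ _ \o ract F g e e' = ract rep_sum g e e' \o linr _ _)%VF.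
Proof. by apply/lfunP => v; rewrite !comp_lfunE lpairE !linrE /= linear0. Qed.
Definition rep_inl : rep_hom E rep_sum := @RepHom k G _ rep_sum (fun x => linl _ _) rep_inl_act.
Definition rep_inr : rep_hom F rep_sum := @RepHom k G _ rep_sum (fun x => linr _ _) rep_inr_act.

Definition sect_pair (p : sect E) (q : sect F) : sect rep_sum := fun x => (p x, q x).
Definition cosect_pair (f : cosect E) (g : cosect F) : cosect rep_sum :=
  fun x => copair (f x) (g x).

Lemma coef_sum f g p q a :
  coef (cosect_pair f g) (sect_pair p q) a = coef f p a + coef g q a.
Proof. by rewrite /coef /= copairE lpairE. Qed.
End DirectSum.

Section Cowedges.
Variables (W : lmodType k) (w : forall {E}, cosect E -> sect E -> W).
Hypothesis cw : cowedge (@w).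

Lemma cowedge0l E (p : sect E) : w (fun=> 0) p = 0.
Proof.
have [/(_ E (-1) (fun=> 0) (fun=> 0) p) + _ _] := cw.
rewrite (_ : (fun x => -1 *: (0 : 'Hom(rfib E x, k^o)) + 0) = fun=> 0).
  by rewrite scaleN1r addNr.
by apply/functional_extensionality_dep => x; rewrite scaler0 addr0.
Qed.

(** A pair of sections is the sum of its images under the two injections, and naturality moves each
    injection over to the form. *)
Lemma cowedge_sum E F (f : cosect E) (g : cosect F) p q :
  w (cosect_pair f g) (sect_pair p q) = w f p + w g q.
Proof.
have [_ wD wu] := cw.
pose S : rep k G := rep_sum E F.
have -> : sect_pair p q = fun x => 1 *: ((p x, 0) : rfib S x) + ((0, q x) : rfib S x).
  apply/functional_extensionality_dep => x; rewrite scale1r /sect_pair.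
  by congr (_, _); rewrite /= ?addr0 ?add0r.
rewrite wD scale1r; congr (_ + _).
- have -> : (fun x => (p x, 0) : rfib S x) = fun x => rep_inl E F x (p x).
    by apply/functional_extensionality_dep => x; rewrite linlE.
  rewrite wu; congr (w _ p); apply/functional_extensionality_dep => x.
  by apply/lfunP => v; rewrite comp_lfunE copairE linlE /= linear0 addr0.
- have -> : (fun x => (0, q x) : rfib S x) = fun x => rep_inr E F x (q x).
    by apply/functional_extensionality_dep => x; rewrite linrE.
  rewrite wu; congr (w _ q); apply/functional_extensionality_dep => x.
  by apply/lfunP => v; rewrite comp_lfunE copairE linrE /= linear0 add0r.
Qed.

(* [f] vanishes on the subrepresentation generated by [p], which is the image of
   a representation with fibres of constant dimension. *)
Lemma cowedge_coef0 E (f : cosect E) (p : sect E) :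
  (forall g, coef f p g = 0) -> w f p = 0.
Proof.
move=> fp0; have [n [s [t st]]] := dual_basis_ex E.
have [|||F [u [q [ua uq us]]]] := @orbit_span_rep k G (fun x => rfib E x)
  (fun g x y e e' => ract E g e e') _ _ p n.
- by move=> x e e' v; rewrite /= ract_id; exact: id_lfunE.
- move=> g h gh x y z es et eh eg e e' v.
  by rewrite /= (ract_comp _ es et eh eg); exact: comp_lfunE.
(* A dual basis bounds the span of the orbits in every fibre by the same [n]. *)
- move=> y; exists (fun i => s i y) => v _; exists (fun i => t i y v).
  exact: dual_basis_at.
have uact g x y (e : gsrc g = x) (e' : gtgt g = y) :
    (linfun (u y) \o ract F g e e' = ract E g e e' \o linfun (u x))%VF.
  by apply/lfunP => v; rewrite !comp_lfunE !lfunE /= ua.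
(* By naturality along [u] it remains to see that [f] vanishes on the image of [u], which is spanned
   by orbit vectors; there its values are matrix coefficients. *)
have [_ _ /(_ F E (RepHom uact) f q) /=] := cw.
have -> : (fun x => linfun (u x) (q x)) = p.
  by apply/functional_extensionality_dep => x; rewrite lfunE /= uq.
move=> ->; rewrite -[RHS](cowedge0l q); congr (w _ q).
apply/functional_extensionality_dep => x; apply/lfunP => v.
rewrite comp_lfunE lfunE [RHS]lfunE /=.
have [m [z [zo zs]]] := us x v.
apply: (@lspan_ind _ _ _ z (fun v => f x v = 0)) zs => [|c a b fa fb|i].
- exact: linear0.
- by have := linearP (f x) c a b => /= ->; move: fa fb => /= -> ->; rewrite scaler0 addr0.
by have [g [y [e [e' ->]]]] := zo i; rewrite -(coef_at f p e e').
Qed.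

(** Through direct sums the difference of the two sides is one value of [w], whose coefficient
    function is zero. Thus [w] depends linearly on the coefficient function alone. *)
Lemma cowedge_coefP c E E1 E2 (f : cosect E) (p : sect E) (f1 : cosect E1)
    (p1 : sect E1) (f2 : cosect E2) (p2 : sect E2) :
  (forall g, coef f p g = c * coef f1 p1 g + coef f2 p2 g) ->
  w f p = c *: w f1 p1 + w f2 p2.
Proof.
move=> e; have [wl _ _] := cw; apply/eqP; rewrite -subr_eq0; apply/eqP.
have sc F a (g : cosect F) q : w (fun x => a *: g x) q = a *: w g q.
  rewrite -[RHS]addr0 -(cowedge0l q) -wl; congr (w _ q).
  by apply/functional_extensionality_dep => x; rewrite addr0.
rewrite opprD -!scaleN1r -(sc _ (-1) f2) scalerA -sc -!cowedge_sum.
apply: cowedge_coef0 => g; rewrite !coef_sum e.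
have cZ F a (h : cosect F) q : coef (fun x => a *: h x) q g = a * coef h q g.
  by rewrite /coef lfunE.
by rewrite !cZ !mulN1r mulNr addrACA !subrr addr0.
Qed.
End Cowedges.
End MatrixCoefficients.

(** * Functions of finite type on the arrows *)

Section FiniteType.
Variables (k : fieldType) (G : groupoid).
Implicit Types F : garr G -> k.

(** The [a i] and [b i] are arbitrary functions, not asked to be of finite type themselves. *)
Definition rep_fun F := exists n (a b : 'I_n -> garr G -> k),
  forall g h (e : gsrc g = gtgt h), F (gcomp e) = \sum_i a i g * b i h.

Lemma rep_fun_coef E (f : cosect E) (p : sect E) : rep_fun (coef f p).
Proof.
have [n [s [t st]]] := dual_basis_ex E.
exists n, (fun i => coef f (s i)), (fun i => coef (t i) p) => g h e.
exact: coef_dual_basis.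
Qed.

Definition star (x : gob G) := {a : garr G | gsrc a = x}.

Section Translation.
Variables (g : garr G) (x y : gob G) (e : gsrc g = x) (e' : gtgt g = y).

Fact star_composable (a : star y) : gsrc (sval a) = gtgt g.
Proof. by rewrite (svalP a). Qed.
Fact star_comp_src (a : star y) : gsrc (gcomp (star_composable a)) = x.
Proof. by rewrite gsrc_comp. Qed.
Definition star_comp (a : star y) : star x := exist _ _ (star_comp_src a).
Definition translate (f : star x -> k^o) : star y -> k^o := fun a => f (star_comp a).
Fact translate_linear : linear translate.
Proof. by []. Qed.
HB.instance Definition _ := GRing.isLinear.Build k _ _ _ translate translate_linear.
End Translation.

Lemma star_eq x (a b : star x) : sval a = sval b -> a = b.
Proof.
case: a b => [a ea] [b eb] /= ab; subst b; congr exist; exact: Prop_irrelevance.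
Qed.

Lemma gcomp_eq (g g' h h' : garr G) (e : gsrc g = gtgt h) (e' : gsrc g' = gtgt h') :
  g = g' -> h = h' -> gcomp e = gcomp e'.
Proof. by move=> eg eh; subst g' h'; congr gcomp; exact: Prop_irrelevance. Qed.

Lemma gcomp1_eq (g : garr G) x (e : gsrc g = gtgt (gid x)) : gcomp e = g.
Proof.
have ex : gsrc g = x by rewrite e gtgt_id.
by subst x; exact: gcomp1.
Qed.

Lemma gcomp1l_eq (g : garr G) x (e : gsrc (gid x) = gtgt g) : gcomp e = g.
Proof.
have ex : gtgt g = x by rewrite -e gsrc_id.
by subst x; exact: gcomp1l.
Qed.

(* The functions on the arrows with source [x] form a representation of infinite
   dimension, in which [F] generates a finite-dimensional one. *)
Lemma rep_funP F : rep_fun F <-> exists E (f : cosect E) (p : sect E), F =1 coef f p.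
Proof.
split=> [[n [a [b Fab]]]|[E [f [p /funext ->]]]]; last exact: rep_fun_coef.
have [|||E [u [q [ua uq us]]]] := @orbit_span_rep k G
  (fun x => (star x -> k^o : lmodType k)) (fun g x y e e' => @translate g x y e e') _ _
  (fun x (c : star x) => F (sval c)) n.
- move=> x e e' v; apply/funext => c; congr v; apply: star_eq; exact: gcomp1_eq.
- move=> g h gh x y z es et eh eg e e' v; apply/funext => c; congr v.
  apply: star_eq => /=; symmetry; exact: gcompA.
(* The translate of [F] by [g] is [c |-> F (c g)], a combination of the [a i] with coefficients
   [b i g]. *)
- move=> y; exists (fun i (c : star y) => a i (sval c)) => v [g [x [e [e' ->]]]].
  exists (fun i => b i g); apply/funext => c.
  rewrite [LHS]Fab /= fct_sumE; apply: eq_bigr => i _; exact: mulrC.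
(* The form is evaluation at the identity arrow: the translate of [F] by [g] takes there the value
   [F g]. *)
pose one x : star x := exist _ (gid x) (gsrc_id x).
pose ev x (v : star x -> k^o) : k^o := v (one x).
have evl x : linear (fun v => ev x (u x v)).
  by move=> c v w; rewrite /ev linearP.
pose evm x := GRing.isLinear.Build k _ _ _ _ (evl x).
pose evL x : {linear rfib E x -> k^o} := HB.pack (fun v => ev x (u x v)) (evm x).
exists E, (fun x => linfun (evL x)), q => g.
rewrite /coef lfunE /= ua uq /ev /translate /=; congr F.
by symmetry; exact: gcomp1l_eq.
Qed.
End FiniteType.

(** * The algebra of functions of finite type *)

Section FiniteTypeAlgebra.
Variables (k : fieldType) (G : groupoid).

Fact garr_inh : inhabited (garr G).
Proof. by have [x] := gob_inh G; exists; exact: gid x. Qed.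

Definition arrfun : Type := mapalg k garr_inh.
HB.instance Definition _ := GRing.ComAlgebra.on arrfun.
HB.instance Definition _ := GRing.NzRing.on arrfun.

Definition finite_type : {pred arrfun} := fun F => `[< rep_fun F >].

Fact finite_type_subalg : subalg_closed finite_type.
Proof.
split=> [|c u v|u v].
- apply/asboolP; exists 1%N, (fun _ _ => 1), (fun _ _ => 1) => g h e.
  by rewrite big_ord1 mulr1.
- move=> /asboolP[n [a [b uE]]] /asboolP[m [a' [b' vE]]]; apply/asboolP.
  exists (n + m)%N,
    (fun i g => match fintype.split i with inl j => c * a j g | inr j => a' j g end),
    (fun i g => match fintype.split i with inl j => b j g | inr j => b' j g end) => g h e.
  rewrite big_split_ord /= [LHS]/(c * u _ + v _) uE vE mulr_sumr.
  congr (_ + _); apply: eq_bigr => i _; first by rewrite (unsplitK (inl i)) mulrA.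
  by rewrite (unsplitK (inr i)).
- move=> /asboolP[n [a [b uE]]] /asboolP[m [a' [b' vE]]]; apply/asboolP.
  pose I := ('I_n * 'I_m)%type.
  exists #|{: I}|, (fun i g => a (enum_val i).1 g * a' (enum_val i).2 g),
    (fun i g => b (enum_val i).1 g * b' (enum_val i).2 g) => g h e.
  rewrite [LHS]/(u _ * v _) uE vE -[LHS]/(_ * _ :> k).
  rewrite big_distrlr pair_bigA /=.
  rewrite (reindex (enum_val (A := {: I}))) /=; last first.
    by apply: onW_bij; exact: enum_val_bij.
  by apply: eq_bigr => i _; rewrite mulrACA.
Qed.
HB.instance Definition _ :=
  GRing.isSubalgClosed.Build k arrfun finite_type finite_type_subalg.

Record rep_alg := RepAlg { rcval :> arrfun; rcP : rcval \in finite_type }.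
HB.instance Definition _ := [isSub for rcval].
HB.instance Definition _ := [Choice of rep_alg by <:].
HB.instance Definition _ := [SubChoice_isSubAlgebra of rep_alg by <:].
Fact rep_alg_mulC : commutative (@GRing.mul rep_alg).
Proof. by move=> u v; apply: val_inj; rewrite !rmorphM; exact: mulrC. Qed.
HB.instance Definition _ := GRing.PzRing_hasCommutativeMul.Build rep_alg rep_alg_mulC.
End FiniteTypeAlgebra.

Section TensorSums.
Variables (S : Type) (M N : zmodType) (aM : S -> M -> M) (aN : S -> N -> N).
Local Notation T := (tensor aM aN).

Lemma tens0l n : tens 0 n = 0 :> T.
Proof. by apply: (addrI (tens 0 n)); rewrite -tensDl !addr0. Qed.
Lemma tens0r m : tens m 0 = 0 :> T.
Proof. by apply: (addrI (tens m 0)); rewrite -tensDr !addr0. Qed.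
Lemma tens_suml I (s : seq I) (F : I -> M) n :
  tens (\sum_(i <- s) F i) n = \sum_(i <- s) tens (F i) n :> T.
Proof.
by apply: (big_morph (fun m => tens m n : T)) => [m m'|]; [exact: tensDl|exact: tens0l].
Qed.
Lemma tens_sumr I (s : seq I) (F : I -> N) m :
  tens m (\sum_(i <- s) F i) = \sum_(i <- s) tens m (F i) :> T.
Proof.
by apply: (big_morph (fun n => tens m n : T)) => [n n'|]; [exact: tensDr|exact: tens0r].
Qed.
Lemma tensor_fin (z : T) : exists n (a : 'I_n -> M) (b : 'I_n -> N),
  z = \sum_i tens (a i) (b i).
Proof.
exists (size (repr z)), (fun i => (tnth (in_tuple (repr z)) i).1).
exists (fun i => (tnth (in_tuple (repr z)) i).2).
by rewrite {1}(tensor_sumE z) big_tnth.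
Qed.
End TensorSums.

(** * Tensors as functions on composable pairs *)

Section Evaluation.
Variables (k : fieldType) (G : groupoid).
Local Notation B := (mapalg k (gob_inh G)).

Section Pairs.
Variables (C : comAlgType k) (sC tC : {lrmorphism B -> C}).
Variable ev : {lrmorphism C -> arrfun k G}.
Hypothesis ev_inj : injective ev.
Hypothesis ev_src : forall a g, ev (sC a) g = a (gsrc g).
Hypothesis ev_tgt : forall a g, ev (tC a) g = a (gtgt g).

Definition ev2 g h (z : ctens sC tC) : k := tlift (fun a b => ev a g * ev b h) z.

Lemma ev2_balanced g h : gsrc g = gtgt h ->
  balanced (fun r (a : C) => a * sC r) (fun r (b : C) => tC r * b)
    (fun a b => ev a g * ev b h : k).
Proof.
move=> e; split=> [a a' b|a b b'|r a b].
- by rewrite raddfD; exact: mulrDl.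
- by rewrite raddfD; exact: mulrDr.
- rewrite !rmorphM [LHS]/(ev a g * ev (sC r) g * ev b h).
  by rewrite [RHS]/(ev a g * (ev (tC r) h * ev b h)) ev_src ev_tgt e; exact: (esym (mulrA _ _ _)).
Qed.

Lemma ev2E g h a b : gsrc g = gtgt h -> ev2 g h (tens a b) = ev a g * ev b h.
Proof. by move=> e; rewrite /ev2 tliftE //; exact: ev2_balanced. Qed.

Lemma ev2D g h z w : gsrc g = gtgt h -> ev2 g h (z + w) = ev2 g h z + ev2 g h w.
Proof. by move=> e; rewrite /ev2 tliftD //; exact: ev2_balanced. Qed.

Lemma ev2_sum g h I (s : seq I) (F : I -> ctens sC tC) : gsrc g = gtgt h ->
  ev2 g h (\sum_(i <- s) F i) = \sum_(i <- s) ev2 g h (F i).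
Proof. by move=> e; rewrite /ev2 tlift_sum //; exact: ev2_balanced. Qed.

Lemma ev2M g h z w : gsrc g = gtgt h -> ev2 g h (z * w) = ev2 g h z * ev2 g h w.
Proof.
move=> e; rewrite (tensor_sumE z) (tensor_sumE w) big_distrlr /= !ev2_sum //.
rewrite big_distrlr; apply: eq_bigr => p _; rewrite ev2_sum //.
apply: eq_bigr => q _; rewrite ctensM !ev2E // !rmorphM.
exact: mulrACA.
Qed.

Lemma ev_sumE I (s : seq I) (F : I -> C) g :
  ev (\sum_(i <- s) F i) g = \sum_(i <- s) ev (F i) g.
Proof. by rewrite raddf_sum fct_sumE. Qed.

(* At each object [m] a projection of [k^n] separates the values of the left
   factors on the arrows out of [m] from those of the right factors on the arrows
   into [m]; as [M_k(G_0)] consists of all functions, these projections form a matrix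
   over it, which can be moved across the tensor sign. *)
Lemma ev2_eq0 z : (forall g h, gsrc g = gtgt h -> ev2 g h z = 0) -> z = 0.
Proof.
move=> z0; have [n [a [b zE]]] := tensor_fin z.
have /choice[P PE] m : exists P : 'M[k]_n,
    (forall g, gsrc g = m -> forall i, \sum_j ev (a j) g * P j i = 0) /\
    (forall h, gtgt h = m -> forall j, \sum_i P j i * ev (b i) h = ev (b j) h).
  have [|P [Pa Pb]] := @annihilating_projection k n
    (fun u => exists2 g, gsrc g = m & u = \row_i ev (a i) g)
    (fun v => exists2 h, gtgt h = m & v = \col_i ev (b i) h).
    move=> _ _ [g gm ->] [h hm ->]; apply/matrixP => i j; rewrite !mxE.
    have e : gsrc g = gtgt h by rewrite hm.
    rewrite -[RHS](z0 g h e) zE ev2_sum //; apply: eq_bigr => l _.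
    by rewrite ev2E // !mxE.
  exists P; split=> [g gm i|h hm j].
    have /rowP/(_ i) := Pa _ (ex_intro2 _ _ g gm erefl); rewrite !mxE => E0; rewrite -[RHS]E0.
    by apply: eq_bigr => j _; rewrite mxE.
  have /colP/(_ j) := Pb _ (ex_intro2 _ _ h hm erefl); rewrite !mxE => <-.
  by apply: eq_bigr => i _; rewrite mxE.
pose Q j i : B := fun m => P m j i.
have aQ i : \sum_j a j * sC (Q j i) = 0.
  apply: ev_inj; apply/funext => g; rewrite ev_sumE raddf0.
  rewrite -[RHS]((PE (gsrc g)).1 g erefl i); apply: eq_bigr => j _.
  by rewrite rmorphM -[RHS](congr1 ( *%R (ev (a j) g)) (ev_src (Q j i) g)).
have Qb j : \sum_i tC (Q j i) * b i = b j.
  apply: ev_inj; apply/funext => h; rewrite ev_sumE.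
  rewrite -[RHS]((PE (gtgt h)).2 h erefl j); apply: eq_bigr => i _.
  by rewrite rmorphM -[RHS](congr1 ( *%R^~ (ev (b i) h)) (ev_tgt (Q j i) h)).
(* Once [Q] has moved across the tensor sign, the left factors are the sums in [aQ], which
   vanish. *)
rewrite zE; under eq_bigr do rewrite -Qb tens_sumr.
rewrite exchange_big big1 // => i _; under eq_bigr do rewrite -ctensA.
by rewrite -tens_suml aQ tens0l.
Qed.

Lemma ev2_inj z w :
  (forall g h, gsrc g = gtgt h -> ev2 g h z = ev2 g h w) -> z = w.
Proof.
move=> e; apply/eqP; rewrite -subr_eq0; apply/eqP/ev2_eq0 => g h gh.
by apply/eqP; rewrite -[_ == _](inj_eq (addIr (ev2 g h w))) -ev2D // subrK add0r e.
Qed.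
End Pairs.
End Evaluation.

Section Inverses.
Variable G : groupoid.

Lemma ginv_uniq (a b : garr G) (e : gsrc a = gtgt b) :
  gcomp e = gid (gsrc b) -> a = ginv b.
Proof.
move=> ab; have d1 : gsrc b = gtgt (ginv b) by rewrite gtgt_inv.
have d2 : gsrc (gcomp e) = gtgt (ginv b) by rewrite gsrc_comp.
have d3 : gsrc a = gtgt (gcomp d1) by rewrite gtgt_comp.
transitivity (gcomp d3).
  have d4 : gsrc a = gtgt (gid (gtgt b)) by rewrite gtgt_id.
  by rewrite -[LHS](gcomp1_eq d4); apply: gcomp_eq; rewrite ?gcompV.
rewrite -(gcompA d2 d3).
have d5 : gsrc (gid (gsrc b)) = gtgt (ginv b) by rewrite gsrc_id.
by rewrite -[RHS](gcomp1l_eq d5); apply: gcomp_eq.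
Qed.

Lemma gcompKl (g h : garr G) (e : gsrc g = gtgt h) (e' : gsrc (ginv g) = gtgt (gcomp e)) :
  gcomp e' = h.
Proof.
have d3 : gsrc (ginv g) = gtgt g by rewrite gsrc_inv.
have d4 : gsrc (gcomp d3) = gtgt h by rewrite gsrc_comp.
rewrite -(gcompA d4 e').
have d5 : gsrc (gid (gsrc g)) = gtgt h by rewrite gsrc_id.
by rewrite -[RHS](gcomp1l_eq d5); apply: gcomp_eq; rewrite ?gcompVl.
Qed.

Lemma ginv_comp (g h : garr G) (e : gsrc g = gtgt h) (e' : gsrc (ginv h) = gtgt (ginv g)) :
  ginv (gcomp e) = gcomp e'.
Proof.
have c : gsrc (gcomp e') = gtgt (gcomp e) by rewrite gsrc_comp gtgt_comp gsrc_inv.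
symmetry; apply: (@ginv_uniq _ _ c).
have d1 : gsrc (ginv g) = gtgt (gcomp e) by rewrite gtgt_comp gsrc_inv.
have d2 : gsrc (ginv h) = gtgt (gcomp d1) by rewrite gtgt_comp.
have d6 : gsrc (ginv h) = gtgt h by rewrite gsrc_inv.
rewrite (gcompA c d2); transitivity (gcomp d6).
  by apply: gcomp_eq => //; exact: gcompKl.
by rewrite gcompVl gsrc_comp.
Qed.
End Inverses.

(** * The Hopf algebroid structure on functions of finite type *)

Section ConcreteModel.
Variables (k : fieldType) (G : groupoid).
Local Notation B := (mapalg k (gob_inh G)).
Local Notation R := (rep_alg k G).

Definition rc (F : garr G -> k) (H : rep_fun F) : R := RepAlg (introT (asboolP _) H).
Lemma rcW (F : R) : rep_fun (rcval F). Proof. by case: F => F /= /asboolP. Qed.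
Lemma rc_eq (u v : R) : rcval u =1 rcval v -> u = v.
Proof. by move=> e; apply: val_inj; apply/funext. Qed.

Fact src_rep_fun (a : B) : rep_fun (fun g : garr G => a (gsrc g)).
Proof.
exists 1%N, (fun _ _ => 1), (fun _ g => a (gsrc g)) => g h e.
by rewrite big_ord1 mul1r gsrc_comp.
Qed.
Fact tgt_rep_fun (a : B) : rep_fun (fun g : garr G => a (gtgt g)).
Proof.
exists 1%N, (fun _ g => a (gtgt g)), (fun _ _ => 1) => g h e.
by rewrite big_ord1 mulr1 gtgt_comp.
Qed.
Fact inv_rep_fun (F : R) : rep_fun (fun g : garr G => rcval F (ginv g)).
Proof.
have [n [a [b Fab]]] := rcW F.
exists n, (fun i g => b i (ginv g)), (fun i g => a i (ginv g)) => g h e.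
have e' : gsrc (ginv h) = gtgt (ginv g) by rewrite gsrc_inv gtgt_inv.
rewrite (ginv_comp e e').
by rewrite Fab; apply: eq_bigr => i _; exact: mulrC.
Qed.

Definition rc_src (a : B) : R := rc (src_rep_fun a).
Definition rc_tgt (a : B) : R := rc (tgt_rep_fun a).
Definition rc_eps (F : R) : B := fun x => rcval F (gid x).
Definition rc_anti (F : R) : R := rc (inv_rep_fun F).

Fact rc_src_zmod : zmod_morphism rc_src. Proof. by move=> a b; apply: rc_eq. Qed.
Fact rc_src_monoid : monoid_morphism rc_src.
Proof. by split=> [|a b]; apply: rc_eq. Qed.
Fact rc_src_scal : scalable rc_src. Proof. by move=> a b; apply: rc_eq. Qed.
HB.instance Definition _ := GRing.isZmodMorphism.Build B R rc_src rc_src_zmod.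
HB.instance Definition _ := GRing.isMonoidMorphism.Build B R rc_src rc_src_monoid.
HB.instance Definition _ := GRing.isScalable.Build k B R *:%R rc_src rc_src_scal.
Fact rc_tgt_zmod : zmod_morphism rc_tgt. Proof. by move=> a b; apply: rc_eq. Qed.
Fact rc_tgt_monoid : monoid_morphism rc_tgt.
Proof. by split=> [|a b]; apply: rc_eq. Qed.
Fact rc_tgt_scal : scalable rc_tgt. Proof. by move=> a b; apply: rc_eq. Qed.
HB.instance Definition _ := GRing.isZmodMorphism.Build B R rc_tgt rc_tgt_zmod.
HB.instance Definition _ := GRing.isMonoidMorphism.Build B R rc_tgt rc_tgt_monoid.
HB.instance Definition _ := GRing.isScalable.Build k B R *:%R rc_tgt rc_tgt_scal.
Fact rc_eps_zmod : zmod_morphism rc_eps. Proof. by move=> a b; apply/funext. Qed.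
Fact rc_eps_monoid : monoid_morphism rc_eps.
Proof. by split=> [|a b]; apply/funext. Qed.
Fact rc_eps_scal : scalable rc_eps. Proof. by move=> a b; apply/funext. Qed.
HB.instance Definition _ := GRing.isZmodMorphism.Build R B rc_eps rc_eps_zmod.
HB.instance Definition _ := GRing.isMonoidMorphism.Build R B rc_eps rc_eps_monoid.
HB.instance Definition _ := GRing.isScalable.Build k R B *:%R rc_eps rc_eps_scal.
Fact rc_anti_zmod : zmod_morphism rc_anti. Proof. by move=> a b; apply: rc_eq. Qed.
Fact rc_anti_monoid : monoid_morphism rc_anti.
Proof. by split=> [|a b]; apply: rc_eq. Qed.
Fact rc_anti_scal : scalable rc_anti. Proof. by move=> a b; apply: rc_eq. Qed.
HB.instance Definition _ := GRing.isZmodMorphism.Build R R rc_anti rc_anti_zmod.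
HB.instance Definition _ := GRing.isMonoidMorphism.Build R R rc_anti rc_anti_monoid.
HB.instance Definition _ := GRing.isScalable.Build k R R *:%R rc_anti rc_anti_scal.

Definition rc_ev (F : R) : arrfun k G := rcval F.
Fact rc_ev_zmod : zmod_morphism rc_ev. Proof. exact: (raddfB (\val : R -> arrfun k G)). Qed.
Fact rc_ev_monoid : monoid_morphism rc_ev.
Proof.
split=> [|u v]; first exact: (rmorph1 (\val : R -> arrfun k G)).
exact: (rmorphM (\val : R -> arrfun k G)).
Qed.
Fact rc_ev_scal : scalable rc_ev.
Proof. by move=> c u; rewrite /rc_ev; exact: (linearZ_LR (\val : R -> arrfun k G)). Qed.
HB.instance Definition _ := GRing.isZmodMorphism.Build R (arrfun k G) rc_ev rc_ev_zmod.
HB.instance Definition _ :=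
  GRing.isMonoidMorphism.Build R (arrfun k G) rc_ev rc_ev_monoid.
HB.instance Definition _ :=
  GRing.isScalable.Build k R (arrfun k G) *:%R rc_ev rc_ev_scal.
Local Notation val := (rc_ev : {lrmorphism R -> arrfun k G}).
Local Notation T := (ctens rc_src rc_tgt).
Local Notation ev2 := (@ev2 k G R rc_src rc_tgt val).

Let vI : injective val. Proof. exact: val_inj. Qed.
Let vs (a : B) g : val (rc_src a) g = a (gsrc g). Proof. by []. Qed.
Let vt (a : B) g : val (rc_tgt a) g = a (gtgt g). Proof. by []. Qed.

Definition rc_cl E (f : cosect E) (p : sect E) : R := rc (rep_fun_coef f p).

Definition rc_delta_cl E n (s : 'I_n -> sect E) (t : 'I_n -> cosect E)
  (f : cosect E) (p : sect E) : T := \sum_i tens (rc_cl f (s i)) (rc_cl (t i) p).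

Lemma ev2_delta_cl E n (s : 'I_n -> sect E) (t : 'I_n -> cosect E) f p g h
    (e : gsrc g = gtgt h) :
  dual_basis s t -> ev2 g h (rc_delta_cl s t f p) = coef f p (gcomp e).
Proof.
move=> st; rewrite (coef_dual_basis st) (ev2_sum vs vt) //; apply: eq_bigr => i _.
exact: (ev2E vs vt).
Qed.

Lemma rc_clP (F : R) : exists E (f : cosect E) (p : sect E), F = rc_cl f p.
Proof.
have /rep_funP[E [f [p e]]] := rcW F; exists E, f, p; exact: rc_eq.
Qed.

(** The tensor factors must themselves be of finite type, which the decomposition in [rep_fun] does
    not guarantee; writing [F] as a matrix coefficient and using a dual basis does. *)
Fact rc_delta_ex (F : R) : exists z : T,
  forall g h (e : gsrc g = gtgt h), ev2 g h z = rcval F (gcomp e).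
Proof.
have [E [f [p ->]]] := rc_clP F; have [n [s [t st]]] := dual_basis_ex E.
by exists (rc_delta_cl s t f p) => g h e; rewrite (ev2_delta_cl f p e st).
Qed.

Definition rc_delta (F : R) : T := sval (cid (rc_delta_ex F)).
Lemma rc_deltaE F g h (e : gsrc g = gtgt h) : ev2 g h (rc_delta F) = rcval F (gcomp e).
Proof. exact: (svalP (cid (rc_delta_ex F))). Qed.

(** Tensors are separated by composable pairs, so the identities for [rc_delta] reduce to identities
    between values on arrows. *)
Lemma rc_delta_uniq F z :
  (forall g h (e : gsrc g = gtgt h), ev2 g h z = rcval F (gcomp e)) -> rc_delta F = z.
Proof.
by move=> zE; apply: (ev2_inj vI vs vt) => g h e; rewrite (rc_deltaE _ e) (zE _ _ e).
Qed.

Fact rc_delta_zmod : zmod_morphism rc_delta.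
Proof.
move=> a b; apply: rc_delta_uniq => g h e.
apply: (addIr (ev2 g h (rc_delta b))); rewrite -(ev2D vs vt) // subrK !(rc_deltaE _ e).
by rewrite [X in X + _]/(rcval a _ - rcval b _) subrK.
Qed.
Fact rc_delta_monoid : monoid_morphism rc_delta.
Proof.
split=> [|a b]; apply: rc_delta_uniq => g h e.
  by rewrite ctens1 (ev2E vs vt) // rmorph1 [LHS]mulr1.
by rewrite (ev2M vs vt) // !(rc_deltaE _ e).
Qed.
HB.instance Definition _ := GRing.isZmodMorphism.Build R T rc_delta rc_delta_zmod.
HB.instance Definition _ := GRing.isMonoidMorphism.Build R T rc_delta rc_delta_monoid.

Lemma rc_delta_clE E n (s : 'I_n -> sect E) (t : 'I_n -> cosect E) f p :
  dual_basis s t -> rc_delta (rc_cl f p) = rc_delta_cl s t f p.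
Proof. by move=> st; apply: rc_delta_uniq => g h e; rewrite (ev2_delta_cl f p e st). Qed.

Lemma rc_delta_src r : rc_delta (rc_src r) = tens 1 (rc_src r).
Proof.
apply: rc_delta_uniq => g h e; rewrite (ev2E vs vt) // rmorph1 [LHS]mul1r /=.
by rewrite gsrc_comp.
Qed.
Lemma rc_delta_tgt r : rc_delta (rc_tgt r) = tens (rc_tgt r) 1.
Proof.
apply: rc_delta_uniq => g h e; rewrite (ev2E vs vt) // rmorph1 [LHS]mulr1 /=.
by rewrite gtgt_comp.
Qed.

Lemma val_tlift (f : R -> R -> R) (z : T) g :
  rcval (tlift f z) g = tlift (fun a b => rcval (f a b) g : k) z.
Proof. exact: (ev_sumE val). Qed.

Lemma rc_counitl h : tlift (fun a b => rc_tgt (rc_eps a) * b) (rc_delta h) = h.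
Proof.
apply: rc_eq => g; rewrite val_tlift.
have e : gsrc (gid (gtgt g)) = gtgt g by rewrite gsrc_id.
by rewrite -[RHS](congr1 (rcval h) (gcomp1l e)) -rc_deltaE.
Qed.
Lemma rc_counitr h : tlift (fun a b => a * rc_src (rc_eps b)) (rc_delta h) = h.
Proof.
apply: rc_eq => g; rewrite val_tlift.
have e : gsrc g = gtgt (gid (gsrc g)) by rewrite gtgt_id.
by rewrite -[RHS](congr1 (rcval h) (gcomp1 e)) -rc_deltaE.
Qed.
Lemma rc_anti_src r : rc_anti (rc_src r) = rc_tgt r.
Proof. by apply: rc_eq => g /=; rewrite gsrc_inv. Qed.
Lemma rc_anti_tgt r : rc_anti (rc_tgt r) = rc_src r.
Proof. by apply: rc_eq => g /=; rewrite gtgt_inv. Qed.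
Lemma rc_antil h : tlift (fun a b => rc_anti a * b) (rc_delta h) = rc_src (rc_eps h).
Proof.
apply: rc_eq => g; rewrite val_tlift.
have e : gsrc (ginv g) = gtgt g by rewrite gsrc_inv.
by rewrite -[RHS](congr1 (rcval h) (gcompVl e)) -rc_deltaE.
Qed.
Lemma rc_antir h : tlift (fun a b => a * rc_anti b) (rc_delta h) = rc_tgt (rc_eps h).
Proof.
apply: rc_eq => g; rewrite val_tlift.
have e : gsrc g = gtgt (ginv g) by rewrite gtgt_inv.
by rewrite -[RHS](congr1 (rcval h) (gcompV e)) -rc_deltaE.
Qed.

(** On a class, both sides expand through the same dual basis, used twice, into one double sum of
    triple tensors. Separation of triple tensors by arrows is thus avoided. *)
Lemma rc_coassoc h :
  tlift (fun a b => tens (rc_delta a) b) (rc_delta h) =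
  tlift (fun a b => tlift (fun b1 b2 => tens (tens a b1 : T) b2) (rc_delta b))
    (rc_delta h) :> ctens (fun r => tens 1 (rc_src r) : T) rc_tgt.
Proof.
pose T3 := ctens (fun r => tens 1 (rc_src r) : T) rc_tgt.
have B1 : balanced (fun r (a : R) => a * rc_src r) (fun r (b : R) => rc_tgt r * b)
    (fun a b => tens (rc_delta a) b : T3).
  split=> [a a' b|a b b'|r a b].
  - by rewrite raddfD; exact: tensDl.
  - exact: tensDr.
  - by rewrite rmorphM /= rc_delta_src; exact: ctensA.
have B2 a : balanced (fun r (a : R) => a * rc_src r) (fun r (b : R) => rc_tgt r * b)
    (fun b1 b2 => tens (tens a b1 : T) b2 : T3).
  split=> [b b' c|b c c'|r b c].
  - by rewrite (_ : tens a (b + b') = tens a b + tens a b');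
      [exact: tensDl|exact: tensDr].
  - exact: tensDr.
  - rewrite -[in RHS]ctensA ctensM mulr1; exact: erefl.
have B3 : balanced (fun r (a : R) => a * rc_src r) (fun r (b : R) => rc_tgt r * b)
    (fun a b => tlift (fun b1 b2 => tens (tens a b1 : T) b2 : T3) (rc_delta b)).
  split=> [a a' b|a b b'|r a b].
  - rewrite /tlift /tens_sum -big_split; apply: eq_bigr => p _ /=.
    by rewrite (_ : tens (a + a') p.1 = tens a p.1 + tens a' p.1);
      exact: tensDl.
  - by rewrite raddfD tliftD.
  - rewrite rmorphM /= rc_delta_tgt (tensor_sumE (rc_delta b)) mulr_sumr.
    rewrite !tlift_sum //; apply: eq_bigr => p _.
    by rewrite ctensM mul1r !tliftE // ctensA.
have [E [f [p ->]]] := rc_clP h; have [n [s [t st]]] := dual_basis_ex E.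
rewrite (rc_delta_clE f p st) !tlift_sum //.
under eq_bigr do rewrite tliftE // (rc_delta_clE _ _ st) tens_suml.
under [in RHS]eq_bigr do rewrite tliftE // (rc_delta_clE _ _ st) tlift_sum //.
rewrite exchange_big; apply: eq_bigr => i _; apply: eq_bigr => j _.
by rewrite tliftE.
Qed.

Definition rc_hopf : hopf_algebroid B :=
  HopfAlgebroid (hsrc := rc_src) (htgt := rc_tgt) (heps := rc_eps)
    (hdelta := rc_delta) (hanti := rc_anti)
    (fun r => funext (fun x => congr1 r (gsrc_id x)))
    (fun r => funext (fun x => congr1 r (gtgt_id x)))
    rc_delta_src rc_delta_tgt rc_counitl rc_counitr rc_coassoc
    rc_anti_src rc_anti_tgt rc_antil rc_antir.
End ConcreteModel.

Lemma linear_eq (K : pzRingType) (U V : lmodType K) (f g : {linear U -> V}) :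
  f =1 g -> f = g.
Proof.
case: f g => f [[f1] [f2]] [g [[g1] [g2]]] /= /funext e.
subst g; congr (GRing.Linear.Pack (GRing.Linear.Class _ _));
  congr (_ _); exact: Prop_irrelevance.
Qed.

(** * Universal property of the concrete model *)

Section Universal.
Variables (k : fieldType) (G : groupoid).
Local Notation B := (mapalg k (gob_inh G)).
Local Notation R := (rep_alg k G).
Implicit Types E : rep k G.

Lemma rc_wedge : @cowedge k G R (@rc_cl k G).
Proof.
split=> [E c f f' p|E c f p p'|E F u f p]; apply: rc_eq => g.
- by rewrite [RHS]/(c * _ + _) /= /coef !lfunE /= lfunE.
- by rewrite [RHS]/(c * _ + _) /= /coef !linearP.
- have /lfunP/(_ (p (gsrc g))) := rmap_act u (g := g) erefl erefl.
  by rewrite /= /coef !comp_lfunE => ->.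
Qed.

Section Factor.
Variables (W : lmodType k) (w : forall E, cosect E -> sect E -> W).
Hypothesis cw : cowedge w.

(** The induced map is well defined: two presentations of [F] have the same coefficient function,
    and [cowedge_coefP] with scalar [0] equates the values of [w]. *)
Fact rc_factor_ex (F : R) : exists v : W,
  forall E (f : cosect E) (p : sect E), F = rc_cl f p -> v = w f p.
Proof.
have [E [f [p ->]]] := rc_clP F; exists (w f p) => E' f' p' e.
have := @cowedge_coefP _ _ _ _ cw 0 _ _ _ f p f' p' f' p'.
rewrite scale0r add0r; apply=> g; rewrite mul0r add0r.
exact: (congr1 (fun F : R => rcval F g) e).
Qed.
Definition rc_factor F := sval (cid (rc_factor_ex F)).
Lemma rc_factorE E (f : cosect E) (p : sect E) : rc_factor (rc_cl f p) = w f p.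
Proof. exact: (svalP (cid (rc_factor_ex _))). Qed.
Fact rc_factor_linear : linear rc_factor.
Proof.
move=> c u v; have [E1 [f1 [p1 ->]]] := rc_clP u; have [E2 [f2 [p2 ->]]] := rc_clP v.
have [E [f [p e]]] := rc_clP (c *: rc_cl f1 p1 + rc_cl f2 p2).
rewrite e !rc_factorE; apply: (cowedge_coefP cw) => g.
by rewrite -[LHS](congr1 (fun F : R => rcval F g) e).
Qed.
HB.instance Definition _ := GRing.isLinear.Build k R W _ rc_factor rc_factor_linear.

Lemma rc_univ : exists! u : {linear R -> W},
  forall E (f : cosect E) (p : sect E), u (rc_cl f p) = w f p.
Proof.
exists rc_factor; split=> [|u uE]; first exact: rc_factorE.
apply: linear_eq => F; have [E [f [p ->]]] := rc_clP F.
by rewrite uE; exact: rc_factorE.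
Qed.
End Factor.

Lemma rc_mul E F (f : cosect E) (p : sect E) (g : cosect F) (q : sect F) :
  rc_cl f p * rc_cl g q =
  @rc_cl k G (rep_tens E F) (fun x => ftens (f x) (g x)) (fun x => vtens (p x) (q x)).
Proof.
apply: rc_eq => a; rewrite [LHS]/(_ * _) /= /coef /=.
by rewrite ltens_vtens ftens_vtens.
Qed.

Lemma rc_srcE (a : B) : rc_src a = @rc_cl k G (rep_unit k G) (fun=> \1%VF) a.
Proof. by apply: rc_eq => g; rewrite /= /coef /= !lfunE. Qed.

Lemma rc_tgtE (a : B) :
  rc_tgt a = @rc_cl k G (rep_unit k G) (fun x => a x *: \1%VF) (fun=> 1).
Proof. by apply: rc_eq => g; rewrite /= /coef /= !lfunE /= !lfunE [RHS]mulr1. Qed.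

Lemma rc_epsE E (f : cosect E) (p : sect E) x : rc_eps (rc_cl f p) x = f x (p x).
Proof. exact: coef_id. Qed.

(** The dual action is the transpose of the inverse, so coefficients of the dual at [g] are
    coefficients of [E] at [ginv g]. *)
Lemma rc_antiE E (f : cosect E) (p : sect E) :
  rc_anti (rc_cl f p) = @rc_cl k G (rep_dual E) (fun x => bidual (p x)) f.
Proof.
apply: rc_eq => g.
rewrite -[LHS]/(coef f p (ginv g)) -[RHS]/(coef (E := rep_dual E) _ _ _).
rewrite [RHS]/coef /= bidualE rep_dual_actE ltrE comp_lfunE.
rewrite (ract_invE E erefl erefl (gsrc_inv g) (gtgt_inv g)).
exact: (coef_at f p (gsrc_inv g) (gtgt_inv g)).
Qed.

Definition rc_rep_functions : rep_functions k G :=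
  @RepFunctions k G (rc_hopf k G) (@rc_cl k G) rc_wedge rc_univ rc_mul rc_srcE rc_tgtE
    rc_epsE (fun E n s t st f p => rc_delta_clE f p st) rc_antiE.
End Universal.

(** * Comparison of an arbitrary model of the coend with the concrete one *)

Section Evaluations.
Variables (k : fieldType) (G : groupoid).
Local Notation B := (mapalg k (gob_inh G)).

(** An identification of [H] with the functions of finite type, all structure maps becoming
    operations on arrows. The study of comodules and of projectivity below works through this
    interface. *)
Record evaluation (H : hopf_algebroid B) := Evaluation {
  evl :> {lrmorphism H -> arrfun k G};
  evl_inj : injective evl;
  evl_src : forall a g, evl (hsrc H a) g = a (gsrc g);
  evl_tgt : forall a g, evl (htgt H a) g = a (gtgt g);
  evl_eps : forall h x, (heps H h : B) x = evl h (gid x);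
  evl_anti : forall h g, evl (hanti H h) g = evl h (ginv g);
  evl_delta : forall h g g' (e : gsrc g = gtgt g'),
    ev2 evl g g' (hdelta H h) = evl h (gcomp e);
  evl_onto : forall F : arrfun k G, rep_fun F -> exists h, evl h = F
}.

Variable A : rep_functions k G.

Let u : {linear A -> rep_alg k G} := sval (cid (@rcl_univ k G A _ _ (@rc_wedge k G))).
Let v : {linear rep_alg k G -> A} := rc_factor (@rcl_wedge k G A).

Let uE E (f : cosect E) (p : sect E) : u (rcl A f p) = rc_cl f p.
Proof. by rewrite /u; case: cid => /= x []. Qed.

(** Both [v \o u] and the identity are induced by the cowedge [rcl], so they agree by uniqueness. *)
Let vK h : v (u h) = h.
Proof.
have [w [_ wU]] := @rcl_univ k G A _ _ (@rcl_wedge k G A).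
transitivity (w h).
  suff -> : w = v \o u by [].
  by apply: wU => E f p; rewrite /= uE; exact: rc_factorE.
by have -> : w = idfun by exact: (wU idfun).
Qed.

Let uK F : u (v F) = F.
Proof.
by have [E [f [p ->]]] := rc_clP F; rewrite -[X in _ = X]uE; congr (u _); exact: rc_factorE.
Qed.

(** Carried over from the concrete model, where every function of finite type is a single
    coefficient; sums of classes need not be considered. *)
Lemma rclP (h : A) : exists E (f : cosect E) (p : sect E), h = rcl A f p.
Proof.
have [E [f [p e]]] := rc_clP (u h); exists E, f, p.
by rewrite -[LHS]vK e; exact: rc_factorE.
Qed.

Definition ev_fun (h : A) : arrfun k G := rc_ev (u h).

Lemma ev_cl E (f : cosect E) (p : sect E) : ev_fun (rcl A f p) = coef f p.
Proof. by rewrite /ev_fun uE. Qed.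

Fact ev_zmod : zmod_morphism ev_fun. Proof. by move=> a b; rewrite /ev_fun !raddfB. Qed.
Fact ev_scal : scalable ev_fun. Proof. by move=> c a; rewrite /ev_fun !linearZ. Qed.
Fact ev_src_ a g : ev_fun (hsrc A a) g = a (gsrc g).
Proof. by rewrite rcl_src ev_cl /coef /= !lfunE. Qed.
Fact ev_tgt_ a g : ev_fun (htgt A a) g = a (gtgt g).
Proof. by rewrite rcl_tgt ev_cl /coef /= !lfunE /= !lfunE [LHS]mulr1. Qed.
Fact ev_monoid : monoid_morphism ev_fun.
Proof.
split=> [|a b].
  by apply/funext => g; rewrite -(rmorph1 (hsrc A)) ev_src_.
have [E [f [p ->]]] := rclP a; have [F [g [q ->]]] := rclP b.
by rewrite rcl_mul /ev_fun !uE -rmorphM rc_mul.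
Qed.
HB.instance Definition _ := GRing.isZmodMorphism.Build A (arrfun k G) ev_fun ev_zmod.
HB.instance Definition _ := GRing.isMonoidMorphism.Build A (arrfun k G) ev_fun ev_monoid.
HB.instance Definition _ := GRing.isScalable.Build k A (arrfun k G) *:%R ev_fun ev_scal.

Fact ev_inj : injective ev_fun.
Proof. by move=> a b /val_inj/(can_inj vK). Qed.
Fact ev_eps_ h x : (heps A h : B) x = ev_fun h (gid x).
Proof.
by have [E [f [p ->]]] := rclP h; rewrite rcl_eps ev_cl coef_id.
Qed.
Fact ev_anti_ h g : ev_fun (hanti A h) g = ev_fun h (ginv g).
Proof.
have [E [f [p ->]]] := rclP h; rewrite rcl_anti !ev_cl.
exact: (esym (congr1 (fun F : rep_alg k G => rcval F g) (rc_antiE f p))).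
Qed.
Fact ev_delta_ h g g' (e : gsrc g = gtgt g') :
  ev2 ev_fun g g' (hdelta A h) = ev_fun h (gcomp e).
Proof.
have [E [f [p ->]]] := rclP h; have [n [s [t st]]] := dual_basis_ex E.
rewrite (rcl_delta A st) (ev2_sum ev_src_ ev_tgt_) // ev_cl (coef_dual_basis st).
by apply: eq_bigr => i _; rewrite (ev2E ev_src_ ev_tgt_) //= !ev_cl.
Qed.
Fact ev_onto_ (F : arrfun k G) : rep_fun F -> exists h, ev_fun h = F.
Proof. by move=> FP; exists (v (rc FP)); rewrite /ev_fun uK. Qed.

Definition rep_evaluation : evaluation A :=
  @Evaluation A ev_fun ev_inj ev_src_ ev_tgt_ ev_eps_ ev_anti_ ev_delta_ ev_onto_.
End Evaluations.


(** * The adjunction *)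

Section Adjunction.
Variables (k : fieldType) (G : groupoid) (X : rep_functions k G).
Local Notation B := (mapalg k (gob_inh G)).
Local Notation ev := (rep_evaluation X).

Section Unit.
Variable g : garr G.
Definition ev_at (h : X) : k^o := ev h g.
Fact ev_at_zmod : zmod_morphism ev_at.
Proof. by move=> a b; rewrite /ev_at raddfB. Qed.
Fact ev_at_monoid : monoid_morphism ev_at.
Proof. by split=> [|a b]; rewrite /ev_at ?rmorph1 ?rmorphM. Qed.
Fact ev_at_scal : scalable ev_at.
Proof. by move=> c a; rewrite /ev_at linearZ. Qed.
HB.instance Definition _ := GRing.isZmodMorphism.Build X k^o ev_at ev_at_zmod.
HB.instance Definition _ := GRing.isMonoidMorphism.Build X k^o ev_at ev_at_monoid.
HB.instance Definition _ := GRing.isScalable.Build k X k^o *:%R ev_at ev_at_scal.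
End Unit.

Local Notation XG := (char_groupoid (rep_chalgd X)).
(** The unit of the adjunction, from [G] to the characters of its representative functions: objects
    and arrows go to evaluation at them. *)
Definition unit_ob (x : gob G) : gob XG := mapalg_eval x : {lrmorphism B -> k^o}.
Definition unit_arr (g : garr G) : garr XG := ev_at g : {lrmorphism X -> k^o}.

Fact unit_src g : gsrc (unit_arr g) = unit_ob (gsrc g).
Proof. by apply: lrmorphismP => r; exact: (evl_src ev). Qed.
Fact unit_tgt g : gtgt (unit_arr g) = unit_ob (gtgt g).
Proof. by apply: lrmorphismP => r; exact: (evl_tgt ev). Qed.
Fact unit_id x : unit_arr (gid x) = gid (unit_ob x).
Proof. by apply: lrmorphismP => h; exact: (esym (evl_eps ev h x)). Qed.
Fact unit_comp g h (e : gsrc g = gtgt h) e' :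
  unit_arr (gcomp e) = @gcomp XG (unit_arr g) (unit_arr h) e'.
Proof. by apply: lrmorphismP => a; exact: (esym (evl_delta ev a e)). Qed.
Definition unit_hom : grpd_hom G XG :=
  @GrpdHom G XG unit_ob unit_arr unit_src unit_tgt unit_id unit_comp.

Variable A : chalgd k.

Definition adj (u : chalgd_hom A (rep_chalgd X)) : grpd_hom G (char_groupoid A) :=
  grpd_comp (char_map u) unit_hom.

Section Inverse.
Variable F : grpd_hom G (char_groupoid A).
Let F0 (x : gob G) : chars (cbase A) := gmap0 F x.
Let F1 (g : garr G) : chars (htot A) := gmap1 F g.

Fact F1_src g r : F1 g (hsrc A r) = F0 (gsrc g) r.
Proof. exact: (congr1 (fun u : chars _ => u r) (gmap_src F g)). Qed.
Fact F1_tgt g r : F1 g (htgt A r) = F0 (gtgt g) r.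
Proof. exact: (congr1 (fun u : chars _ => u r) (gmap_tgt F g)). Qed.
Fact F1_id x h : F1 (gid x) h = F0 x (heps A h).
Proof. exact: (congr1 (fun u : chars _ => u h) (gmap_id F x)). Qed.
Fact F1_bal g h : gsrc g = gtgt h ->
  balanced (fun r (a : A) => a * hsrc A r) (fun r (b : A) => htgt A r * b)
    (fun a b => F1 g a * F1 h b).
Proof.
by move=> e; apply: char_bal; rewrite [LHS](gmap_src F) [RHS](gmap_tgt F) e.
Qed.
Fact F1_comp g h (e : gsrc g = gtgt h) a :
  F1 (gcomp e) a = tlift (fun a b => F1 g a * F1 h b) (hdelta A a).
Proof.
have e' : gsrc (gmap1 F g) = gtgt (gmap1 F h).
  by rewrite [LHS](gmap_src F) [RHS](gmap_tgt F) e.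
exact: (congr1 (fun u : chars _ => u a) (gmap_comp e e')).
Qed.
(** [grpd_hom] has no clause on inverses; their preservation follows from uniqueness of inverses in
    the character groupoid. *)
Fact F1_anti g h : F1 (ginv g) h = F1 g (hanti A h).
Proof.
have e : gsrc (ginv g) = gtgt g by rewrite gsrc_inv.
have e' : gsrc (gmap1 F (ginv g)) = gtgt (gmap1 F g).
  by rewrite [LHS](gmap_src F) [RHS](gmap_tgt F) e.
have := @ginv_uniq (char_groupoid A) (gmap1 F (ginv g)) (gmap1 F g) e'.
rewrite -(gmap_comp e e') gcompVl gmap_id gmap_src => /(_ erefl).
by move=> /(congr1 (fun u : chars _ => u h)).
Qed.

Definition coadj0 (r : cbase A) : B := fun x => F0 x r.
Fact coadj0_zmod : zmod_morphism coadj0.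
Proof. by move=> a b; apply/funext => x; rewrite /coadj0 raddfB. Qed.
Fact coadj0_monoid : monoid_morphism coadj0.
Proof. by split=> [|a b]; apply/funext => x; rewrite /coadj0 ?rmorph1 ?rmorphM. Qed.
Fact coadj0_scal : scalable coadj0.
Proof. by move=> c a; apply/funext => x; rewrite /coadj0 linearZ. Qed.
HB.instance Definition _ := GRing.isZmodMorphism.Build _ B coadj0 coadj0_zmod.
HB.instance Definition _ := GRing.isMonoidMorphism.Build _ B coadj0 coadj0_monoid.
HB.instance Definition _ := GRing.isScalable.Build k _ B *:%R coadj0 coadj0_scal.

(* A decomposition of [Delta h] exhibits [g |-> F1 g h] as a representative
   function. *)
Fact coadj1_rep_fun h : rep_fun (fun g => F1 g h : k).
Proof.
have [n [a [b hE]]] := tensor_fin (hdelta A h).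
exists n, (fun i g => F1 g (a i)), (fun i g => F1 g (b i)) => g g' e.
rewrite F1_comp hE tlift_sum; last exact: F1_bal.
by apply: eq_bigr => i _; rewrite tliftE //; exact: F1_bal.
Qed.
Definition coadj1 (h : A) : X := sval (cid (evl_onto ev (coadj1_rep_fun h))).
Lemma coadj1E h g : ev (coadj1 h) g = F1 g h.
Proof. by rewrite /coadj1; case: cid => /= x ->. Qed.
Lemma coadj1_uniq h x : (forall g, ev x g = F1 g h) -> coadj1 h = x.
Proof.
by move=> e; apply: (@evl_inj _ _ _ ev); apply/funext => g; rewrite coadj1E e.
Qed.
Fact coadj1_zmod : zmod_morphism coadj1.
Proof.
move=> a b; apply: coadj1_uniq => g.
by rewrite raddfB [LHS]/(ev _ g - ev _ g) !coadj1E raddfB.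
Qed.
Fact coadj1_monoid : monoid_morphism coadj1.
Proof.
split=> [|a b]; apply: coadj1_uniq => g; first by rewrite !rmorph1.
by rewrite rmorphM [LHS]/(ev _ g * ev _ g) !coadj1E rmorphM.
Qed.
Fact coadj1_scal : scalable coadj1.
Proof.
move=> c a; apply: coadj1_uniq => g.
by rewrite linearZ [LHS]/(c * ev _ g) coadj1E linearZ.
Qed.
HB.instance Definition _ := GRing.isZmodMorphism.Build A X coadj1 coadj1_zmod.
HB.instance Definition _ := GRing.isMonoidMorphism.Build A X coadj1 coadj1_monoid.
HB.instance Definition _ := GRing.isScalable.Build k A X *:%R coadj1 coadj1_scal.

Fact coadj_src r : coadj1 (hsrc A r) = hsrc X (coadj0 r).
Proof. by apply: coadj1_uniq => g; rewrite evl_src F1_src. Qed.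
Fact coadj_tgt r : coadj1 (htgt A r) = htgt X (coadj0 r).
Proof. by apply: coadj1_uniq => g; rewrite evl_tgt F1_tgt. Qed.
Fact coadj_eps h : coadj0 (heps A h) = heps X (coadj1 h).
Proof. by apply/funext => x; rewrite (evl_eps ev) coadj1E F1_id. Qed.
Fact coadj_delta h :
  hdelta X (coadj1 h) = tlift (fun a b => tens (coadj1 a) (coadj1 b)) (hdelta A h).
Proof.
apply: (ev2_inj (@evl_inj _ _ _ ev) (evl_src ev) (evl_tgt ev)) => g g' e.
rewrite (evl_delta ev _ e) coadj1E F1_comp.
rewrite /tlift /tens_sum (ev2_sum (evl_src ev) (evl_tgt ev)) //.
by apply: eq_bigr => p _; rewrite (ev2E (evl_src ev) (evl_tgt ev)) // !coadj1E.
Qed.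
Fact coadj_anti h : coadj1 (hanti A h) = hanti X (coadj1 h).
Proof. by apply: coadj1_uniq => g; rewrite evl_anti coadj1E F1_anti. Qed.

Definition coadj : chalgd_hom A (rep_chalgd X) :=
  @CHAlgdHom k A (rep_chalgd X) coadj0 coadj1
    coadj_src coadj_tgt coadj_eps coadj_delta coadj_anti.
End Inverse.

Lemma adj_bij : bijective adj.
Proof.
exists coadj => [u|F].
  apply: chalgd_homP => [r|h]; first exact: erefl.
  exact: coadj1_uniq.
apply: grpd_homP => [x|g]; apply: lrmorphismP => h; first exact: erefl.
exact: coadj1E.
Qed.
Lemma adjK F : adj (coadj F) = F.
Proof.
apply: grpd_homP => [x|g]; apply: lrmorphismP => h; first exact: erefl.
exact: coadj1E.
Qed.
End Adjunction.

(** * Functoriality and naturality *)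

Section Functoriality.
Variable k : fieldType.

(** Obtained as the transpose of the unit after [p] rather than on classes, so that identities can
    be tested after [adj]; the formula on classes is [rep_map_is_rep_map]. *)
Definition rep_map G H (X : rep_functions k G) (Y : rep_functions k H)
    (p : grpd_hom G H) : chalgd_hom (rep_chalgd Y) (rep_chalgd X) :=
  coadj X (grpd_comp (unit_hom Y) p).

Lemma adj_rep_map G H (X : rep_functions k G) (Y : rep_functions k H)
    (p : grpd_hom G H) : adj (rep_map X Y p) = grpd_comp (unit_hom Y) p.
Proof. exact: adjK. Qed.

Lemma rep_mapE G H (X : rep_functions k G) (Y : rep_functions k H)
    (p : grpd_hom G H) h g :
  rep_evaluation X (hmap1 (rep_map X Y p) h) g = rep_evaluation Y h (gmap1 p g).
Proof. exact: coadj1E. Qed.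

Lemma rep_map_is_rep_map G H (X : rep_functions k G) (Y : rep_functions k H)
    (p : grpd_hom G H) : is_rep_map p (rep_map X Y p).
Proof.
split=> // F f q; apply: (@evl_inj _ _ _ (rep_evaluation X)); apply/funext => g.
rewrite rep_mapE [LHS](congr1 (@^~ _) (ev_cl _ _ _)) [RHS](congr1 (@^~ _) (ev_cl _ _ _)).
exact: coef_at.
Qed.

Lemma rep_map_uniq G H (X : rep_functions k G) (Y : rep_functions k H)
    (p : grpd_hom G H) (u : chalgd_hom (rep_chalgd Y) (rep_chalgd X)) :
  adj u = grpd_comp (unit_hom Y) p -> rep_map X Y p = u.
Proof.
move=> e; apply: (bij_inj (@adj_bij _ _ X (rep_chalgd Y))).
by rewrite adj_rep_map.
Qed.

Lemma rep_map_id G (X : rep_functions k G) :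
  rep_map X X (grpd_idm G) = chalgd_idm (rep_chalgd X).
Proof. by apply: rep_map_uniq; apply: grpd_homP => x; apply: lrmorphismP. Qed.

Lemma rep_map_comp G H K (X : rep_functions k G) (Y : rep_functions k H)
    (Z : rep_functions k K) (q : grpd_hom H K) (p : grpd_hom G H) :
  rep_map X Z (grpd_comp q p) = chalgd_comp (rep_map X Y p) (rep_map Y Z q).
Proof.
apply: rep_map_uniq; apply: grpd_homP => x; apply: lrmorphismP => // h.
by rewrite /= /ev_at !rep_mapE.
Qed.

Lemma adj_naturall (A A' : chalgd k) G (X : rep_functions k G) (u : chalgd_hom A' A)
    (f : chalgd_hom A (rep_chalgd X)) :
  adj (chalgd_comp f u) = grpd_comp (char_map u) (adj f).
Proof. by apply: grpd_homP => x; apply: lrmorphismP. Qed.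

Lemma adj_naturalr (A : chalgd k) G G' (X : rep_functions k G) (X' : rep_functions k G')
    (p : grpd_hom G' G) (f : chalgd_hom A (rep_chalgd X)) :
  adj (chalgd_comp (rep_map X' X p) f) = grpd_comp (adj f) p.
Proof.
apply: grpd_homP => x; apply: lrmorphismP => // h.
by rewrite /= /ev_at rep_mapE.
Qed.
End Functoriality.

(** * Total composition and connecting arrows *)

Section TotalComposition.
Variable G : groupoid.
Implicit Types f g h : garr G.

(* The composite, with the junk value [g] when [g] and [h] are not composable. *)
Definition cmp g h := if pselect (gsrc g = gtgt h) is left e then gcomp e else g.

Lemma cmpE g h (e : gsrc g = gtgt h) : cmp g h = gcomp e.
Proof. by rewrite /cmp; case: pselect => // e'; apply: gcomp_eq. Qed.
Lemma cmp_src g h : gsrc g = gtgt h -> gsrc (cmp g h) = gsrc h.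
Proof. by move=> e; rewrite (cmpE e) gsrc_comp. Qed.
Lemma cmp_tgt g h : gsrc g = gtgt h -> gtgt (cmp g h) = gtgt g.
Proof. by move=> e; rewrite (cmpE e) gtgt_comp. Qed.
Lemma cmpA f g h : gsrc f = gtgt g -> gsrc g = gtgt h ->
  cmp f (cmp g h) = cmp (cmp f g) h.
Proof.
move=> e1 e2.
have e3 : gsrc f = gtgt (gcomp e2) by rewrite gtgt_comp.
have e4 : gsrc (gcomp e1) = gtgt h by rewrite gsrc_comp.
by rewrite (cmpE e1) (cmpE e2) (cmpE e3) (cmpE e4) (gcompA e4 e3).
Qed.
Lemma cmp1 g x : gsrc g = x -> cmp g (gid x) = g.
Proof.
move=> e; have e1 : gsrc g = gtgt (gid x) by rewrite gtgt_id.
by rewrite (cmpE e1) gcomp1_eq.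
Qed.
Lemma cmp1l g x : gtgt g = x -> cmp (gid x) g = g.
Proof.
move=> e; have e1 : gsrc (gid x) = gtgt g by rewrite gsrc_id.
by rewrite (cmpE e1) gcomp1l_eq.
Qed.
Lemma cmpV g : cmp g (ginv g) = gid (gtgt g).
Proof.
have e : gsrc g = gtgt (ginv g) by rewrite gtgt_inv.
by rewrite (cmpE e) gcompV.
Qed.
Lemma cmpVl g : cmp (ginv g) g = gid (gsrc g).
Proof.
have e : gsrc (ginv g) = gtgt g by rewrite gsrc_inv.
by rewrite (cmpE e) gcompVl.
Qed.
End TotalComposition.

Section Paths.
Variables (G : groupoid) (trG : transitive_groupoid G).

Definition base_ob : gob G :=
  sval (cid (let: inhabits x := gob_inh G in ex_intro (fun=> True) x I)).
Definition spoke x : garr G := sval (cid (trG base_ob x)).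
Lemma spoke_src x : gsrc (spoke x) = base_ob.
Proof. by rewrite /spoke; case: cid => /= g []. Qed.
Lemma spoke_tgt x : gtgt (spoke x) = x.
Proof. by rewrite /spoke; case: cid => /= g []. Qed.
(** Passing through the base point makes this choice of arrows coherent: they compose to one
    another, and [conn x x] is an identity. *)
Definition conn x y : garr G := cmp (spoke y) (ginv (spoke x)).
Let conn_cmp x y : gsrc (spoke y) = gtgt (ginv (spoke x)).
Proof. by rewrite gtgt_inv !spoke_src. Qed.
Lemma conn_src x y : gsrc (conn x y) = x.
Proof. by rewrite /conn cmp_src // gsrc_inv spoke_tgt. Qed.
Lemma conn_tgt x y : gtgt (conn x y) = y.
Proof. by rewrite /conn cmp_tgt // spoke_tgt. Qed.
Lemma conn_id x : conn x x = gid x.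
Proof. by rewrite /conn cmpV spoke_tgt. Qed.
Lemma conn_comp x y z : cmp (conn y z) (conn x y) = conn x z.
Proof.
have yx : gsrc (ginv (spoke y)) = gtgt (spoke y) by rewrite gsrc_inv.
rewrite {2}/conn cmpA ?conn_src ?spoke_tgt //; congr (cmp _ _).
by rewrite -cmpA // cmpVl cmp1 // !spoke_src.
Qed.
End Paths.

(** * Comodules over a transitive groupoid *)

Section ScalarRestriction.
Variables (S A : pzRingType) (f : {rmorphism S -> A}) (M : lmodType A).
Definition rmod of {rmorphism S -> A} : Type := M.
Local Notation N := (rmod f).
HB.instance Definition _ := GRing.Zmodule.on N.
Definition rscale (c : S) (m : N) : N := f c *: (m : M).
Fact rscaleA a b v : rscale a (rscale b v) = rscale (a * b) v.
Proof. by rewrite /rscale scalerA rmorphM. Qed.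
Fact rscale1 : left_id 1 rscale.
Proof. by move=> v; rewrite /rscale rmorph1 scale1r. Qed.
Fact rscaleDr : right_distributive rscale +%R.
Proof. by move=> a u v; rewrite /rscale [LHS]scalerDr. Qed.
Fact rscaleDl v : {morph rscale^~ v : a b / a + b}.
Proof. by move=> a b; rewrite /rscale rmorphD [LHS]scalerDl. Qed.
HB.instance Definition _ :=
  GRing.Zmodule_isLmodule.Build S N rscaleA rscale1 rscaleDr rscaleDl.
End ScalarRestriction.
Notation kmod M := (rmod M (in_alg _)).

Section Sections.
Variables (k : fieldType) (G : groupoid).
Local Notation B := (mapalg k (gob_inh G)).
Variables (H : hopf_algebroid B) (ev : evaluation H).
Implicit Types (a u : gob G -> garr G) (h : H).

(** Here [a] chooses an arrow for each object; when [a y] ends at [y] ([is_section]), restriction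
    along [a] is compatible with the target map. *)
Definition along a h : B := fun y => ev h (a y).
Definition is_section a := forall y, gtgt (a y) = y.

Lemma alongD a h h' : along a (h + h') = along a h + along a h'.
Proof. by apply/funext => y; rewrite /along raddfD. Qed.

Lemma along_tgt a r h : is_section a -> along a (htgt H r * h) = r * along a h.
Proof.
move=> sa; apply/funext => y; rewrite /along rmorphM.
rewrite [LHS]/(ev (htgt H r) (a y) * ev h (a y)) evl_tgt sa; exact: erefl.
Qed.

Lemma along_src a r h :
  along a (h * hsrc H r) = ((fun y => r (gsrc (a y))) : B) * along a h.
Proof.
apply/funext => y; rewrite /along rmorphM mulrC.
rewrite [LHS]/(ev (hsrc H r) (a y) * ev h (a y)) evl_src; exact: erefl.
Qed.

Section Op.
Variable M : comodule H.

Definition opc a (z : cotens H M) : M := tlift (fun m h => along a h *: m) z.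
(** With [m] thought of as a section, [op a m] has at [y] the transport along [a y] of the value of
    [m] at the source of [a y]; [opZ] expresses this on scalars. *)
Definition op a (m : M) : M := opc a (coact M m).

Lemma opc_bal a : is_section a -> balanced (fun (r : B) (m : M) => r *: m)
  (fun (r : B) (h : H) => htgt H r * h) (fun m h => along a h *: m).
Proof.
move=> sa; split=> [m m' h|m h h'|r m h]; first exact: scalerDr.
  by rewrite alongD scalerDl.
by rewrite along_tgt // scalerA mulrC.
Qed.

Lemma opc_tens a m h : is_section a -> opc a (tens m h) = along a h *: m.
Proof. by move=> sa; rewrite /opc tliftE //; exact: opc_bal. Qed.

Lemma opc_sum a I (s : seq I) (F : I -> cotens H M) : is_section a ->
  opc a (\sum_(i <- s) F i) = \sum_(i <- s) opc a (F i).
Proof. by move=> sa; rewrite /opc tlift_sum //; exact: opc_bal. Qed.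

Lemma opcD a z w : is_section a -> opc a (z + w) = opc a z + opc a w.
Proof. by move=> sa; rewrite /opc tliftD //; exact: opc_bal. Qed.

Lemma opc_act a r z : is_section a ->
  opc a (cotens_act r z) = ((fun y => r (gsrc (a y))) : B) *: opc a z.
Proof.
move=> sa; rewrite [in RHS]/opc /cotens_act /tlift /tens_sum scaler_sumr opc_sum //.
by apply: eq_bigr => p _; rewrite opc_tens // along_src scalerA.
Qed.

Lemma opD a m m' : is_section a -> op a (m + m') = op a m + op a m'.
Proof. by move=> sa; rewrite /op raddfD opcD. Qed.
Lemma op0 a : is_section a -> op a 0 = 0.
Proof. by move=> sa; apply: (addrI (op a 0)); rewrite -opD // !addr0. Qed.
Lemma op_sum a I (s : seq I) (F : I -> M) : is_section a ->
  op a (\sum_(i <- s) F i) = \sum_(i <- s) op a (F i).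
Proof.
by move=> sa; apply: (big_morph (op a)) => [m m'|]; [exact: opD|exact: op0].
Qed.
Lemma opZ a r m : is_section a ->
  op a (r *: m) = ((fun y => r (gsrc (a y))) : B) *: op a m.
Proof. by move=> sa; rewrite /op coact_lin opc_act. Qed.

Lemma op_ext a a' : a =1 a' -> op a =1 op a'.
Proof. by move=> /funext ->. Qed.

Lemma op_id m : op (@gid G) m = m.
Proof.
rewrite -[RHS]coact_eps; apply: eq_tlift => m' h; congr (_ *: _).
by apply/funext => y; rewrite /along (evl_eps ev).
Qed.

(** Coassociativity of the coaction, evaluated at the pairs [(a y, u y)], where [Delta h] takes the
    value of [h] at the composite. *)
Lemma op_cmp a u m : is_section a -> (forall y, gsrc (a y) = gtgt (u y)) ->
  tlift (fun m' h => along u h *: op a m') (coact M m) = op (fun y => cmp (a y) (u y)) m.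
Proof.
move=> sa hu.
have bal : balanced (@cotens_act _ _ H M) (fun (r : B) (h : H) => htgt H r * h)
    (fun z h => along u h *: opc a z).
  split=> [z w h|z h h'|r z h].
  - by rewrite opcD // scalerDr.
  - by rewrite alongD scalerDl.
  - rewrite opc_act // scalerA; congr (_ *: _); apply/funext => y.
    rewrite /along rmorphM [RHS]/(ev (htgt H r) (u y) * ev h (u y)) evl_tgt -hu mulrC.
    exact: erefl.
have := congr1 (tlift (fun z h => along u h *: opc a z)) (coact_delta m).
rewrite !tlift_tlift // => E; transitivity (tlift (fun m' h =>
  tlift (fun z h => along u h *: opc a z)
    (tens (coact M m') h : tensor (@cotens_act _ _ H M)
      (fun (r : B) (h : H) => htgt H r * h))) (coact M m)).
  by apply: eq_tlift => m' h; rewrite tliftE.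
rewrite E; apply: eq_tlift => m' h; rewrite tlift_tlift //.
transitivity (tlift (fun h1 h2 => (along u h2 * along a h1) *: m') (hdelta H h)).
  by apply: eq_tlift => h1 h2; rewrite tliftE // opc_tens // scalerA.
rewrite /tlift /tens_sum -scaler_suml; congr (_ *: _).
apply/funext => y; rewrite fct_sumE /along (cmpE (hu y)) -(evl_delta ev).
by apply: eq_bigr => p _; rewrite [LHS]mulrC.
Qed.

Lemma op_op a b m : is_section a -> is_section b ->
  op a (op b m) = op (fun y => cmp (a y) (b (gsrc (a y)))) m.
Proof.
move=> sa sb; rewrite -(op_cmp _ sa) => [|y]; last by rewrite sb.
rewrite {2}/op /opc /tlift /tens_sum op_sum //; apply: eq_bigr => p _.
by rewrite opZ.
Qed.
End Op.

Lemma op_hom (M N : comodule H) (f : comod_hom M N) a m : is_section a ->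
  f (op a m) = op a (f m).
Proof.
move=> sa; rewrite [RHS]/op cohom_coact /tlift /tens_sum opc_sum //.
rewrite [in LHS]/op [in LHS]/opc /tlift /tens_sum linear_sum.
by apply: eq_bigr => p _; rewrite linearZ opc_tens.
Qed.
End Sections.

(** * Flat vectors of a comodule *)

Section FlatVectors.
Variables (k : fieldType) (G : groupoid) (trG : transitive_groupoid G).
Local Notation B := (mapalg k (gob_inh G)).
Variables (H : hopf_algebroid B) (ev : evaluation H).
Local Notation conn := (conn trG).
Local Notation x0 := (base_ob G).

Lemma conn_section x : is_section (conn x). Proof. by move=> y; rewrite conn_tgt. Qed.
#[local] Hint Resolve conn_section : core.

Section OneComodule.
Variable M : comodule H.
Local Notation kM := (kmod M).
Implicit Types m : M.

(** Spreads the value of [m] at [x] over all objects along connecting arrows. The flat vectors,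
    fixed by every [sig x], play the part of the fibre at the base point. *)
Definition sig x (m : M) : M := op ev (conn x) m.
Definition flat (m : M) := forall x, sig x m = m.

Lemma sigZ x (r : B) m : sig x (r *: m) = ((r x)%:A : B) *: sig x m.
Proof.
rewrite /sig opZ //; congr (_ *: _); apply/funext => y.
by rewrite conn_src; exact: (esym (mulr1 (r x))).
Qed.

Lemma opZk a (c : k) m : is_section a ->
  op ev a ((c%:A : B) *: m) = (c%:A : B) *: op ev a m.
Proof. by move=> sa; rewrite opZ. Qed.

Lemma flat_sig x m : flat (sig x m).
Proof.
by move=> z; rewrite /sig op_op //; apply: op_ext => y; rewrite conn_src conn_comp.
Qed.

Lemma flat0 : flat 0. Proof. by move=> x; exact: op0. Qed.
Lemma flatP (c : k) m n : flat m -> flat n -> flat ((c%:A : B) *: m + n).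
Proof. by move=> fm fn x; rewrite /sig opD // opZk // [op _ _ m]fm [op _ _ n]fn. Qed.

Lemma flat_lspan n (w : 'I_n -> kM) m : (forall i, flat (w i)) -> lspan w m -> flat m.
Proof.
move=> fw; apply: (@lspan_ind _ _ _ w flat) => //; first exact: flat0.
by move=> c u v; exact: flatP.
Qed.

(** The identity of [y] is [conn x0 y] after [conn y x0]. This makes [m] a combination of flat
    vectors with coefficients in [B]. *)
Lemma flat_expand m :
  m = tlift (fun m' h => along ev (fun y => conn y x0) h *: sig x0 m') (coact M m).
Proof.
rewrite op_cmp // => [|y]; last by rewrite conn_src conn_tgt.
rewrite -[LHS](op_id ev); apply: op_ext => y.
by rewrite conn_comp conn_id.
Qed.

Definition flat_basis d (w : 'I_d -> kM) :=
  [/\ forall i, flat (w i), indep w & forall v, flat v -> lspan w v].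

(** Applying [sig x0] evaluates coefficients at [x0], so [B]-generators [v i] yield the finite
    [k]-spanning family [sig x0 (v i)] for the flat vectors. *)
Lemma flat_basis_ex : exists d (w : 'I_d -> kM), flat_basis w.
Proof.
have [n [v vs]] := cofg M.
have [m fm|d [w [_ fw iw sw]]] := @max_indep k kM flat n (fun i => sig x0 (v i)).
  have [c mE] := vs (m : M); exists (fun i => c i x0).
  rewrite -{1}(fm x0) {1}mE /sig op_sum //; apply: eq_bigr => i _.
  exact: sigZ.
by exists d, w.
Qed.

Section Basis.
Variables (d : nat) (w : 'I_d -> kM).
Hypothesis bw : flat_basis w.

Lemma flat_basis_span (m : M) : exists c : 'I_d -> B, m = \sum_i c i *: (w i : M).
Proof.
have [_ _ sw] := bw; pose S (m : M) := exists c : 'I_d -> B, m = \sum_i c i *: (w i : M).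
change (S m); rewrite (flat_expand m) /tlift /tens_sum.
apply: (big_ind S) => [|u v [c ->] [c' ->]|p _].
- by exists (fun=> 0); rewrite big1 // => i _; rewrite scale0r.
- by exists (fun i => c i + c' i); rewrite -big_split; apply: eq_bigr => i _;
    rewrite scalerDl.
have [c cE] := sw _ (@flat_sig x0 p.1).
exists (fun i => along ev (fun y => conn y x0) p.2 * (c i)%:A).
rewrite cE scaler_sumr; apply: eq_bigr => i _; exact: scalerA.
Qed.

(** Applying [sig x] to the relation evaluates its coefficients at [x], which leaves a [k]-linear
    relation for each [x]. *)
Lemma flat_basis_free (c : 'I_d -> B) :
  \sum_i c i *: (w i : M) = 0 -> forall i, c i = 0.
Proof.
have [fw iw _] := bw => c0 i; apply/funext => x; apply: (iw (fun i => c i x)).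
have := congr1 (sig x) c0; rewrite {2}/sig op0 // => E; rewrite -[RHS]E /sig op_sum //.
by apply: eq_bigr => j _; rewrite [op _ _ _]sigZ fw.
Qed.

Lemma flat_basis_size n (u : 'I_n -> kM) :
  (forall i, flat (u i)) -> indep u -> (n <= d)%N.
Proof. by have [_ _ sw] := bw => fu iu; apply: (indep_leq iu) => i; exact/sw/fu. Qed.

Lemma flat_basis_full (u : 'I_d -> kM) :
  (forall i, flat (u i)) -> indep u -> flat_basis u.
Proof.
have [_ _ sw] := bw => fu iu; split=> // v /sw; apply: indep_full => // i.
exact/sw/fu.
Qed.

(** Transport along [g], then spread the result by connecting arrows. On flat vectors this is an
    action of the groupoid on one vector space. *)
Definition arrow_act g : M -> M := op ev (fun y => cmp (conn (gtgt g) y) g).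
Let act_src g y : gsrc (conn (gtgt g) y) = gtgt g. Proof. exact: conn_src. Qed.
Lemma act_section g : is_section (fun y => cmp (conn (gtgt g) y) g).
Proof. by move=> y; rewrite cmp_tgt // conn_tgt. Qed.

Lemma arrow_actE g m :
  arrow_act g m = tlift (fun m' h => ((ev h g)%:A : B) *: sig (gtgt g) m') (coact M m).
Proof.
rewrite /arrow_act -(op_cmp ev _ (conn_section _)) //; apply: eq_tlift => m' h.
by congr (_ *: _); apply/funext => y; exact: (esym (mulr1 _)).
Qed.

Lemma arrow_act_flat g m : flat (arrow_act g m).
Proof.
move=> x; rewrite /sig /arrow_act op_op //; last exact: act_section.
by apply: op_ext => y; rewrite cmpA ?conn_src ?conn_tgt // conn_comp.
Qed.

Lemma arrow_act_id x m : flat m -> arrow_act (gid x) m = m.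
Proof.
move=> fm; rewrite -[RHS](fm x) /arrow_act /sig; apply: op_ext => y.
by rewrite gtgt_id cmp1 // conn_src.
Qed.

Lemma arrow_act_comp g h m : gsrc g = gtgt h ->
  arrow_act (cmp g h) m = arrow_act g (arrow_act h m).
Proof.
move=> e; rewrite /arrow_act op_op; try exact: act_section.
apply: op_ext => y; rewrite cmp_tgt // cmp_src // e conn_id cmp1l //.
by rewrite -cmpA // conn_src.
Qed.

Lemma arrow_act_balanced g : balanced (fun (r : B) (m : M) => r *: m)
  (fun (r : B) (h : H) => htgt H r * h) (fun m h => ((ev h g)%:A : B) *: sig (gtgt g) m).
Proof.
split=> [m m' h|m h h'|r m h].
- by rewrite /sig opD // scalerDr.
- by rewrite raddfD [X in X%:A]/(ev h g + ev h' g) !scalerDl.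
- rewrite sigZ scalerA rmorphM mulr_algl scalerA; congr (_ *: _ *: _).
  by rewrite [RHS]/(ev (htgt H r) g * ev h g) evl_tgt mulrC.
Qed.

(** Expand the left factors in the flat basis [w] and move the coefficients to the right.
    Independence of [w] then recovers the values of each right factor at every arrow. *)
Lemma cotens_eq (z z' : cotens H M) :
  (forall g, tlift (fun m h => ((ev h g)%:A : B) *: sig (gtgt g) m) z =
             tlift (fun m h => ((ev h g)%:A : B) *: sig (gtgt g) m) z') -> z = z'.
Proof.
have bal := arrow_act_balanced.
pose ph g (z : cotens H M) : M := tlift (fun m h => ((ev h g)%:A : B) *: sig (gtgt g) m) z.
have z0 (y : cotens H M) : (forall g, ph g y = 0) -> y = 0.
  move=> y0; have [n [a [b yE]]] := tensor_fin y.
  have /choice[c cE] p : exists c : 'I_d -> B, a p = \sum_i c i *: (w i : M).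
    exact: flat_basis_span.
  have {}yE : y = \sum_i tens (w i : M) (\sum_p htgt H (c p i) * b p).
    rewrite yE; under eq_bigr => p _ do rewrite cE tens_suml.
    rewrite exchange_big; apply: eq_bigr => i _; rewrite tens_sumr.
    by apply: eq_bigr => p _; exact: tensA.
  have [fw iw _] := bw.
  rewrite yE big1 // => i _; rewrite (_ : \sum_p _ = 0) ?tens0r //.
  apply: (@evl_inj _ _ _ ev); apply/funext => g; rewrite [in RHS]raddf0.
  apply: (iw (fun i => ev (\sum_p htgt H (c p i) * b p) g)).
  rewrite -[RHS](y0 g) yE /ph tlift_sum //; apply: eq_bigr => j _.
  by rewrite tliftE // fw.
move=> e; apply/eqP; rewrite -subr_eq0; apply/eqP/z0 => g.
apply: (addIr (ph g z')); rewrite add0r -[RHS]e /ph -tliftD ?subrK //; exact: bal.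
Qed.
End Basis.
End OneComodule.

Lemma flat_hom (M N : comodule H) (f : comod_hom M N) m : flat m -> flat (f m).
Proof. by move=> fm x; rewrite -{2}(fm x) /sig (op_hom _ f). Qed.

Lemma arrow_act_hom (M N : comodule H) (f : comod_hom M N) g m :
  f (arrow_act g m) = arrow_act g (f m).
Proof. by apply: op_hom; exact: act_section. Qed.
End FlatVectors.

(** * The comodule of a matrix representation *)

Section MatrixComodule.
Variables (k : fieldType) (G : groupoid).
Local Notation B := (mapalg k (gob_inh G)).
Variables (H : hopf_algebroid B) (ev : evaluation H) (d : nat).
Variable rho : garr G -> 'M[k]_d.
Hypothesis rho_id : forall x, rho (gid x) = 1%:M.
Hypothesis rho_cmp : forall g h, gsrc g = gtgt h -> rho (cmp g h) = rho g *m rho h.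

(** Multiplicativity of [rho], read entrywise, is a finite-type decomposition. *)
Fact entry_ex i j : exists h : H, evl ev h = fun g => rho g i j.
Proof.
apply: evl_onto; exists d, (fun l g => rho g i l), (fun l g => rho g l j) => g h e.
by rewrite -(cmpE e) rho_cmp // mxE.
Qed.
Definition entry i j : H := sval (cid (entry_ex i j)).
Lemma entryE i j g : ev (entry i j) g = rho g i j.
Proof. by rewrite /entry; case: cid => /= h ->. Qed.

Lemma entry_delta i j : hdelta H (entry i j) = \sum_l tens (entry i l) (entry l j).
Proof.
apply: (ev2_inj (@evl_inj _ _ _ ev) (evl_src ev) (evl_tgt ev)) => g g' e.
rewrite (evl_delta ev _ e) entryE -(cmpE e) rho_cmp // mxE.
rewrite (ev2_sum (evl_src ev) (evl_tgt ev)) //; apply: eq_bigr => l _.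
by rewrite (ev2E (evl_src ev) (evl_tgt ev)) // !entryE.
Qed.

Lemma entry_eps i j : heps H (entry i j) = (i == j)%:R.
Proof.
apply/funext => x; rewrite (evl_eps ev) entryE rho_id mxE.
by case: (i == j).
Qed.

Local Notation M := 'rV[B]_d.
Local Notation e_ i := (delta_mx 0 i : M).

(** The coaction [e_j |-> \sum_i tens e_i (entry i j)], with the coordinates of [v] entering through
    the source, as [coact_lin] requires. *)
Definition mx_coact (v : M) : cotens H M :=
  \sum_i \sum_j tens (e_ i) (entry i j * hsrc H (v 0 j)).

Fact mx_coact_zmod : zmod_morphism mx_coact.
Proof.
move=> u v; rewrite /mx_coact -[RHS]sumrB; apply: eq_bigr => i _.
rewrite -[RHS]sumrB; apply: eq_bigr => j _.
rewrite !mxE raddfB mulrBr; apply: (addIr (tens (e_ i) (entry i j * hsrc H (v 0 j)))).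
by rewrite subrK -tensDr subrK.
Qed.
HB.instance Definition _ :=
  GRing.isZmodMorphism.Build M (cotens H M) mx_coact mx_coact_zmod.

Lemma mx_coact_delta j : mx_coact (e_ j) = \sum_i tens (e_ i) (entry i j).
Proof.
apply: eq_bigr => i _; rewrite (bigD1 j) //= big1 => [|l /negPf lj].
  by rewrite mxE !eqxx rmorph1 mulr1 addr0.
by rewrite mxE lj andbF raddf0 mulr0 tens0r.
Qed.

Fact mx_coact_lin (r : B) (v : M) : mx_coact (r *: v) = cotens_act r (mx_coact v).
Proof.
rewrite [RHS]/cotens_act tlift_sum; last exact: cotens_act_balanced.
apply: eq_bigr => i _; rewrite tlift_sum; last exact: cotens_act_balanced.
apply: eq_bigr => j _; rewrite tliftE; last exact: cotens_act_balanced.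
by rewrite mxE rmorphM -mulrA [X in _ = tens _ (_ * X)]mulrC.
Qed.

Lemma eps_balanced (L : lmodType B) : balanced (fun (r : B) (m : L) => r *: m)
  (fun (r : B) (h : H) => htgt H r * h) (fun m h => heps H h *: m).
Proof.
split=> [m m' h|m h h'|r m h]; first exact: scalerDr.
  by rewrite rmorphD scalerDl.
by rewrite rmorphM /= heps_tgt scalerA mulrC.
Qed.

Fact mx_coact_eps (v : M) : tlift (fun m h => heps H h *: m) (mx_coact v) = v.
Proof.
rewrite tlift_sum; last exact: eps_balanced.
rewrite [RHS]row_sum_delta; apply: eq_bigr => i _.
rewrite tlift_sum; last exact: eps_balanced.
rewrite (bigD1 i) //= big1 => [|j /negPf ji].
  by rewrite tliftE ?rmorphM /= ?entry_eps ?eqxx ?mul1r ?heps_src ?addr0 //; exact: eps_balanced.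
rewrite tliftE; last exact: eps_balanced.
by rewrite rmorphM /= entry_eps eq_sym ji mul0r scale0r.
Qed.

Fact mx_coact_coassoc (v : M) :
  tlift (fun m h => tens (mx_coact m) h) (mx_coact v) =
  tlift (fun m h =>
           tlift (fun h1 h2 => tens (tens m h1 : cotens H M) h2) (hdelta H h))
    (mx_coact v)
  :> tensor (@cotens_act _ _ H M) (fun (r : B) (h : H) => htgt H r * h).
Proof.
pose T3 := tensor (@cotens_act _ _ H M) (fun (r : B) (h : H) => htgt H r * h).
have B1 : balanced (fun (r : B) (m : M) => r *: m)
    (fun (r : B) (h : H) => htgt H r * h) (fun m h => tens (mx_coact m) h : T3).
  split=> [a a' b|a b b'|c a b]; last 1 first.
  - by rewrite mx_coact_lin; exact: tensA.
  - by rewrite raddfD; exact: tensDl.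
  - exact: tensDr.
have B2 (m : M) : balanced (fun r (a : H) => a * hsrc H r)
    (fun r (b : H) => htgt H r * b)
    (fun h1 h2 => tens (tens m h1 : cotens H M) h2 : T3).
  split=> [a a' b|a b b'|c a b]; last 1 first.
  - by rewrite -cotens_actE; exact: tensA.
  - by rewrite (_ : tens m (a + a') = tens m a + tens m a');
      [exact: tensDl | exact: tensDr].
  - exact: tensDr.
have B3 : balanced (fun (r : B) (m : M) => r *: m)
    (fun (r : B) (h : H) => htgt H r * h) (fun m h => tlift
      (fun h1 h2 => tens (tens m h1 : cotens H M) h2 : T3) (hdelta H h)).
  split=> [a a' b|a b b'|c a b].
  - rewrite /tlift /tens_sum -big_split; apply: eq_bigr => p _ /=.
    by rewrite (_ : tens (a + a') _ = tens a p.1 + tens a' p.1);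
      [exact: tensDl | exact: tensDl].
  - by rewrite rmorphD tliftD.
  - rewrite rmorphM /= hdelta_tgt (tensor_sumE (hdelta H b)) mulr_sumr.
    rewrite !tlift_sum //; apply: eq_bigr => p _.
    rewrite ctensM mul1r !tliftE //; congr (tens _ _).
    exact: (tensA (fun (r : B) (m : M) => r *: m)).
rewrite !tlift_sum //; under eq_bigr do rewrite tlift_sum //.
under [in RHS]eq_bigr do rewrite tlift_sum //.
rewrite exchange_big [RHS]exchange_big; apply: eq_bigr => j _.
have R i : tlift (fun m h => tlift (fun h1 h2 => tens (tens m h1 : cotens H M) h2 : T3)
      (hdelta H h)) (tens (e_ i) (entry i j * hsrc H (v 0 j)) : cotens H M) =
    \sum_l tens (tens (e_ i) (entry i l) : cotens H M) (entry l j * hsrc H (v 0 j)) :> T3.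
  rewrite tliftE // rmorphM /= hdelta_src entry_delta mulr_suml tlift_sum //.
  by apply: eq_bigr => l _; rewrite ctensM mulr1 tliftE.
under [RHS]eq_bigr do rewrite R.
under eq_bigr do rewrite tliftE // mx_coact_delta tens_suml.
exact: exchange_big.
Qed.

Fact mx_cofg : exists n (v : 'I_n -> M),
  forall m, exists c : 'I_n -> B, m = \sum_i c i *: v i.
Proof. by exists d, (fun i => e_ i) => m; exists (m 0); exact: row_sum_delta. Qed.

Definition mx_comodule : comodule H :=
  Comodule (coact := mx_coact) mx_coact_lin mx_coact_eps mx_coact_coassoc mx_cofg.

Section Hom.
Variables (L : comodule H) (w : 'I_d -> L).
Hypothesis w_coact : forall j, coact L (w j) = \sum_i tens (w i) (entry i j).
Definition comb (v : M) : L := \sum_i v 0 i *: w i.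
Fact comb_linear : linear comb.
Proof.
move=> c u v; rewrite /comb scaler_sumr -big_split; apply: eq_bigr => i _.
by rewrite !mxE scalerDl scalerA.
Qed.
HB.instance Definition _ := GRing.isLinear.Build B M L _ comb comb_linear.
Lemma comb_delta i : comb (e_ i) = w i.
Proof.
rewrite /comb (bigD1 i) //= mxE !eqxx scale1r big1 ?addr0 // => j /negPf ji.
by rewrite mxE ji andbF scale0r.
Qed.
Fact comb_coact m : coact L (comb m) = tlift (fun m' h => tens (comb m') h) (mx_coact m).
Proof.
have bal : balanced (fun (r : B) (m : M) => r *: m)
    (fun (r : B) (h : H) => htgt H r * h) (fun m h => tens (comb m) h : cotens H L).
  split=> [a a' b|a b b'|c a b]; last 1 first.
  - by rewrite linearZ; exact: tensA.
  - by rewrite raddfD; exact: tensDl.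
  - exact: tensDr.
rewrite tlift_sum // [in LHS]/comb raddf_sum.
under [in RHS]eq_bigr do rewrite tlift_sum //.
rewrite exchange_big; apply: eq_bigr => j _.
rewrite coact_lin w_coact /cotens_act tlift_sum; last exact: cotens_act_balanced.
apply: eq_bigr => i _; rewrite !tliftE //; last exact: cotens_act_balanced.
by rewrite comb_delta.
Qed.
Definition comb_hom : comod_hom mx_comodule L :=
  @ComodHom _ _ _ mx_comodule L comb comb_coact.
End Hom.
End MatrixComodule.

Section ZeroHom.
Variables (k : fieldType) (R : comAlgType k) (H : hopf_algebroid R) (M N : comodule H).
Fact zero_coact m : coact N ((\0 : {linear M -> N}) m) =
  tlift (fun m' h => tens ((\0 : {linear M -> N}) m') h) (coact M m).
Proof.
rewrite [in LHS]/= raddf0 /tlift /tens_sum big1 // => p _; exact: tens0l.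
Qed.
Definition zero_hom : comod_hom M N := ComodHom zero_coact.
End ZeroHom.

(** * Finite length and finite-dimensional Hom spaces *)

Section Finiteness.
Variables (k : fieldType) (G : groupoid) (trG : transitive_groupoid G).
Local Notation B := (mapalg k (gob_inh G)).
Variables (H : hopf_algebroid B) (ev : evaluation H).
Local Notation flat := (flat trG ev).
Local Notation flat_basis := (flat_basis trG ev).
Local Notation arrow_act := (arrow_act trG ev).

(* A nonzero flat vector killed by [f] lies in a subrepresentation of the flat
   vectors, which is a matrix comodule mapped to zero by [f]. *)
Lemma mono_flat_inj (L M : comodule H) (f : comod_hom L M) :
  comod_mono f -> forall l, flat l -> f l = 0 -> l = 0.
Proof.
move=> fm l fl l0; have [d [w bw]] := flat_basis_ex trG ev L.
have [_ _ sw] := bw.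
have [v [/sw //]|n [u [_ Du iu su]]] :=
  @max_indep k (kmod L) (fun v => flat v /\ f v = 0) d w.
(* Flat vectors killed by [f] are stable under [arrow_act]; [rho g] is its matrix in the basis
   [u]. *)
have /choice[rho rhoE] g : exists R : 'M[k]_n, forall j,
    arrow_act g (u j) = \sum_i ((R i j)%:A : B) *: (u i : L).
  have /choice[R RE] j : lspan u (arrow_act g (u j)).
    apply: su; split; first exact: arrow_act_flat.
    by rewrite arrow_act_hom (Du j).2 /arrow_act op0 //; exact: act_section.
  by exists (\matrix_(i, j) R j i) => j; rewrite RE; apply: eq_bigr => i _; rewrite mxE.
have rho_id x : rho (gid x) = 1%:M.
  apply/matrixP => i j.
  apply: (indep_inj iu (a := fun i => rho (gid x) i j) (b := fun i => (1%:M : 'M_n) i j)).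
  rewrite -[LHS]rhoE arrow_act_id; last exact: (Du j).1.
  rewrite (bigD1 j) //= mxE eqxx scale1r big1 ?addr0 // => l' /negPf lj.
  by rewrite mxE lj scale0r.
have rho_cmp g h : gsrc g = gtgt h -> rho (cmp g h) = rho g *m rho h.
  move=> e; apply/matrixP => i j.
  apply: (indep_inj iu (a := fun i => rho (cmp g h) i j)
    (b := fun i => (rho g *m rho h) i j)).
  rewrite -[LHS]rhoE arrow_act_comp // rhoE /arrow_act op_sum; last exact: act_section.
  under [RHS]eq_bigr do rewrite mxE scaler_suml.
  rewrite exchange_big; apply: eq_bigr => l' _.
  rewrite opZk; last exact: act_section.
  rewrite -/(arrow_act g _) rhoE scaler_sumr; apply: eq_bigr => i' _.
  by rewrite scalerA mulr_algl scalerA mulrC.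
have uc j : coact L (u j) = \sum_i tens (u i : L) (entry ev rho_cmp i j).
  apply: (cotens_eq bw) => g; rewrite -arrow_actE rhoE.
  rewrite tlift_sum; last exact: arrow_act_balanced.
  apply: eq_bigr => i _; rewrite tliftE; last exact: arrow_act_balanced.
  by rewrite entryE (Du i).1.
(* [comb_hom] and the zero morphism agree after [f], hence agree, so every [u i] is zero. *)
have := fm _ (comb_hom rho_id uc) (zero_hom _ _).
rewrite /= => mono.
have u0 i : (u i : L) = 0.
  rewrite -(comb_delta u i) mono // => x.
  by rewrite raddf0 /comb linear_sum big1 // => j _; rewrite linearZ /= (Du j).2 scaler0.
have [c ->] := su l (conj fl l0); rewrite big1 // => i _.
by rewrite u0 scaler0.
Qed.

(** Flat bases are bases over [B], so [f] is bijective, and the linear inverse inherits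
    compatibility with the coactions. *)
Lemma flat_basis_iso (L M : comodule H) (f : comod_hom L M) d
    (w : 'I_d -> kmod L) (w' : 'I_d -> kmod M) :
  flat_basis w -> flat_basis w' -> (forall i, (w' i : M) = f (w i)) -> comod_iso f.
Proof.
move=> bw bw' e.
have /choice[c cE] m : exists c : 'I_d -> B, m = \sum_i c i *: (w' i : M).
  exact: (flat_basis_span bw').
pose g m : L := \sum_i c m i *: (w i : L).
have fg m : f (g m) = m.
  by rewrite {2}(cE m) /g linear_sum; apply: eq_bigr => i _; rewrite linearZ e.
have finj : injective f.
  move=> x y /eqP; rewrite -subr_eq0 -linearB => /eqP.
  have [b bE] := flat_basis_span bw (x - y); rewrite bE linear_sum => b0.
  apply/eqP; rewrite -subr_eq0 bE big1 // => i _.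
  rewrite (flat_basis_free bw' (c := b)) ?scale0r // -[RHS]b0.
  by apply: eq_bigr => j _; rewrite linearZ e.
have gf : cancel f g by move=> x; apply: finj.
have glin : linear g by move=> r x y; apply: finj; rewrite linearP !fg.
pose gm := GRing.isLinear.Build B M L _ g glin.
pose gL : {linear M -> L} := HB.pack g gm.
have gco m : coact L (gL m) = tlift (fun m' h => tens (gL m') h) (coact M m).
  have bal : balanced (fun (r : B) (m : M) => r *: m)
      (fun (r : B) (h : H) => htgt H r * h) (fun m h => tens (gL m) h : cotens H L).
    split=> [a a' b|a b b'|r a b]; last 1 first.
    - by rewrite linearZ; exact: tensA.
    - by rewrite raddfD; exact: tensDl.
    - exact: tensDr.
  rewrite -{2}(fg m) cohom_coact tlift_tlift //.
  rewrite [LHS]tensor_sumE; apply: eq_bigr => p _.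
  by rewrite tliftE // /= gf.
by exists (ComodHom gco).
Qed.

(** The size of a flat basis drops along a proper subobject: a monomorphism keeps a flat basis
    independent, and equal sizes would make it an isomorphism. *)
Lemma subobject_chain_le n (M : comodule H) d (w : 'I_d -> kmod M) :
  flat_basis w -> subobject_chain n M -> (n <= d)%N.
Proof.
elim: n M d w => // n IH M d w bw [L [f [fm fi chL]]].
have [e [v bv]] := flat_basis_ex trG ev L; apply: (leq_ltn_trans (IH _ _ _ bv chL)).
have [fv iv _] := bv.
pose u i : kmod M := f (v i).
have fu i : flat (u i) by exact/flat_hom/fv.
have iu : indep u.
  move=> c c0; apply: iv; apply: (mono_flat_inj fm).
    by apply: (flat_lspan fv); exists c.
  by rewrite linear_sum -[RHS]c0; apply: eq_bigr => i _; rewrite linearZ.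
have le := flat_basis_size bw fu iu; rewrite ltn_neqAle le andbT; apply/eqP => ed.
apply: fi; subst e; apply: (flat_basis_iso bv (flat_basis_full bw fu iu)) => //.
Qed.

Lemma comodule_finite_length (M : comodule H) : finite_length M.
Proof.
have [d [w bw]] := flat_basis_ex trG ev M.
by exists d.+1 => /(subobject_chain_le bw); rewrite ltnn.
Qed.

(** A morphism is determined by its [d] by [e] scalar matrix in flat bases. A maximal independent
    family among the matrices that come from morphisms supplies the spanning morphisms. *)
Lemma comodule_fin_dim_hom (M N : comodule H) : fin_dim_hom M N.
Proof.
have [d [w bw]] := flat_basis_ex trG ev M; have [fw _ _] := bw.
have [e [v bv]] := flat_basis_ex trG ev N; have [_ _ sv] := bv.
pose D (c : 'rV[k]_(d * e)) := exists f : comod_hom M N, forall i,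
  f (w i) = \sum_j ((vec_mx c i j)%:A : B) *: (v j : N).
have [c _|n [u [_ Du _ su]]] := @max_indep k _ D (d * e) (delta_mx 0).
  by exists (c 0); exact: row_sum_delta.
have /choice[b bE] := Du; exists n, b => f.
have /choice[C CE] i : exists C : 'I_e -> k, f (w i) = \sum_j ((C j)%:A : B) *: (v j : N).
  exact/sv/flat_hom/fw.
have CE' i : f (w i) =
    \sum_j ((vec_mx (mxvec (\matrix_(i, j) C i j)) i j)%:A : B) *: (v j : N).
  by rewrite CE mxvecK; apply: eq_bigr => j _; rewrite mxE.
have [c cE] := su _ (ex_intro (fun f => _) f CE').
exists c.
have fb i : f (w i) = \sum_l ((c l)%:A : B) *: b l (w i).
  rewrite CE' cE.
  under [RHS]eq_bigr do rewrite bE scaler_sumr.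
  rewrite exchange_big; apply: eq_bigr => j _.
  rewrite linear_sum summxE !scaler_suml; apply: eq_bigr => l _.
  by rewrite linearZ mxE scalerA mulr_algl scalerA.
move=> m; have [a ->] := flat_basis_span bw m; rewrite linear_sum.
under [RHS]eq_bigr do rewrite linear_sum scaler_sumr.
rewrite exchange_big; apply: eq_bigr => i _.
rewrite linearZ /= fb scaler_sumr; apply: eq_bigr => l _.
by rewrite [in RHS]linearZ /= !scalerA [X in X *: _]mulrC.
Qed.
End Finiteness.

(** * Endomorphisms of the unit comodule and transitivity *)

Section UnitEndomorphisms.
Variables (k : fieldType) (G : groupoid).
Local Notation B := (mapalg k (gob_inh G)).
Variables (H : hopf_algebroid B) (ev : evaluation H).
Local Notation U := (comod_unit H).

Lemma unit_balanced : balanced (fun (r : B) (m : B^o) => r *: m)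
  (fun (r : B) (h : H) => htgt H r * h) (fun m h => htgt H m * h).
Proof.
split=> [m m' h|m h h'|r m h]; first by rewrite rmorphD mulrDl.
  exact: mulrDr.
by rewrite rmorphM mulrA [X in X * _]mulrC.
Qed.

Lemma hom_balanced (M N : comodule H) (f : {linear M -> N}) :
  balanced (fun (r : B) (m : M) => r *: m) (fun (r : B) (h : H) => htgt H r * h)
    (fun m h => tens (f m) h : cotens H N).
Proof.
split=> [a a' b|a b b'|r a b]; first by rewrite raddfD; exact: tensDl.
  exact: tensDr.
by rewrite linearZ; exact: tensA.
Qed.

(** Compatibility of [f] with the coaction at [1], pushed to [H] by [m, h |-> htgt H m * h], says
    that source and target agree on [f 1]. *)
Lemma unit_end_invariant (f : comod_hom U U) g : (f 1 : B) (gsrc g) = (f 1 : B) (gtgt g).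
Proof.
have e : hsrc H (f 1) = htgt H (f 1).
  have := congr1 (tlift (fun (m : B^o) h => htgt H m * h)) (cohom_coact f 1).
  rewrite [coact U 1]/(ucoact H 1) [coact U _]/(ucoact H _) /ucoact rmorph1.
  rewrite tliftE; last exact: unit_balanced.
  rewrite tliftE; last exact: (hom_balanced f).
  rewrite tliftE; last exact: unit_balanced.
  by rewrite rmorph1 mul1r mulr1.
by rewrite -(evl_src ev) -(evl_tgt ev) e.
Qed.

Section Multiplication.
Variable a : B.
Hypothesis aP : hsrc H a = htgt H a.
Definition umul (r : B^o) : B^o := r * a.
Fact umul_linear : linear umul.
Proof. by move=> c u v; rewrite /umul mulrDl -mulrA. Qed.
HB.instance Definition _ := GRing.isLinear.Build B B^o B^o _ umul umul_linear.
Fact umul_coact (m : B^o) :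
  coact U (umul m) = tlift (fun m' h => tens (umul m') h) (coact U m).
Proof.
rewrite [coact U m]/(ucoact H m) [coact U _]/(ucoact H _) /ucoact.
rewrite tliftE; last exact: (@hom_balanced U U umul).
have -> : hsrc H (umul m) = htgt H a * hsrc H m by rewrite /umul rmorphM /= aP mulrC.
have -> : umul 1 = a *: (1 : B^o) by rewrite /umul mul1r [RHS]mulr1.
exact: (esym (tensA (fun (r : B) (m : B^o) => r *: m) (fun r h => htgt H r * h) a _ _)).
Qed.
Definition umul_hom : comod_hom U U := @ComodHom _ _ _ U U umul umul_coact.
End Multiplication.

Lemma geom_transitive_transitive : geom_transitive H -> transitive_groupoid G.
Proof.
move=> [_ _ _ endU] x y.
(* The indicator function of the component of [x]. It is constant along arrows, so multiplication by
   it is an endomorphism of the unit, hence a scalar. *)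
pose a : B := fun z => if `[< exists g, gsrc g = x /\ gtgt g = z >] then 1 else 0.
have aP : hsrc H a = htgt H a.
  apply: (@evl_inj _ _ _ ev); apply/funext => g; rewrite evl_src evl_tgt /a.
  congr (if _ then _ else _); apply/asboolP/asboolP => -[h [hx hg]].
    by exists (cmp g h); rewrite cmp_src ?cmp_tgt ?hg.
  by exists (cmp (ginv g) h); rewrite cmp_src ?cmp_tgt ?gtgt_inv ?gsrc_inv ?hg.
have [c [cE _]] := endU (umul_hom aP).
have ac z : a z = c.
  have -> : a = (c%:A : B) *: (1 : B^o) by exact: (etrans (esym (mul1r a)) (cE 1)).
  exact: (etrans (mulr1 (c * 1)) (mulr1 c)).
have ax : a x = 1.
  by rewrite /a asboolT //; exists (gid x); rewrite gsrc_id gtgt_id.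
have := ac y; rewrite -(ac x) ax /a; case: asboolP => // _ /eqP.
by rewrite eq_sym oner_eq0.
Qed.

(** [f] is multiplication by [f 1], which is constant along arrows and hence equal to its value at
    the base point. *)
Lemma transitive_unit_end : transitive_groupoid G -> forall f : comod_hom U U,
  exists! c : k, forall r, f r = (c%:A : B) *: r.
Proof.
move=> trG f; exists ((f 1 : B) (base_ob G)); split=> [r|c cE].
  have {1}-> : r = (r : B) *: (1 : B^o) by exact: (esym (mulr1 r)).
  rewrite linearZ [LHS]mulrC; congr (_ * _); apply/funext => y.
  have [g [gx <-]] := trG (base_ob G) y.
  by rewrite -(unit_end_invariant f g) gx; exact: (esym (mulr1 _)).
by rewrite (cE 1); exact: (etrans (mulr1 (c * 1)) (mulr1 c)).
Qed.
End UnitEndomorphisms.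

(** * Projectivity over the enveloping algebra *)

Section LinearLift.
Variables (k : fieldType) (V W U : lmodType k).
Variables (q : {linear W -> U}) (f : {linear V -> U}).
Hypothesis q_onto : forall u, exists w, q w = u.

Definition partial_lift (R : set (V * W)) :=
  [/\ forall (c : k) u v, R u -> R v -> R (c *: u + v),
      forall p, R p -> q p.2 = f p.1
    & forall w, R (0, w) -> w = 0].

Lemma partial_lift_bigcup (F : set (set (V * W))) :
  (F `<=` partial_lift)%classic -> total_on F subset ->
  partial_lift (\bigcup_(X in F) X)%classic.
Proof.
move=> FP tF; split=> [c u v [X FX Xu] [Y FY Yv]|p [X FX Xp]|w [X FX Xw]].
- have [XY|YX] := tF X Y FX FY; [exists Y|exists X] => //.
    by have [cl _ _] := FP Y FY; apply: cl => //; exact: XY.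
  by have [cl _ _] := FP X FX; apply: cl => //; exact: YX.
- by have [_ qf _] := FP X FX; exact: qf.
- by have [_ _ fu] := FP X FX; exact: fu.
Qed.

Lemma linear_lift : exists g : {linear V -> W}, forall x, q (g x) = f x.
Proof.
have [R [[Rcl Rq Rf] Rmax]] := Zorn_bigcup partial_lift_bigcup.
have ext S : (R `<=` S)%classic -> partial_lift S -> (S `<=` R)%classic.
  by move=> RS PS; apply: contrapT => nSR; apply: (Rmax S) => //; split.
(* As the empty relation is a partial lift, maximality is used to see that [R] contains [0]. *)
have R0 : R 0.
  pose S p := R p \/ p = 0.
  apply: (ext S) => [p|  |]; [by left| |by right].
  split=> [c u v [Ru|->] [Rv|->]|p [/Rq //|->]|w [/Rf //|[]//]].
  - by left; exact: Rcl.
  - left; have -> : c *: u + 0 = (c - 1) *: u + u.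
      by rewrite scalerBl scale1r subrK addr0.
    exact: Rcl.
  - by rewrite scaler0 add0r; left.
  - by rewrite scaler0 add0r; right.
  - by rewrite !linear0.
have RZ c p : R p -> R (c *: p) by move=> Rp; rewrite -[_ *: _]addr0; exact: Rcl.
have RD p p' : R p -> R p' -> R (p + p') by rewrite -{2}[p]scale1r; exact: Rcl.
(* Otherwise the line through [(v, w)], with [q w = f v], could be added to [R]. *)
have tot v : exists w, R (v, w).
  apply: contrapT => nv; have [w wE] := q_onto (f v); apply: (nv); exists w.
  pose S p := exists a p', R p' /\ p = a *: (v, w) + p'.
  apply: (ext S) => [p Rp||]; last first.
  - by exists 1, 0; rewrite scale1r addr0.
  - split=> [c _ _ [a [p [Rp ->]]] [b [p' [Rp' ->]]]|_ [a [p [Rp ->]]]|w' [a [p [Rp e]]]].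
    + exists (c * a + b), (c *: p + p'); split; first exact: Rcl.
      by rewrite scalerDr scalerA scalerDl addrACA.
    + by rewrite /= !linearP Rq // wE.
    + have [a0|a0] := eqVneq a 0.
        by apply: Rf; rewrite e a0 scale0r add0r.
      case: nv; exists (- a^-1 *: p.2); move: e => [e1 e2].
      have -> : v = - a^-1 *: p.1.
        apply: (scalerI a0); rewrite scalerA mulrN divff // scaleN1r.
        by apply/eqP; rewrite -addr_eq0 -e1.
      by case: p Rp {e1 e2} => p1 p2 Rp; exact: (RZ (- a^-1) (p1, p2)).
  - by exists 0, p; rewrite scale0r add0r.
pose g v := sval (cid (tot v)).
have gR v : R (v, g v) by rewrite /g; case: cid.
have glin : linear g.
  move=> c u v; apply/eqP; rewrite -subr_eq0; apply/eqP/Rf.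
  have := Rcl (-1) _ _ (Rcl c _ _ (gR u) (gR v)) (gR (c *: u + v)).
  by rewrite [_ + _](_ : _ = (0, g (c *: u + v) - (c *: g u + g v))) //;
    congr (_, _); rewrite /= ?scaleN1r ?addNr // addrC.
pose gm := GRing.isLinear.Build k V W _ g glin.
pose gL : {linear V -> W} := HB.pack g gm.
by exists gL => x; exact: (Rq _ (gR x)).
Qed.
End LinearLift.

(** * The enveloping algebra as functions on pairs of objects *)

Section Envelope.
Variables (k : fieldType) (G : groupoid).
Local Notation B := (mapalg k (gob_inh G)).
Local Notation S := (envel B).

Definition env_ev (y x : gob G) (s : S) : k := tlift (fun a b : B => a y * b x) s.

Lemma env_ev_balanced y x : balanced (fun (c : k) (a : B) => a * in_alg B c)
  (fun (c : k) (b : B) => in_alg B c * b) (fun a b : B => a y * b x : k).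
Proof.
split=> [a a' b|a b b'|c a b]; first exact: mulrDl.
  exact: mulrDr.
exact: (esym (mulrA (a y) _ _)).
Qed.

Lemma env_evE y x a b : env_ev y x (tens a b) = a y * b x.
Proof. by rewrite /env_ev tliftE //; exact: env_ev_balanced. Qed.
Lemma env_ev_sum y x I (s : seq I) (F : I -> S) :
  env_ev y x (\sum_(i <- s) F i) = \sum_(i <- s) env_ev y x (F i).
Proof. by rewrite /env_ev tlift_sum //; exact: env_ev_balanced. Qed.
(** The argument of [ev2_eq0] with a single projection, whose scalar entries move across the tensor
    product over [k]. *)
Lemma env_ev_eq0 s : (forall y x, env_ev y x s = 0) -> s = 0.
Proof.
move=> s0; have [n [a [b sE]]] := tensor_fin s.
have [|P [Pa Pb]] := @annihilating_projection k n
    (fun u => exists y, u = \row_i a i y) (fun v => exists x, v = \col_i b i x).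
  move=> _ _ [y ->] [x ->]; apply/matrixP => i j; rewrite !mxE.
  rewrite -[RHS](s0 y x) sE env_ev_sum; apply: eq_bigr => l _.
  by rewrite env_evE !mxE.
have aP i : \sum_j a j * in_alg B (P j i) = 0.
  apply/funext => y; rewrite fct_sumE.
  have /rowP/(_ i) := Pa _ (ex_intro _ y erefl); rewrite !mxE => E; rewrite -[RHS]E.
  by apply: eq_bigr => j _; rewrite mxE; congr (_ * _); exact: mulr1.
have Pb' j : \sum_i in_alg B (P j i) * b i = b j.
  apply/funext => x; rewrite fct_sumE.
  have /colP/(_ j) := Pb _ (ex_intro _ x erefl); rewrite !mxE => E; rewrite -[RHS]E.
  by apply: eq_bigr => i _; rewrite mxE; congr (_ * _); exact: mulr1.
rewrite sE; under eq_bigr do rewrite -Pb' tens_sumr.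
rewrite exchange_big big1 // => i _; under eq_bigr do rewrite -ctensA.
by rewrite -tens_suml aP tens0l.
Qed.
End Envelope.

(** * Projectivity of [H] for a transitive groupoid *)

Section Projectivity.
Variables (k : fieldType) (G : groupoid) (trG : transitive_groupoid G).
Local Notation B := (mapalg k (gob_inh G)).
Variables (H : hopf_algebroid B) (ev : evaluation H).
Local Notation S := (envel B).
Local Notation conn := (conn trG).
Local Notation x0 := (base_ob G).
Local Notation P := (lrestr (@envel_map _ _ H)).

(** A retraction of the arrows onto the isotropy group of the base point. *)
Definition loop (g : garr G) := cmp (conn (gtgt g) x0) (cmp g (conn x0 (gsrc g))).

Local Ltac ends := repeat (rewrite ?conn_src ?conn_tgt ?gsrc_id ?gtgt_id;
  first [done | rewrite cmp_src | rewrite cmp_tgt]).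

Lemma loop_src g : gsrc (loop g) = x0.
Proof. by rewrite /loop; ends. Qed.
Lemma loop_tgt g : gtgt (loop g) = x0.
Proof. by rewrite /loop; ends. Qed.
Lemma loopK g : g = cmp (conn x0 (gtgt g)) (cmp (loop g) (conn (gsrc g) x0)).
Proof.
rewrite /loop -cmpA; try by ends.
rewrite cmpA; try by ends.
rewrite conn_comp conn_id -cmpA; try by ends.
rewrite conn_comp conn_id (cmp1 (x := gsrc g)) // cmp1l //.
Qed.
Lemma loop_id c : gsrc c = x0 -> gtgt c = x0 -> loop c = c.
Proof. by move=> cs ct; rewrite /loop cs ct !conn_id cmp1 // cmp1l. Qed.
Lemma loop_conn c x y : gsrc c = x0 -> gtgt c = x0 ->
  loop (cmp (conn x0 y) (cmp c (conn x x0))) = c.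
Proof.
move=> cs ct; have e1 : gsrc c = gtgt (conn x x0) by rewrite conn_tgt.
have e2 : gsrc (conn x0 y) = gtgt c by rewrite conn_src.
rewrite /loop (_ : gtgt _ = y); last by ends.
rewrite (_ : gsrc _ = x); last by ends.
rewrite (cmpA e2 e1) -[cmp (cmp _ (conn x x0)) _]cmpA; try by ends.
rewrite conn_comp conn_id cmp1; last by ends.
by rewrite cmpA; try ends; rewrite conn_comp conn_id cmp1l.
Qed.
(** With [g] and [h] factored as in [loopK], the connecting arrows between the two loops compose to
    the identity of [x0]. *)
Lemma loop_comp g h : gsrc g = gtgt h -> loop (cmp g h) = cmp (loop g) (loop h).
Proof.
move=> e; have := loopK g; have := loopK h.
have [] := (loop_src g, loop_tgt g); have [] := (loop_src h, loop_tgt h).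
move: (loop g) (loop h) => a b bs bt as_ at_ hE gE; rewrite [in LHS]gE [in LHS]hE.
have e1 : gsrc a = gtgt (conn (gsrc g) x0) by rewrite conn_tgt.
have e2 : gsrc (conn x0 (gtgt g)) = gtgt a by rewrite conn_src.
have e3 : gsrc b = gtgt (conn (gsrc h) x0) by rewrite conn_tgt.
have e4 : gsrc (conn x0 (gtgt h)) = gtgt b by rewrite conn_src.
have e5 : gsrc a = gtgt b by rewrite as_.
have e6 : gsrc (cmp a b) = gtgt (conn (gsrc h) x0) by rewrite cmp_src.
have e7 : gsrc (cmp a b) = x0 by rewrite cmp_src.
have e8 : gtgt (cmp a b) = x0 by rewrite cmp_tgt.
rewrite -[RHS](loop_conn (gsrc h) (gtgt g) e7 e8); congr loop.
have m1 : cmp (conn (gsrc g) x0) (conn x0 (gtgt h)) = gid x0.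
  by rewrite e conn_comp conn_id.
have m2 : gsrc (conn (gsrc g) x0) = gtgt (conn x0 (gtgt h)) by rewrite conn_src conn_tgt.
have m3 : gtgt (cmp b (conn (gsrc h) x0)) = x0 by rewrite cmp_tgt.
have m4 : gsrc (conn x0 (gtgt h)) = gtgt (cmp b (conn (gsrc h) x0)) by rewrite m3 conn_src.
have m5 : gtgt (cmp (conn x0 (gtgt h)) (cmp b (conn (gsrc h) x0))) = gtgt h.
  by rewrite cmp_tgt // conn_tgt.
have m6 : gsrc (conn (gsrc g) x0) = gtgt (cmp (conn x0 (gtgt h)) (cmp b (conn (gsrc h) x0))).
  by rewrite m5 conn_src.
rewrite -cmpA; last 2 first.
- by rewrite cmp_tgt.
- by rewrite cmp_src // m5 conn_src.
congr (cmp _ _); rewrite -(cmpA e1 m6) (cmpA m2 m4) m1 (cmp1l m3).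
exact: cmpA.
Qed.

Definition loop_fun (l : H) := forall g, ev l g = ev l (loop g).

(** As [loop] is multiplicative, composition with it preserves finite type. *)
Lemma loop_fun_ex h : exists2 l, loop_fun l & forall g, ev l g = ev h (loop g).
Proof.
have [|l lE] := evl_onto ev (F := fun g => ev h (loop g)).
  have [n [a [b hE]]] := tensor_fin (hdelta H h).
  exists n, (fun i g => ev (a i) (loop g)), (fun i g => ev (b i) (loop g)) => g g' e.
  have e' : gsrc (loop g) = gtgt (loop g') by rewrite loop_src loop_tgt.
  rewrite -(cmpE e) loop_comp // (cmpE e') -(evl_delta ev) hE.
  rewrite (ev2_sum (evl_src ev) (evl_tgt ev)) //; apply: eq_bigr => i _.
  by rewrite (ev2E (evl_src ev) (evl_tgt ev)).
exists l => g; last by rewrite lE.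
by rewrite lE [in RHS]loop_id ?loop_src ?loop_tgt.
Qed.

Lemma ev_envel s h g :
  ev (envel_map H s * h) g = env_ev (gtgt g) (gsrc g) s * ev h g.
Proof.
rewrite rmorphM [LHS]/(ev (envel_map H s) g * ev h g); congr (_ * _).
rewrite /envel_map /tlift /tens_sum ev_sumE; apply: eq_bigr => p _.
rewrite rmorphM [LHS]/(ev (htgt H p.1) g * ev (hsrc H p.2) g).
by rewrite evl_tgt evl_src.
Qed.

(* Apply [Delta] twice to [g = (x0 -> y) . loop g . (x -> x0)]. *)
Lemma loop_fun_span h : exists2 r : seq (S * H),
  forall p, p \in r -> loop_fun p.2 & h = \sum_(p <- r) envel_map H p.1 * p.2.
Proof.
pose Q (h : H) := exists2 r : seq (S * H),
  forall p, p \in r -> loop_fun p.2 & h = \sum_(p <- r) envel_map H p.1 * p.2.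
have Q0 : Q 0 by exists [::]; rewrite // big_nil.
have QD u v : Q u -> Q v -> Q (u + v).
  move=> [r1 f1 ->] [r2 f2 ->]; exists (r1 ++ r2); last by rewrite big_cat.
  by move=> p; rewrite mem_cat => /orP[/f1|/f2].
have [n [a [b hE]]] := tensor_fin (hdelta H h).
have /choice[fl flE] (l : H) : exists l', loop_fun l' /\ forall g, ev l' g = ev l (loop g).
  by have [l' f1 f2] := loop_fun_ex l; exists l'.
(* The outer factors of [g] depend only on its target and on its source, so evaluation on them gives
   functions on objects, and together an element of [S]. *)
pose al i : B := fun y => ev (a i) (conn x0 y).
pose ga (l : H) : B := fun x => ev l (conn x x0).
have -> : h = \sum_i \sum_(p <- repr (hdelta H (b i)))
    envel_map H (tens (al i) (ga p.2)) * fl p.1.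
  apply: (@evl_inj _ _ _ ev); apply/funext => g.
  have e1 : gsrc (loop g) = gtgt (conn (gsrc g) x0) by rewrite loop_src conn_tgt.
  have e2 : gsrc (conn x0 (gtgt g)) = gtgt (cmp (loop g) (conn (gsrc g) x0)).
    by rewrite conn_src cmp_tgt // loop_tgt.
  rewrite [in LHS](loopK g) (cmpE e2) -(evl_delta ev) hE.
  rewrite (ev2_sum (evl_src ev) (evl_tgt ev)) // ev_sumE; apply: eq_bigr => i _.
  rewrite (ev2E (evl_src ev) (evl_tgt ev)) // ev_sumE (cmpE e1) -(evl_delta ev).
  rewrite /ev2 /tlift /tens_sum mulr_sumr; apply: eq_bigr => p _.
  rewrite ev_envel env_evE (flE _).2 -[RHS]mulrA; congr (_ * _).
  exact: mulrC.
apply: (big_ind Q) => // i _; apply: (big_ind Q) => // p _.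
exists [:: (tens (al i) (ga p.2) : S, fl p.1)]; last by rewrite big_seq1.
by move=> p'; rewrite inE => /eqP -> /=; exact: (flE _).1.
Qed.

Definition env_scal (c : k) : S := tens (c%:A : B) (1 : B).
Fact env_scal_zmod : zmod_morphism env_scal.
Proof.
move=> c d; apply: (addIr (env_scal d)).
by rewrite subrK /env_scal -[LHS]tensDl -scalerDl subrK.
Qed.
Fact env_scal_monoid : monoid_morphism env_scal.
Proof.
split=> [|c d]; first by rewrite /env_scal scale1r.
by rewrite [RHS]ctensM mulr1 mulr_algl scalerA.
Qed.
HB.instance Definition _ := GRing.isZmodMorphism.Build k S env_scal env_scal_zmod.
HB.instance Definition _ := GRing.isMonoidMorphism.Build k S env_scal env_scal_monoid.

Lemma envel_scal c (h : H) : envel_map H (env_scal c) * h = c *: h.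
Proof.
rewrite /envel_map tliftE; last exact: envel_balanced.
by rewrite rmorph1 mulr1 linearZ rmorph1 mulr_algl.
Qed.

(** Loop functions independent over [k] are independent over [S]: with endpoints fixed, a relation
    over [S] becomes one over [k], tested on all loops. So every relation over [S] comes from
    [k]-linear ones, which [F] respects. *)
Lemma loop_fun_relation (N : lmodType S) (F : {linear H -> rmod N env_scal})
    (r : seq (S * H)) :
  (forall p, p \in r -> loop_fun p.2) -> \sum_(p <- r) envel_map H p.1 * p.2 = 0 ->
  \sum_(p <- r) p.1 *: (F p.2 : N) = 0.
Proof.
move=> fr; rewrite [X in X = 0 -> _]big_tnth [X in _ -> X = 0]big_tnth.
set n := size r; have fl i : loop_fun (tnth (in_tuple r) i).2 by apply: fr; exact: mem_tnth.
move: fl; pose s i := (tnth (in_tuple r) i).1; pose l i := (tnth (in_tuple r) i).2.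
rewrite -/(forall i, loop_fun (l i)) => fl.
rewrite -[X in X = 0 -> _]/(\sum_i envel_map H (s i) * l i).
rewrite -[X in _ -> X = 0]/(\sum_i s i *: (F (l i) : N)) => e.
have [_ [i ->]|d [u [_ Du iu su]]] := @max_indep k H (fun v => exists i, v = l i) n l.
  exact: lspan_mem.
have fu j : loop_fun (u j) by have [i ->] := Du j.
have /choice[C CE] i : exists c, l i = \sum_j c j *: u j by apply: su; exists i.
pose t j := \sum_i s i * env_scal (C i j).
have tu : \sum_j envel_map H (t j) * u j = 0.
  rewrite -[RHS]e; under [RHS]eq_bigr do rewrite CE mulr_sumr.
  rewrite exchange_big; apply: eq_bigr => j _; rewrite /t rmorph_sum mulr_suml.
  by apply: eq_bigr => i _; rewrite rmorphM -mulrA envel_scal.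
have t0 j : t j = 0.
  apply: env_ev_eq0 => y x; apply: (iu (fun j => env_ev y x (t j))).
  apply: (@evl_inj _ _ _ ev); apply/funext => g0; rewrite [in RHS]raddf0 ev_sumE.
  have := loop_src g0; have := loop_tgt g0; set c := loop g0 => ct cs.
  (* The arrow from [x] to [y] whose loop is [c]. *)
  pose g := cmp (conn x0 y) (cmp c (conn x x0)).
  have gy : gtgt g = y by rewrite /g; ends.
  have gx : gsrc g = x by rewrite /g; ends.
  have := congr1 (fun h => ev h g) tu; rewrite /= ev_sumE.
  rewrite (raddf0 ev : ev 0 = 0) => E; rewrite -[RHS]E.
  apply: eq_bigr => i _; rewrite linearZ ev_envel gy gx; congr (_ * _).
  exact: (etrans (fu i g0) (etrans (congr1 _ (esym (loop_conn x y cs ct))) (esym (fu i g)))).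
transitivity (\sum_i \sum_j (s i * env_scal (C i j)) *: (F (u j) : N)).
  apply: eq_bigr => i _; rewrite CE linear_sum scaler_sumr; apply: eq_bigr => j _.
  by rewrite linearZ [LHS]scalerA.
by rewrite exchange_big big1 // => j _; rewrite -scaler_suml -/(t j) t0 scale0r.
Qed.

(** Loop functions generate [H] over [S]. A [k]-linear lift [F] is used on them only and extended
    over [S] through a chosen decomposition [r h]; [loop_fun_relation] makes the extension
    linear. *)
Lemma envel_projective : projective P.
Proof.
move=> N M q f q_onto.
have ql : linear (fun n : rmod N env_scal => q n : rmod M env_scal).
  by move=> c u v; rewrite linearP.
have fl : linear (fun h : H => f (h : P) : rmod M env_scal).
  move=> c u v; rewrite -[_ *: u]envel_scal.
  exact: (linearP f (env_scal c) (u : P) (v : P)).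
pose qm := GRing.isLinear.Build k _ _ _ _ ql.
pose qk : {linear rmod N env_scal -> rmod M env_scal} :=
  HB.pack (fun n : rmod N env_scal => q n : rmod M env_scal) qm.
pose fm := GRing.isLinear.Build k _ _ _ _ fl.
pose fk : {linear H -> rmod M env_scal} :=
  HB.pack (fun h : H => f (h : P) : rmod M env_scal) fm.
have [F FE] := @linear_lift k _ _ _ qk fk q_onto.
have /choice[r rP] (h : H) : exists r : seq (S * H),
    (forall p, p \in r -> loop_fun p.2) /\ h = \sum_(p <- r) envel_map H p.1 * p.2.
  by have [r r1 r2] := loop_fun_span h; exists r.
pose g (h : P) : N := \sum_(p <- r h) p.1 *: (F p.2 : N).
have glin : linear g.
  move=> s u v; apply/eqP; rewrite eq_sym -subr_eq0; apply/eqP.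
  (* The decompositions of [u] scaled by [s], of [v], and of [s *: u + v] with opposite sign
     together form a relation. *)
  have := @loop_fun_relation N F ([seq (s * p.1, p.2) | p <- r u] ++ r v ++
    [seq (- p.1, p.2) | p <- r (s *: u + v)]).
  rewrite !big_cat !big_map /=.
  under eq_bigr do rewrite rmorphM -mulrA.
  under [X in _ + (_ + X) = 0 -> _]eq_bigr do rewrite rmorphN mulNr.
  rewrite -mulr_sumr sumrN -!(rP _).2 => E.
  rewrite -[RHS]E; first last.
  - by rewrite addrA subrr.
  - move=> p; rewrite !mem_cat => /or3P[/mapP[p' + ->]|+|/mapP[p' + ->]];
      exact: (rP _).1.
  rewrite /g addrA scaler_sumr -sumrN; congr (_ + _ + _); apply: eq_bigr => p _.
    by rewrite scalerA.
  by rewrite scaleNr.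
pose gm := GRing.isLinear.Build S P N _ g glin.
pose gL : {linear P -> N} := HB.pack g gm.
exists gL => h; rewrite /= /g linear_sum [in RHS](rP h).2.
rewrite -[RHS]/(f (\sum_(p <- r h) p.1 *: (p.2 : P))) linear_sum.
apply: eq_bigr => p _; rewrite !linearZ; congr (_ *: _).
exact: FE.
Qed.
End Projectivity.

(** * Geometric transitivity and the duality *)

Lemma geom_transitiveP (k : fieldType) (G : groupoid)
    (H : hopf_algebroid (mapalg k (gob_inh G))) (ev : evaluation H) :
  geom_transitive H <-> transitive_groupoid G.
Proof.
split=> [|trG]; first exact: (geom_transitive_transitive ev).
split.
- exact: (envel_projective trG ev).
- exact: (comodule_finite_length trG ev).
- exact: (comodule_fin_dim_hom trG ev).
- exact: (transitive_unit_end ev trG).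
Qed.

(** [RR] is any choice of models of the coend. As [rep_chalgd (RR G)] is geometrically transitive
    exactly when [G] is transitive, [Phi] is stated on [chalgd_hom]; for transitive [G] these are
    the morphisms of the full subcategory. *)
Theorem theoremI (k : fieldType) :
  (forall G : groupoid, inhabited (rep_functions k G)) /\
  forall RR : (forall G : groupoid, rep_functions k G),
    (forall G : groupoid, geom_transitive (RR G) <-> transitive_groupoid G) /\
    exists Rmap : (forall G H : groupoid, grpd_hom G H ->
                     chalgd_hom (rep_chalgd (RR H)) (rep_chalgd (RR G))),
      [/\ forall (G H : groupoid) (p : grpd_hom G H), is_rep_map p (Rmap G H p),
          forall G : groupoid,
            Rmap G G (grpd_idm G) = chalgd_idm (rep_chalgd (RR G)),
          forall (G H K : groupoid) (q : grpd_hom H K) (p : grpd_hom G H),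
            Rmap G K (grpd_comp q p) = chalgd_comp (Rmap G H p) (Rmap H K q)
        & exists Phi : (forall (A : gtchalgd k) (G : groupoid),
              chalgd_hom A (rep_chalgd (RR G)) -> grpd_hom G (char_groupoid A)),
            [/\ forall (A : gtchalgd k) (G : groupoid), bijective (Phi A G),
                forall (A A' : gtchalgd k) (G : groupoid) (u : chalgd_hom A' A)
                  (f : chalgd_hom A (rep_chalgd (RR G))),
                  Phi A' G (chalgd_comp f u) =
                  grpd_comp (char_map u) (Phi A G f)
              & forall (A : gtchalgd k) (G G' : groupoid) (p : grpd_hom G' G)
                  (f : chalgd_hom A (rep_chalgd (RR G))),
                  Phi A G' (chalgd_comp (Rmap G' G p) f) =
                  grpd_comp (Phi A G f) p]].
Proof.
split=> [G|RR]; first by exists; exact: rc_rep_functions.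
split=> [G|]; first exact: geom_transitiveP (rep_evaluation (RR G)).
exists (fun G H p => rep_map (RR G) (RR H) p); split=> [G H p|G|G H K q p|].
- exact: rep_map_is_rep_map.
- exact: rep_map_id.
- exact: rep_map_comp.
exists (fun A G => @adj k G (RR G) A); split=> [A G|A A' G u f|A G G' p f].
- exact: adj_bij.
- exact: adj_naturall.
- exact: adj_naturalr.
Qed.
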